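(* Let $\Lambda$ be a continuous bilinear form on $V$. Then the product $\star_\Lambda$ on $\mathcal{S}^\bullet(V)$ is continuous and $\big(\mathcal{S}^\bullet(V),\star_\Lambda\big)$ is a locally convex algebra. Moreover, for fixed tensors $X,Y$ from the completion $\mathcal{S}^\bullet(V)^{\mathrm{cpl}}$, the product $X\star_{z\Lambda}Y$ (i.e. the series defining it) converges absolutely and locally uniformly in $z\in\mathbb{C}$ and thus depends holomorphically on $z$.
   Context: $V$ is a complex Hausdorff locally convex space whose topology is given by its continuous Hilbert seminorms: let $\mathcal{I}_V$ be the set of continuous positive Hermitian forms $\langle\cdot\,|\,\cdot\rangle_\alpha$ on $V$ (sesquilinear, antilinear in the first argument, Hermitian, positive semi-definite), put $\|v\|_\alpha:=\sqrt{\langle v|v\rangle_\alpha}$, and let $\mathcal{P}_V$ be the set of all these seminorms; it is assumed that $\mathcal{P}_V$ is cofinal in the set of all continuous seminorms on $V$. Let $\mathcal{T}^k_{\mathrm{alg}}(V)$ be the algebraic $k$-th tensor power ($\mathcal{T}^0_{\mathrm{alg}}(V)=\mathbb{C}$), $\mathcal{T}^\bullet_{\mathrm{alg}}(V)=\bigoplus_{k\ge 0}\mathcal{T}^k_{\mathrm{alg}}(V)$, and $\langle X\rangle_k$ the degree-$k$ component of $X$. Each $\langle\cdot|\cdot\rangle_\alpha\in\mathcal{I}_V$ is extended to a positive Hermitian form $\langle X|Y\rangle_\alpha^\bullet:=\sum_{k}\langle\langle X\rangle_k|\langle Y\rangle_k\rangle_\alpha^\bullet$ on $\mathcal{T}^\bullet_{\mathrm{alg}}(V)$,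 where $\langle x_1\otimes\cdots\otimes x_k|y_1\otimes\cdots\otimes y_k\rangle_\alpha^\bullet:=k!\prod_{m=1}^k\langle x_m|y_m\rangle_\alpha$; set $\|X\|_\alpha^\bullet:=\sqrt{\langle X|X\rangle_\alpha^\bullet}$. $\mathcal{T}^\bullet(V)$ is $\mathcal{T}^\bullet_{\mathrm{alg}}(V)$ with the locally convex topology defined by all seminorms $\|\cdot\|_\alpha^\bullet$, $\|\cdot\|_\alpha\in\mathcal{P}_V$. Let $\mathrm{Sym}^\bullet$ be the symmetrisation operator, $\mathrm{Sym}^\bullet(x_1\otimes\cdots\otimes x_k)=\frac1{k!}\sum_{\sigma\in\mathfrak{S}_k}x_{\sigma(1)}\otimes\cdots\otimes x_{\sigma(k)}$, and let $\mathcal{S}^\bullet(V)$ be its image (the symmetric tensors) with the subspace topology; $\mathcal{S}^\bullet(V)^{\mathrm{cpl}}$ is its completion. For a continuous bilinear form $\Lambda$ on $V$, let $P_\Lambda$ be the linear map $\mathcal{T}^\bullet(V)\otimes_\pi\mathcal{T}^\bullet(V)\to\mathcal{T}^{\bullet-1}(V)\otimes_\pi\mathcal{T}^{\bullet-1}(V)$ ($\otimes_\pi$: projective tensor product) with $P_\Lambda\big((x_1\otimes\cdots\otimes x_k)\otimes_\pi(y_1\otimes\cdots\otimes y_\ell)\big)=k\ell\,\Lambda(x_k,y_1)\,(x_1\otimes\cdots\otimes x_{k-1})\otimes_\pi(y_2\otimes\cdots\otimes y_\ell)$ for $k,\ell\ge1$, and zero if $k=0$ or $\ell=0$. With $\mu_\vee(X\otimes_\pi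 Y):=\mathrm{Sym}^\bullet(X\otimes Y)$, the product is $$X\star_\Lambda Y:=\sum_{t=0}^\infty\frac1{t!}\,\mu_\vee\big((P_\Lambda)^t(X\otimes_\pi Y)\big)$$ for $X,Y\in\mathcal{S}^\bullet(V)$. Continuous (multi)linear maps are extended to completions by continuity. *)

(* Defs.v *)
From HB Require Import structures.
From mathcomp Require Import all_boot all_order all_fingroup all_algebra.
From mathcomp Require Import generic_quotient sesquilinear.
From mathcomp Require Import complex.
From mathcomp Require Import all_classical all_reals all_analysis.

Set Implicit Arguments.
Unset Strict Implicit.
Unset Printing Implicit Defensive.

Import Order.TTheory GRing.Theory Num.Theory.

Local Open Scope classical_set_scope.
Local Open Scope ring_scope.
Local Open Scope quotient_scope.

(* Vector spaces presented by generators and relations: formal linear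
   combinations of elements of G, two of which are identified when they have
   the same value under every map from G to a vector space that satisfies the
   relations. *)
Section Presented.
Variables (K : fieldType) (G : choiceType).

Local Notation formal := (seq (K * G)).

Definition evalf (E : lmodType K) (f : G -> E) (s : formal) : E :=
  \sum_(p <- s) p.1 *: f p.2.

Variable rel : formal -> formal -> Prop.

Definition respects (E : lmodType K) (f : G -> E) :=
  forall s t, rel s t -> evalf f s = evalf f t.

Definition presentedb (s t : formal) : bool :=
  `[< forall (E : lmodType K) (f : G -> E),
        respects f -> evalf f s = evalf f t >].

Fact presentedb_refl : reflexive presentedb.
Proof. by move=> s; apply/asboolP. Qed.

Fact presentedb_sym : symmetric presentedb.
Proof.
by move=> s t; apply/asboolP/asboolP => st E f fr; rewrite (st E f fr).
Qed.

Fact presentedb_trans : transitive presentedb.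
Proof.
move=> t s r /asboolP st /asboolP tr; apply/asboolP => E f fr.
by rewrite (st E f fr) (tr E f fr).
Qed.

Canonical presentedb_equiv :=
  EquivRel presentedb presentedb_refl presentedb_sym presentedb_trans.

Definition presented : Type := {eq_quot presentedb}.
HB.instance Definition _ : EqQuotient _ presentedb presented :=
  EqQuotient.on presented.
HB.instance Definition _ := Choice.on presented.

Definition gen (g : G) : presented := \pi_presented [:: (1, g)].

Definition plift (E : lmodType K) (f : G -> E) (X : presented) : E :=
  evalf f (repr X).

Lemma evalf_pi (E : lmodType K) (f : G -> E) (s : formal) :
  respects f -> plift f (\pi_presented s) = evalf f s.
Proof.
move=> fr; have : presentedb (repr (\pi_presented s)) s.
  by apply/eqmodP; rewrite reprK.
by move=> /asboolP; exact.
Qed.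

Let evalf_cat (E : lmodType K) (f : G -> E) s t :
  evalf f (s ++ t) = evalf f s + evalf f t.
Proof. by rewrite /evalf big_cat. Qed.

Definition fscale (a : K) (s : formal) : formal :=
  [seq (a * p.1, p.2) | p <- s].

Let evalf_scale (E : lmodType K) (f : G -> E) a s :
  evalf f (fscale a s) = a *: evalf f s.
Proof.
rewrite /evalf big_map scaler_sumr; apply: eq_bigr => p _.
by rewrite scalerA.
Qed.

Let pi_ext s t :
  (forall (E : lmodType K) (f : G -> E), respects f ->
     evalf f s = evalf f t) -> \pi_presented s = \pi_presented t.
Proof. by move=> st; apply/eqmodP/asboolP. Qed.

Definition padd (X Y : presented) : presented :=
  \pi_presented (repr X ++ repr Y).
Definition pscale (a : K) (X : presented) : presented :=
  \pi_presented (fscale a (repr X)).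
Definition popp (X : presented) : presented := pscale (-1) X.
Definition pzero : presented := \pi_presented [::].

Let pliftD (E : lmodType K) (f : G -> E) X Y :
  respects f -> plift f (padd X Y) = plift f X + plift f Y.
Proof. by move=> fr; rewrite evalf_pi // evalf_cat. Qed.

Let pliftZ (E : lmodType K) (f : G -> E) a X :
  respects f -> plift f (pscale a X) = a *: plift f X.
Proof. by move=> fr; rewrite evalf_pi // evalf_scale. Qed.

Let plift0 (E : lmodType K) (f : G -> E) :
  respects f -> plift f pzero = 0.
Proof. by move=> fr; rewrite evalf_pi // /evalf big_nil. Qed.

Let pres_ext X Y :
  (forall (E : lmodType K) (f : G -> E), respects f ->
     plift f X = plift f Y) -> X = Y.
Proof. by move=> XY; rewrite -[X]reprK -[Y]reprK; apply: pi_ext. Qed.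

Fact paddA : associative padd.
Proof. by move=> *; apply: pres_ext => E f fr; rewrite !pliftD // addrA. Qed.
Fact paddC : commutative padd.
Proof. by move=> *; apply: pres_ext => E f fr; rewrite !pliftD // addrC. Qed.
Fact padd0 : left_id pzero padd.
Proof. by move=> *; apply: pres_ext => E f fr; rewrite !pliftD // plift0 // add0r. Qed.
Fact paddN : left_inverse pzero popp padd.
Proof.
move=> *; apply: pres_ext => E f fr.
by rewrite pliftD // pliftZ // plift0 // scaleN1r addNr.
Qed.

HB.instance Definition _ :=
  GRing.isZmodule.Build presented paddA paddC padd0 paddN.

Fact pscaleA a b X : pscale a (pscale b X) = pscale (a * b) X.
Proof. by apply: pres_ext => E f fr; rewrite !pliftZ // scalerA. Qed.
Fact pscale1 : left_id 1 pscale.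
Proof. by move=> *; apply: pres_ext => E f fr; rewrite pliftZ // scale1r. Qed.
Fact pscaleDr : right_distributive pscale +%R.
Proof.
move=> *; apply: pres_ext => E f fr.
by rewrite /GRing.add /= !(pliftZ, pliftD) // scalerDr.
Qed.
Fact pscaleDl X : {morph pscale^~ X : a b / a + b}.
Proof.
move=> a b; apply: pres_ext => E f fr.
by rewrite [in RHS]/GRing.add /= !(pliftZ, pliftD) // scalerDl.
Qed.

HB.instance Definition _ := GRing.Zmodule_isLmodule.Build K presented
  pscaleA pscale1 pscaleDr pscaleDl.

Lemma plift_linear (E : lmodType K) (f : G -> E) :
  respects f -> linear (plift f).
Proof. by move=> fr a X Y; rewrite [LHS]pliftD // pliftZ. Qed.

Lemma plift_gen (E : lmodType K) (f : G -> E) g :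
  respects f -> plift f (gen g) = f g.
Proof. by move=> fr; rewrite evalf_pi // /evalf big_seq1 scale1r. Qed.

Lemma pi_evalf s : \pi_presented s = evalf gen s.
Proof.
apply: pres_ext => E f fr; rewrite evalf_pi // /evalf.
elim: s => [|p s IH]; first by rewrite !big_nil plift0.
by rewrite !big_cons addrC [RHS]pliftD // -IH pliftZ // plift_gen // addrC.
Qed.

Lemma gen_respects : respects gen.
Proof.
move=> s t st; rewrite -!pi_evalf; apply: pi_ext => E f fr; exact: fr.
Qed.

Lemma presented_ind (P : presented -> Prop) :
  P 0 -> (forall a g X, P X -> P (a *: gen g + X)) -> forall X, P X.
Proof.
move=> P0 Pcons X; rewrite -[X]reprK pi_evalf /evalf.
elim: (repr X) => [|p s IH]; first by rewrite big_nil.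
by rewrite big_cons; apply: Pcons.
Qed.

End Presented.

Lemma plift_fun (K : fieldType) (G : choiceType)
    (rel : seq (K * G) -> seq (K * G) -> Prop) (E : lmodType K)
    (a : K) (f g : G -> E) (X : presented rel) :
  plift (fun x => a *: f x + g x) X = a *: plift f X + plift g X.
Proof.
rewrite /plift /evalf scaler_sumr -big_split /=; apply: eq_bigr => p _.
by rewrite scalerDr !scalerA mulrC.
Qed.

(* The algebraic tensor product, which is the vector space underlying the
   projective tensor product. *)
Section TensorProduct.
Variables (K : fieldType) (M N : lmodType K).

Inductive tprod_rel : seq (K * (M * N)) -> seq (K * (M * N)) -> Prop :=
| TprodRelL a x x' y :
    tprod_rel [:: (1, (a *: x + x', y))] [:: (a, (x, y)); (1, (x', y))]
| TprodRelR a x y y' :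
    tprod_rel [:: (1, (x, a *: y + y'))] [:: (a, (x, y)); (1, (x, y'))].

Definition tprod : Type := presented tprod_rel.
HB.instance Definition _ := GRing.Lmodule.on tprod.

Definition tens (x : M) (y : N) : tprod := gen tprod_rel (x, y).

Definition tprod_lift (E : lmodType K) (f : M -> N -> E) (Z : tprod) : E :=
  plift (fun p => f p.1 p.2) Z.

Lemma tprod_respects (E : lmodType K) (f : M -> N -> E) :
  bilinear_for *:%R *:%R f -> respects tprod_rel (fun p => f p.1 p.2).
Proof.
case=> fl fr s t [a x x' y|a x y y']; rewrite /evalf !big_cons !big_nil /=;
  rewrite !addr0 !scale1r; [exact: fl|exact: fr].
Qed.

Lemma tprod_lift_linear (E : lmodType K) (f : M -> N -> E) :
  bilinear_for *:%R *:%R f -> linear (tprod_lift f).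
Proof. by move=> fb; apply: plift_linear; apply: tprod_respects. Qed.

Lemma tprod_liftE (E : lmodType K) (f : M -> N -> E) x y :
  bilinear_for *:%R *:%R f -> tprod_lift f (tens x y) = f x y.
Proof. by move=> fb; rewrite /tprod_lift plift_gen //; apply: tprod_respects. Qed.

Lemma tens_bilinear : bilinear_for *:%R *:%R tens.
Proof.
split=> [y a x x'|x a y y'].
  have := gen_respects (TprodRelL a x x' y).
  by rewrite /evalf !big_cons !big_nil !addr0 !scale1r.
have := gen_respects (TprodRelR a x y y').
by rewrite /evalf !big_cons !big_nil !addr0 !scale1r.
Qed.

End TensorProduct.

(* The algebraic tensor algebra, i.e. the direct sum of the tensor powers of V:
   the word [:: x_1; ...; x_k] stands for x_1 (x) ... (x) x_k, and the empty
   word for 1 in degree 0. The relations are homogeneous for the length of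
   words, so words of length k span the k-th tensor power. *)
Section TensorAlgebra.
Variables (K : fieldType) (V : lmodType K).

Inductive tensor_rel : seq (K * seq V) -> seq (K * seq V) -> Prop :=
| TensorRel (u w : seq V) a x y :
    tensor_rel [:: (1, u ++ (a *: x + y) :: w)]
               [:: (a, u ++ x :: w); (1, u ++ y :: w)].

Definition tensor : Type := presented tensor_rel.
HB.instance Definition _ := GRing.Lmodule.on tensor.

Definition word (w : seq V) : tensor := gen tensor_rel w.

Definition multilinear (E : lmodType K) (f : seq V -> E) :=
  forall (u w : seq V) a x y,
    f (u ++ (a *: x + y) :: w) = a *: f (u ++ x :: w) + f (u ++ y :: w).

Lemma tensor_respects (E : lmodType K) (f : seq V -> E) :
  multilinear f -> respects tensor_rel f.
Proof.
move=> fm s t [u w a x y]; rewrite /evalf !big_cons !big_nil /=.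
by rewrite !addr0 !scale1r.
Qed.

Lemma word_multilinear : multilinear word.
Proof.
move=> u w a x y; have := gen_respects (TensorRel u w a x y).
by rewrite /evalf !big_cons !big_nil !addr0 !scale1r.
Qed.

Definition tensor_lift (E : lmodType K) (f : seq V -> E) : tensor -> E :=
  plift f.

Definition tensor_lift2 (E : lmodType K) (f : seq V -> seq V -> E)
    (X Y : tensor) : E :=
  tensor_lift (fun u => tensor_lift (fun w => f u w) Y) X.

Lemma tensor_lift_linear (E : lmodType K) (f : seq V -> E) :
  multilinear f -> linear (tensor_lift f).
Proof. by move=> fm; apply: plift_linear; apply: tensor_respects. Qed.

Lemma tensor_liftE (E : lmodType K) (f : seq V -> E) w :
  multilinear f -> tensor_lift f (word w) = f w.
Proof. by move=> fm; rewrite /tensor_lift plift_gen //; apply: tensor_respects. Qed.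

Lemma tensor_lift2_respects (E : lmodType K) (f : seq V -> seq V -> E) Y :
  (forall w, multilinear (f^~ w)) ->
  multilinear (fun u => tensor_lift (fun w => f u w) Y).
Proof.
move=> fl u w a x y; rewrite -plift_fun; congr plift.
by apply/funext => w'; exact: fl.
Qed.

Lemma tensor_lift2_bilinear (E : lmodType K) (f : seq V -> seq V -> E) :
  (forall w, multilinear (f^~ w)) -> (forall u, multilinear (f u)) ->
  bilinear_for *:%R *:%R (tensor_lift2 f).
Proof.
move=> fl fr; split=> [Y|X].
  by apply: tensor_lift_linear; apply: tensor_lift2_respects.
move=> a Y Y'; rewrite /= /tensor_lift2 -plift_fun; congr plift.
by apply/funext => u; apply: tensor_lift_linear.
Qed.

Lemma tensor_lift2E (E : lmodType K) (f : seq V -> seq V -> E) u w :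
  (forall w, multilinear (f^~ w)) -> (forall u, multilinear (f u)) ->
  tensor_lift2 f (word u) (word w) = f u w.
Proof.
move=> fl fr; rewrite /tensor_lift2 tensor_liftE ?tensor_liftE //.
exact: tensor_lift2_respects.
Qed.

Definition tmul : tensor -> tensor -> tensor :=
  tensor_lift2 (fun u w => word (u ++ w)).

Let cat_multil w : multilinear (fun u => word (u ++ w)).
Proof. by move=> u v a x y; rewrite -!catA !cat_cons word_multilinear. Qed.

Let cat_multir u : multilinear (fun w => word (u ++ w)).
Proof. by move=> v w a x y; rewrite !catA word_multilinear. Qed.

Lemma tmul_bilinear : bilinear_for *:%R *:%R tmul.
Proof. exact: tensor_lift2_bilinear. Qed.

Lemma tmul_word u w : tmul (word u) (word w) = word (u ++ w).
Proof. exact: tensor_lift2E. Qed.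

Definition sym_word (w : seq V) : tensor :=
  (size w)`!%:R^-1 *:
    \sum_(s : 'S_(size w)) word [seq nth 0 w (s i) | i : 'I_(size w)].

Definition Symop : tensor -> tensor := tensor_lift sym_word.

Lemma sym_word_multilinear : multilinear sym_word.
Proof.
move=> u w a x y.
pose n := size (u ++ x :: w).
have symE z : sym_word (u ++ z :: w) =
    n`!%:R^-1 *: \sum_(s : 'S_n) word [seq nth 0 (u ++ z :: w) (s i) | i : 'I_n].
  by rewrite /sym_word; have -> : size (u ++ z :: w) = n by rewrite /n !size_cat.
rewrite !symE scalerA mulrC -scalerA -scalerDr; congr (_ *: _).
rewrite scaler_sumr -big_split /=; apply: eq_bigr => s _.
have un : (size u < n)%N by rewrite /n size_cat /= addnS ltnS leq_addr.
pose i0 : 'I_n := (s^-1)%g (Ordinal un).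
have si0 : s i0 = Ordinal un by rewrite /i0 permKV.
have := enum_uniq 'I_n; rewrite /image_mem.
have : i0 \in enum 'I_n by rewrite mem_enum.
case/splitPr => p1 p2; rewrite cat_uniq /= negb_or -!andbA.
case/and5P => _ i01 _ i02 _.
have neq z z' i : i != i0 ->
    nth 0 (u ++ z :: w) (s i) = nth 0 (u ++ z' :: w) (s i).
  move=> ii0; rewrite !nth_cat; case: ltngtP => //= h.
    by rewrite -(subnSK h) /=.
  case/eqP: ii0; apply: (@perm_inj _ s); rewrite si0; exact: val_inj.
have e1 z : [seq nth 0 (u ++ z :: w) (s i) | i <- p1] =
    [seq nth 0 (u ++ x :: w) (s i) | i <- p1].
  apply/eq_in_map => i ip; apply: neq.
  by apply: contraNneq i01 => <-.
have e2 z : [seq nth 0 (u ++ z :: w) (s i) | i <- p2] =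
    [seq nth 0 (u ++ x :: w) (s i) | i <- p2].
  apply/eq_in_map => i ip; apply: neq.
  by apply: contraNneq i02 => <-.
rewrite !map_cat /= !si0 /= !nth_cat ltnn subnn /= !(e1 (_ + _), e1 y).
by rewrite !(e2 (_ + _), e2 y) word_multilinear.
Qed.

Lemma Symop_linear : linear Symop.
Proof. exact/tensor_lift_linear/sym_word_multilinear. Qed.

Lemma Symop_word w : Symop (word w) = sym_word w.
Proof. exact/tensor_liftE/sym_word_multilinear. Qed.

Definition is_symmetric : {pred tensor} :=
  [pred X | `[< exists Y, X = Symop Y >]].

Fact is_symmetric_submod : submod_closed is_symmetric.
Proof.
split.
  by apply/asboolP; exists 0; rewrite -[in RHS](subrr (0 : tensor))
     -scaleN1r addrC Symop_linear scaleN1r addNr.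
move=> a X Y /asboolP[X' ->] /asboolP[Y' ->].
by apply/asboolP; exists (a *: X' + Y'); rewrite Symop_linear.
Qed.

HB.instance Definition _ :=
  GRing.isSubmodClosed.Build K tensor is_symmetric is_symmetric_submod.

Record symtensor : Type := SymTensor {
  symval : tensor;
  symvalP : symval \in is_symmetric }.

HB.instance Definition _ := [isSub for symval].
HB.instance Definition _ := [Choice of symtensor by <:].
HB.instance Definition _ := [SubChoice_isSubLmodule of symtensor by <:].

Lemma Symop_is_symmetric X : Symop X \in is_symmetric.
Proof. by apply/asboolP; exists X. Qed.

Definition symproj (X : tensor) : symtensor :=
  SymTensor (Symop_is_symmetric X).

Lemma symproj_linear : linear symproj.
Proof. by move=> a X Y; apply: val_inj; rewrite /= Symop_linear. Qed.

Definition mu_vee : tprod tensor tensor -> symtensor :=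
  tprod_lift (fun X Y => symproj (tmul X Y)).

Let symproj_tmul_bilinear :
  bilinear_for *:%R *:%R (fun X Y => symproj (tmul X Y)).
Proof.
have [ml mr] := tmul_bilinear; split=> [Y|X] a Z Z' /=.
  by rewrite -symproj_linear; congr symproj; exact: ml.
by rewrite -symproj_linear; congr symproj; exact: mr.
Qed.

Lemma mu_vee_linear : linear mu_vee.
Proof. exact: tprod_lift_linear. Qed.

Lemma mu_vee_tens X Y : symval (mu_vee (tens X Y)) = Symop (tmul X Y).
Proof. by rewrite /mu_vee tprod_liftE. Qed.

Section StarProduct.
Variable Lam : V -> V -> K^o.

(* On words u = x_1 ... x_k and w = y_1 ... y_l this is
   k l Lam(x_k, y_1) (x_1 ... x_(k-1)) (x) (y_2 ... y_l); the scalar factor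
   k l makes it vanish when k = 0 or l = 0. *)
Definition PLam_word (u w : seq V) : tprod tensor tensor :=
  ((size u * size w)%:R * Lam (last 0 u) (head 0 w) : K) *:
    tens (word (take (size u).-1 u)) (word (behead w)).

Definition PLam : tprod tensor tensor -> tprod tensor tensor :=
  tprod_lift (tensor_lift2 PLam_word).

Definition star_term (t : nat) (X Y : symtensor) : symtensor :=
  t`!%:R^-1 *: mu_vee (iter t PLam (tens (symval X) (symval Y))).

(* For a bilinear Lam this sum has finitely many nonzero terms, see
   star_term_finite. *)
Definition star (X Y : symtensor) : symtensor :=
  \sum_(t \in [set: nat]) star_term t X Y.

Hypothesis LamB : bilinear_for *:%R *:%R Lam.

Lemma PLam_word_multilinearl w : multilinear (PLam_word^~ w).
Proof.
move=> u v a x y; rewrite /PLam_word.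
have [ml mr] := tens_bilinear tensor tensor.
case/lastP: v => [|v z].
  rewrite !size_cat /= !addn1 /= !take_size_cat // !last_cat /=.
  by have [-> _] := LamB; rewrite mulrDr scalerDl scalerA mulrCA.
rewrite -!rcons_cons -!rcons_cat !size_rcons !last_rcons /=.
rewrite -!cats1 !take_size_cat // !size_cat /=.
rewrite word_multilinear.
rewrite (ml _ a) scalerDr; congr (_ + _).
by rewrite /= !scalerA mulrC.
Qed.

Lemma PLam_word_multilinearr u : multilinear (PLam_word u).
Proof.
move=> v w a x y; rewrite /PLam_word.
have [ml mr] := tens_bilinear tensor tensor.
case: v => [|z v] /=.
  by have [_ ->] := LamB; rewrite mulrDr scalerDl scalerA mulrCA.
rewrite !size_cat /= word_multilinear (mr _ a) scalerDr; congr (_ + _).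
by rewrite /= !scalerA mulrC.
Qed.

Let PLam_bilinear : bilinear_for *:%R *:%R (tensor_lift2 PLam_word).
Proof.
apply: tensor_lift2_bilinear; first exact: PLam_word_multilinearl.
exact: PLam_word_multilinearr.
Qed.

Lemma PLam_linear : linear PLam.
Proof. exact: tprod_lift_linear. Qed.

Lemma PLam_tens u w : PLam (tens (word u) (word w)) = PLam_word u w.
Proof.
rewrite /PLam tprod_liftE // tensor_lift2E //; first exact: PLam_word_multilinearl.
exact: PLam_word_multilinearr.
Qed.

Let linear_fun (E F : lmodType K) (f : E -> F) : linear f ->
  f 0 = 0 /\ (forall a x, f (a *: x) = a *: f x).
Proof.
move=> fl; have f0 : f 0 = 0.
  by have := fl (-1) 0 0; rewrite !scaler0 addr0 scaleN1r addNr.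
by split=> // a x; have := fl a x 0; rewrite !addr0 f0 addr0.
Qed.

Lemma iter_PLam_linear t : linear (iter t PLam).
Proof.
by elim: t => [|t IH] a Z Z'; rewrite //= IH PLam_linear.
Qed.

Lemma iter_PLam_eq0 X :
  exists n, forall t Y, (n < t)%N -> iter t PLam (tens X Y) = 0.
Proof.
have [ml mr] := tens_bilinear tensor tensor.
have il0 t : iter t PLam 0 = 0 by case: (linear_fun (iter_PLam_linear t)).
have ilZ t a Z : iter t PLam (a *: Z) = a *: iter t PLam Z.
  by case: (linear_fun (iter_PLam_linear t)).
have h t u w : (size u < t)%N -> iter t PLam (tens (word u) (word w)) = 0.
  elim: t u w => // t IH u w; rewrite ltnS iterSr PLam_tens /PLam_word => ut.
  rewrite ilZ; have [/size0nil->|u0] := eqVneq (size u) 0%N.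
    by rewrite mul0n mul0r scale0r.
  by rewrite IH ?scaler0 // size_takel ?leq_pred // (leq_trans _ ut) // prednK ?lt0n.
elim/presented_ind: X => [|a u X [n IH]].
  exists 0%N => t Y _; rewrite -(il0 t); congr iter.
  by have /linear_fun[] := ml Y.
exists (maxn (size u) n) => t Y; rewrite gtn_max => /andP[ut nt].
have -> : tens (a *: gen tensor_rel u + X) Y =
    a *: tens (word u) Y + tens X Y by exact: ml.
rewrite iter_PLam_linear IH // addr0.
suff -> : iter t PLam (tens (word u) Y) = 0 by rewrite scaler0.
elim/presented_ind: Y => [|b w Y IHY].
  by rewrite -(il0 t); congr iter; have /linear_fun[] := mr (word u).
have -> : tens (word u) (b *: gen tensor_rel w + Y) =
    b *: tens (word u) (word w) + tens (word u) Y by exact: mr.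
by rewrite iter_PLam_linear IHY addr0 h // scaler0.
Qed.

Lemma star_term_finite X Y : finite_set [set t | star_term t X Y != 0].
Proof.
have [n hn] := iter_PLam_eq0 (symval X).
apply: (@sub_finite_set _ _ `I_n.+1); last exact: finite_II.
move=> t /=; apply: contraNT; rewrite -leqNgt => nt.
rewrite /star_term hn //.
by have [-> _] := linear_fun mu_vee_linear; rewrite scaler0.
Qed.

End StarProduct.

End TensorAlgebra.

Section HilbertForms.
Variables (R : realType) (V : tvsType R[i]).
Local Notation C := R[i].

(* Continuous positive Hermitian forms, antilinear in the first argument and
   linear in the second one. *)
Record hilbert_form : Type := HilbertForm {
  hform :> V -> V -> C^o;
  hform_linear : forall x, linear (hform x);
  hform_antilinear : forall y a x x',
    hform (a *: x + x') y = a^* * hform x y + hform x' y;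
  hform_herm : forall x y, hform y x = (hform x y)^*;
  hform_ge0 : forall x, 0 <= hform x x;
  hform_continuous : continuous (fun p : V * V => hform p.1 p.2) }.

Definition hnorm (h : hilbert_form) (v : V) : C := sqrtC (h v v).

Definition tform_word (h : hilbert_form) (u w : seq V) : C^o :=
  if size u == size w
  then (size u)`!%:R * \prod_(p <- zip u w) h p.1 p.2 else 0.

(* The sesquilinear extension of tform_word to the tensor algebra; words of
   different lengths are orthogonal. *)
Definition tform (h : hilbert_form) (X Y : tensor V) : C :=
  (tensor_lift (fun u => (tensor_lift (tform_word h u) Y)^* : C^o) X)^*.

Definition tnorm (h : hilbert_form) (X : tensor V) : C := sqrtC (tform h X X).

Lemma tform_word_multilinear h u : multilinear (tform_word h u).
Proof.
move=> v w a x y; rewrite /tform_word !size_cat /=.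
case: eqP => [e|_]; last by rewrite scaler0 addr0.
have ek : (size v < size u)%N by rewrite e addnS ltnS leq_addr.
rewrite -(cat_take_drop (size v) u) (drop_nth 0 ek).
have sz : size (take (size v) u) = size v by rewrite size_takel // ltnW.
rewrite !zip_cat // !big_cat /= !big_cons /=.
rewrite hform_linear /GRing.scale /= !(mulrDr, mulrDl).
by congr (_ + _); rewrite -(mulrA a) !(mulrCA _ a).
Qed.

Lemma tform_word_herm h u w : tform_word h w u = (tform_word h u w)^*.
Proof.
rewrite /tform_word eq_sym; case: eqP => [e|_]; last by rewrite rmorph0.
rewrite rmorphM rmorph_nat e rmorph_prod /=; congr (_ * _).
elim: u w e => [|x u IH] [|y w] //=; first by rewrite !big_nil.
by case=> /IH {}IH; rewrite !big_cons IH /= -hform_herm.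
Qed.

Lemma tform_linear h X : linear (tform h X : tensor V -> C^o).
Proof.
move=> a Y Y'; rewrite /tform; set f := (f in tensor_lift f X).
have -> : f = (fun u => a^* *: ((tensor_lift (tform_word h u) Y)^* : C^o)
                        + ((tensor_lift (tform_word h u) Y')^* : C^o)).
  apply/funext => u; rewrite /f.
  rewrite (tensor_lift_linear (tform_word_multilinear h u)).
  by rewrite rmorphD rmorphM.
by rewrite /tensor_lift plift_fun rmorphD rmorphM /= conjCK.
Qed.

Let tform_conj_multilinear h Y :
  multilinear (fun u => (tensor_lift (tform_word h u) Y)^* : C^o).
Proof.
move=> u w a x y; set f := (f in tensor_lift f Y).
have -> : f = (fun v => a^* *: tform_word h (u ++ x :: w) v
                        + tform_word h (u ++ y :: w) v).
  apply/funext => v; rewrite /f tform_word_herm tform_word_multilinear.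
  rewrite rmorphD /= rmorphM /= -!tform_word_herm; congr (_ + _).
rewrite /tensor_lift plift_fun rmorphD /= rmorphM /= conjCK.
by [].
Qed.

Lemma tform_antilinear h Y a X X' :
  tform h (a *: X + X') Y = a^* * tform h X Y + tform h X' Y.
Proof.
rewrite /tform (tensor_lift_linear (tform_conj_multilinear h Y)).
by rewrite rmorphD rmorphM.
Qed.

Lemma tform_words h u w : tform h (word u) (word w) = tform_word h u w.
Proof.
rewrite /tform tensor_liftE ?conjCK; last exact: tform_conj_multilinear.
by rewrite tensor_liftE //; exact: tform_word_multilinear.
Qed.

Lemma tform_herm h X Y : tform h Y X = (tform h X Y)^*.
Proof.
have l0 Z : tform h Z 0 = 0.
  have := tform_linear h Z (-1) 0 0.
  by rewrite !scaler0 addr0 scaleN1r addNr.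
have r0 Z : tform h 0 Z = 0.
  have := tform_antilinear h Z (-1) 0 0.
  by rewrite !scaler0 addr0 rmorphN1 mulN1r addNr.
elim/presented_ind: X Y => [|a u X IHX] Y; first by rewrite l0 r0 rmorph0.
rewrite tform_antilinear tform_linear IHX rmorphD rmorphM /= conjCK.
congr (_ * _ + _); rewrite -/(word u).
elim/presented_ind: Y => [|b w Y IHY]; first by rewrite l0 r0 rmorph0.
rewrite tform_antilinear tform_linear IHY rmorphD rmorphM /=.
by rewrite -/(word w) !tform_words [in RHS]tform_word_herm conjCK.
Qed.

(* The topology defined by the seminorms tnorm h: a set is open when each of its
   points is the centre of a finite intersection of seminorm balls that is
   contained in the set. *)
Definition tensor_open : set_system (tensor V) :=
  fun U => forall X, U X -> exists (s : seq hilbert_form) (e : C),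
    0 < e /\ forall Y, all (fun h => tnorm h (Y - X) < e) s -> U Y.

Fact tensor_openT : tensor_open setT.
Proof. by move=> X _; exists [::], 1. Qed.

Fact tensor_openI : setI_closed tensor_open.
Proof.
move=> A B oA oB X [/oA [s [e [e0 sA]]] /oB [s' [e' [e0' sB]]]].
have ee : (e >=< e')%O by apply: real_comparable; apply: gtr0_real.
exists (s ++ s'), (Num.min e e'); split.
  by rewrite comparable_lt_min // e0.
move=> Y; rewrite all_cat => /andP[hs hs']; split.
  apply: sA; apply: sub_all hs => h /=.
  by rewrite comparable_lt_min // => /andP[].
apply: sB; apply: sub_all hs' => h /=.
by rewrite comparable_lt_min // => /andP[].
Qed.

Fact tensor_open_bigU (I : Type) (f : I -> set (tensor V)) :
  (forall i, tensor_open (f i)) -> tensor_open (\bigcup_i f i).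
Proof.
move=> fo X [i _ fiX]; have [s [e [e0 sf]]] := fo i X fiX.
by exists s, e; split => // Y /sf fY; exists i.
Qed.

HB.instance Definition _ :=
  isOpenTopological.Build (tensor V) tensor_openT tensor_openI tensor_open_bigU.

HB.instance Definition _ :=
  Topological.copy (symtensor V) (initial_topology (@symval _ V)).

End HilbertForms.

Section LocallyConvex.
Variable R : realType.
Local Notation C := R[i].

(* Seminorms take their values in the nonnegative reals, seen in R[i] like the
   norms of a normedModType R[i]. *)
Definition seminorm (E : lmodType C) (p : E -> C^o) : Prop :=
  [/\ forall x, 0 <= p x,
      forall x y, p (x + y) <= p x + p y
    & forall a x, p (a *: x) = `|a| * p x].

(* The seminorms of the continuous positive Hermitian forms are cofinal among
   the continuous seminorms. *)
Definition hilbert_topology (V : tvsType C) : Prop :=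
  forall p : V -> C^o, seminorm p -> continuous p ->
    exists h : hilbert_form V, forall v, p v <= hnorm h v.

(* An associative unital algebra that is a locally convex space and whose
   product is jointly continuous. *)
Definition lc_algebra (A : preTopologicalLmodType C) (mul : A -> A -> A) : Prop :=
  [/\ [/\ continuous (fun p : A * A => p.1 + p.2),
          continuous (fun p : C^o * A => p.1 *: p.2)
        & exists2 B : set_system A,
            (forall b, b \in B -> convex_set b) & basis B],
      [/\ bilinear_for *:%R *:%R mul, associative mul
        & exists e, left_id e mul /\ right_id e mul]
    & continuous (fun p : A * A => mul p.1 p.2)].

(* The uniform structure of a tvsType is not required to be the one induced by
   its addition, so Cauchy filters and uniform convergence are expressed with
   the neighbourhoods of 0. *)
Definition lc_complete (E : tvsType C) : Prop :=
  forall F : set_system E, ProperFilter F ->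
    (forall U, nbhs (0 : E) U ->
       exists2 A, F A & forall x y, A x -> A y -> U (x - y)) ->
    exists l : E, F --> l.

(* E is a completion of S: a complete Hausdorff space in which S embeds as a
   dense linear subspace carrying the subspace topology. *)
Record is_completion (S : preTopologicalLmodType C) (E : tvsType C)
    (i : S -> E) : Prop := IsCompletion {
  completion_linear : linear i;
  completion_inj : injective i;
  completion_top : forall A : set S,
    open A <-> exists2 B : set E, open B & A = i @^-1` B;
  completion_dense : dense (range i);
  completion_hausdorff : hausdorff_space E;
  completion_complete : lc_complete E }.

(* As i is a dense embedding into a Hausdorff space, fE is the unique continuous
   map extending f. *)
Definition continuous_extension (S : preTopologicalLmodType C) (E : tvsType C)
    (i : S -> E) (f : S -> S -> S) (fE : E -> E -> E) : Prop :=
  continuous (fun p : E * E => fE p.1 p.2) /\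
  forall x y, fE (i x) (i y) = i (f x y).

Definition converges_absolutely (E : tvsType C) (u : nat -> E) : Prop :=
  forall p : E -> C^o, seminorm p -> continuous p -> cvgn (series (p \o u)).

Definition converges_locally_uniformly (E : tvsType C)
    (u : nat -> C^o -> E) (f : C^o -> E) : Prop :=
  forall z0 : C^o, exists2 U, nbhs z0 U &
    forall N, nbhs (0 : E) N ->
      \forall n \near \oo, forall z, U z -> N (u n z - f z).

Definition holomorphic (E : tvsType C) (f : C^o -> E) : Prop :=
  forall z : C^o, exists l : E,
    (fun h : C^o => (h : C)^-1 *: (f (z + h) - f z)) @ 0^' --> l.

End LocallyConvex.

(* Main.v *)
Require Import Defs.
From HB Require Import structures.
From mathcomp Require Import all_boot all_order all_fingroup all_algebra.
From mathcomp Require Import generic_quotient sesquilinear.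
From mathcomp Require Import complex.
From mathcomp Require Import ring zify.
From mathcomp Require Import all_classical all_reals all_analysis.

Set Implicit Arguments.
Unset Strict Implicit.
Unset Printing Implicit Defensive.

Import Order.TTheory GRing.Theory Num.Theory.

Local Open Scope classical_set_scope.
Local Open Scope ring_scope.

(** Continuity. Since the topology of [V] is given by Hilbert seminorms, there is
    a form [h] with [|Lam x y| <= |x|_h |y|_h]. Let [X] and [Y] be homogeneous of
    degrees [k + 1] and [l + 1], and split off the letters that face each other:
    [X] is the sum of the [A_a (x) x_a], and [Y] the sum of the [y_b (x) B_b].
    Expanding the [y_b] in an [h]-orthogonal family [e_c] turns [P (X (x) Y)] into
    [(k+1)(l+1)] times the sum over [c] of [(sum_a Lam(x_a, e_c) A_a) (x) B'_c].
    The norms of the [B'_c] add up to that of [Y]; those of the left factors are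
    controlled by Bessel's inequality for the functionals [Lam(x_a, _)], which the
    Schur product theorem ([psd_Schur]) carries over to tensors. By
    Cauchy-Schwarz, one contraction costs at most a factor [sqrt((k+1)(l+1))] in
    the projective norm ([PLam_letters_step]). After [t] contractions and the
    symmetrised multiplication only square roots of binomial coefficients remain,
    so that [star_term Lam t] has norm at most [2^(k+l)] between homogeneous
    components ([star_term_homog]). The powers of 2 are absorbed by replacing [h]
    by [16 h] ([star_term_bound]). Replacing [h] by [c h] with large [c] makes
    [Lam] small with respect to it: hence, for every [r > 0], the [t]-th term is
    bounded by [r^t] in suitable seminorms ([star_term_geometric]).

    Associativity. On symmetric tensors [P] agrees with the contraction of all
    pairs of letters ([PLam_Sym2]), and the star product is the symmetrisation of
    a product [tstar] on the whole tensor algebra. For a letter [x], the latter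
    satisfies [(x (x) X) * Y = x (x) (X * Y) + X * i_x Y], where
    [i_x = contr (Lam x)] is a derivation of [tstar]. Associativity of [tstar]
    follows by induction on the length of the left factor ([tstarA]).

    Completion. Continuous seminorms of the completion [E] and the seminorms of
    the symmetric tensors dominate each other, because gauges of convex
    neighbourhoods are continuous seminorms ([nbhs0_seminorm]). The estimates thus
    become Lipschitz estimates for the terms as maps into [E]; these maps extend
    to [E], and the estimates with them. For fixed [X] and [Y] the extended terms
    [M_t] decay faster than every geometric sequence, so that the power series
    with coefficients [M_t] converges absolutely, uniformly for bounded [z], and
    can be differentiated term by term ([psum_derivative]). *)

(** * Positive semi-definite Hermitian forms *)

Definition psd_form (C : numClosedFieldType) (M : lmodType C) (G : M -> M -> C) :=
  [/\ forall a x y z, G x (a *: y + z) = a * G x y + G x z,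
      forall x y, G y x = (G x y)^*
    & forall x, 0 <= G x x].

Section PsdForm.
Variables (C : numClosedFieldType) (M : lmodType C) (G : M -> M -> C).
Hypothesis G_psd : psd_form G.

Definition psd_norm (x : M) : C := sqrtC (G x x).

Let GH x y : G y x = (G x y)^*. Proof. by case: G_psd. Qed.
Lemma psd_ge0 x : 0 <= G x x. Proof. by case: G_psd. Qed.

Lemma psdDr x y z : G x (y + z) = G x y + G x z.
Proof. by case: G_psd => Gl _ _; rewrite -[y]scale1r Gl mul1r scale1r. Qed.

Lemma psd0r x : G x 0 = 0.
Proof. by apply: (addrI (G x 0)); rewrite -psdDr !addr0. Qed.

Lemma psdZr x a y : G x (a *: y) = a * G x y.
Proof. by case: G_psd => Gl _ _; rewrite -[a *: y]addr0 Gl psd0r addr0. Qed.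

Lemma psdDl x y z : G (x + y) z = G x z + G y z.
Proof. by rewrite GH psdDr rmorphD /= -!GH. Qed.

Lemma psdZl a x y : G (a *: x) y = a^* * G x y.
Proof. by rewrite GH psdZr rmorphM /= -GH. Qed.

Lemma psd0l x : G 0 x = 0.
Proof. by rewrite GH psd0r rmorph0. Qed.

Lemma psd_sumr x (I : Type) (r : seq I) (P : pred I) (F : I -> M) :
  G x (\sum_(i <- r | P i) F i) = \sum_(i <- r | P i) G x (F i).
Proof. by apply: (big_morph (G x) (psdDr x) (psd0r x)). Qed.

Lemma psd_suml x (I : Type) (r : seq I) (P : pred I) (F : I -> M) :
  G (\sum_(i <- r | P i) F i) x = \sum_(i <- r | P i) G (F i) x.
Proof.
by apply: (big_morph (G^~ x)) => [y z|]; [exact: psdDl|exact: psd0l].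
Qed.

Lemma psd_real x : (G x x)^* = G x x.
Proof. by rewrite -GH. Qed.

(** The discriminant argument for a form that may have isotropic vectors: if [y]
    is isotropic, [G (x - t *: y) (x - t *: y)] is an affine function of the real
    and imaginary parts of [t], so that it is nonnegative for all [t] only when
    [G x y = 0]. *)
Lemma psd_Cauchy_Schwarz x y : `|G x y| ^+ 2 <= G x x * G y y.
Proof.
have expand (s t : C) : G (s *: x - t *: y) (s *: x - t *: y) =
    s^* * s * G x x - s^* * t * G x y - t^* * s * (G x y)^* + t^* * t * G y y.
  rewrite -!scaleNr psdDl !psdDr !psdZl !psdZr -(GH x y) rmorphN.
  by ring.
have [y0|y_neq0] := eqVneq (G y y) 0.
  have [->|xy_neq0] := eqVneq (G x y) 0; first by rewrite normr0 expr0n y0 mulr0.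
  set b := G x y in xy_neq0 *.
  (* For this multiple of [y] the value of the form is [- (G x x + 2)]. *)
  have := psd_ge0 (1 *: x - ((G x x + 1) / b) *: y).
  have tE : ((G x x + 1) / b)^* = (G x x + 1) / b^*.
    by rewrite rmorphM fmorphV rmorphD /= psd_real conjC1.
  rewrite expand y0 -/b conjC1 tE.
  have -> : 1 * 1 * G x x - 1 * ((G x x + 1) / b) * b -
     (G x x + 1) / b^* * 1 * b^* + (G x x + 1) / b^* * ((G x x + 1) / b) * 0
     = - (G x x + 2).
    by field; rewrite conjC_eq0 xy_neq0.
  by rewrite oppr_ge0 lt_geF // ltr_wpDl ?psd_ge0 // ltr0n.
have yy : 0 < G y y by rewrite lt_def y_neq0 psd_ge0.
have := psd_ge0 (G y y *: x - (G x y)^* *: y).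
rewrite expand psd_real conjCK normCK.
have -> : G y y * G y y * G x x - G y y * (G x y)^* * G x y -
   G x y * G y y * (G x y)^* + G x y * (G x y)^* * G y y
   = G y y * (G x x * G y y - G x y * (G x y)^*) by ring.
by rewrite pmulr_rge0 // subr_ge0.
Qed.

Lemma psd_norm_ge0 x : 0 <= psd_norm x.
Proof. by rewrite sqrtC_ge0 psd_ge0. Qed.

Lemma psd_norm_sqr x : psd_norm x ^+ 2 = G x x.
Proof. by rewrite sqrtCK. Qed.

Lemma psd_norm_bound x y : `|G x y| <= psd_norm x * psd_norm y.
Proof.
rewrite -(ler_pXn2r (ltn0Sn 1)) ?nnegrE ?mulr_ge0 ?psd_norm_ge0 //.
by rewrite exprMn !psd_norm_sqr psd_Cauchy_Schwarz.
Qed.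

Lemma psd_normD x y : psd_norm (x + y) <= psd_norm x + psd_norm y.
Proof.
rewrite -(ler_pXn2r (ltn0Sn 1)) ?nnegrE ?addr_ge0 ?psd_norm_ge0 //.
rewrite psd_norm_sqr psdDl !psdDr (GH x y) sqrrD !psd_norm_sqr.
rewrite !addrA lerD2r -!addrA lerD2l.
have -> : G x y + (G x y)^* = 'Re (G x y) *+ 2.
  by rewrite -mulr_natr ReE mulfVK // pnatr_eq0.
rewrite lerMn2r /=; apply: le_trans (psd_norm_bound x y).
by case: (leif_Re_Creal (G x y)).
Qed.

Lemma psd_normZ a x : psd_norm (a *: x) = `|a| * psd_norm x.
Proof.
rewrite /psd_norm psdZl psdZr mulrA [_^* * a]mulrC -normCK.
by rewrite sqrtCM ?nnegrE ?exprn_ge0 ?psd_ge0 // sqrCK.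
Qed.

Lemma psd_norm0 : psd_norm 0 = 0.
Proof. by rewrite /psd_norm psd0r sqrtC0. Qed.

Lemma psd_norm_sum (I : Type) (r : seq I) (P : pred I) (F : I -> M) :
  psd_norm (\sum_(i <- r | P i) F i) <= \sum_(i <- r | P i) psd_norm (F i).
Proof.
elim/big_rec2: _ => [|i a x _ ax]; first by rewrite psd_norm0.
by apply: le_trans (psd_normD _ _) _; rewrite lerD2l.
Qed.

Lemma psd_null x y : G x x = 0 -> G x y = 0.
Proof.
move=> x0; have := psd_Cauchy_Schwarz x y; rewrite x0 mul0r.
by rewrite -normrX normr_le0 sqrf_eq0 => /eqP.
Qed.

(** Null vectors are kept in the orthogonal family, so that the [x i] are linear
    combinations of it on the nose and not only up to vectors of norm zero. *)
Lemma psd_Gram_Schmidt (x : nat -> M) n : exists (e : nat -> M) (d : nat -> bool)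
    (b : nat -> nat -> C),
  (forall i j, (i < n)%N -> (j < n)%N -> G (e i) (e j) = ((i == j) && d i)%:R)
  /\ forall i, (i < n)%N -> x i = \sum_(j < n) b i j *: e j.
Proof.
elim: n => [|n [e [d [b [eE xE]]]]].
  by exists x, xpredT, (fun _ _ => 0).
pose r := x n - \sum_(j < n) G (e j) (x n) *: e j.
(* If [e i] is null, [G (e i)] vanishes on all vectors. *)
have er i : (i < n)%N -> G (e i) r = 0.
  move=> ltin; rewrite /r -scaleN1r psdDr psdZr psd_sumr.
  rewrite (bigD1 (Ordinal ltin)) //= psdZr eE // eqxx /=.
  rewrite big1 => [|j ji]; last first.
    rewrite psdZr eE //.
    have /negPf -> : i != j by apply: contra ji => /eqP ij; apply/eqP/val_inj.
    by rewrite mulr0.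
  case di: (d i); first by rewrite mulr1 addr0 mulN1r subrr.
  by rewrite mulr0 !addr0 mulr0 addr0 psd_null // eE // eqxx di.
(* A null remainder joins the family as it is. *)
pose s := if G r r == 0 then 1 else psd_norm r.
have s0 : s != 0.
  by rewrite /s; case: ifPn => [_|rr]; [exact: oner_neq0|rewrite sqrtC_eq0].
pose e' i := if i == n then s^-1 *: r else e i.
pose d' i := if i == n then G r r != 0 else d i.
pose b' i j := if i == n then (if j == n then s else G (e j) (x n))
               else (if j == n then 0 else b i j).
have e'n : e' n = s^-1 *: r by rewrite /e' eqxx.
have e'lt i : (i < n)%N -> e' i = e i by move=> /ltn_eqF; rewrite /e' => ->.
have e'e i : (i < n)%N -> G (e' i) (e' n) = 0.
  by move=> ltin; rewrite e'n e'lt // psdZr er // mulr0.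
exists e', d', b'; split=> [i j|i].
  rewrite !ltnS leq_eqVlt => /predU1P[->|ltin]; rewrite leq_eqVlt => /predU1P[->|ltjn].
  - rewrite e'n eqxx /d' eqxx psdZl psdZr /s.
    case: eqP => [->|/eqP rr]; first by rewrite !mulr0.
    have nr : psd_norm r != 0 by rewrite sqrtC_eq0.
    have -> : (psd_norm r)^-1^* = (psd_norm r)^-1.
      by apply: conj_Creal; rewrite rpredV ger0_real ?psd_norm_ge0.
    by rewrite -psd_norm_sqr /=; field.
  - by rewrite GH e'e // gtn_eqF // rmorph0.
  - by rewrite e'e // ltn_eqF.
  - by rewrite !e'lt // eE // /d' (ltn_eqF ltin).
rewrite big_ord_recr /= e'n /b' eqxx ltnS leq_eqVlt.
case/predU1P => [->|ltin].
  rewrite eqxx scalerA mulfV // scale1r.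
  rewrite (eq_bigr (fun j : 'I_n => G (e j) (x n) *: e j)) => [|j _].
    by rewrite addrC subrK.
  by rewrite e'lt // ltn_eqF.
rewrite (ltn_eqF ltin) scale0r addr0 xE //; apply: eq_bigr => j _.
by rewrite e'lt // (ltn_eqF (ltn_ord j)).
Qed.

Lemma psd_orthogonal_sum (e : nat -> M) (d : nat -> bool) n (c c' : nat -> C) :
  (forall i j, (i < n)%N -> (j < n)%N -> G (e i) (e j) = ((i == j) && d i)%:R) ->
  G (\sum_(i < n) c i *: e i) (\sum_(i < n) c' i *: e i) =
  \sum_(i < n) (d i)%:R * ((c i)^* * c' i).
Proof.
move=> eE; rewrite psd_suml; apply: eq_bigr => i _.
rewrite psdZl psd_sumr (bigD1 i) //= psdZr eE // eqxx /= big1 ?addr0; last first.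
  move=> j ji; rewrite psdZr eE //; case: eqP => [ij|]; last by rewrite mulr0.
  by case/eqP: ji; apply/val_inj.
by ring.
Qed.

End PsdForm.

Lemma psd_formB (C : numClosedFieldType) (M : lmodType C) (G T : M -> M -> C) :
  psd_form G -> psd_form T -> (forall x, T x x <= G x x) ->
  psd_form (fun x y => G x y - T x y).
Proof.
move=> [Gl GH _] [Tl TH _] TG; split=> [a x y z|x y|x]; last by rewrite subr_ge0.
  by rewrite Gl Tl; ring.
by rewrite rmorphB /= -GH -TH.
Qed.

(** The Schur product theorem. An orthogonal family for one of the two forms
    turns the double sum into a sum of values of the other form on the diagonal. *)
Lemma psd_Schur (C : numClosedFieldType) (M N : lmodType C)
    (G : M -> M -> C) (T : N -> N -> C) n (x : nat -> M) (y : nat -> N) :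
  psd_form G -> psd_form T ->
  0 <= \sum_(i < n) \sum_(j < n) G (x i) (x j) * T (y i) (y j).
Proof.
move=> Gp Tp; have [e [d [b [eE yE]]]] := psd_Gram_Schmidt Tp y n.
have -> : \sum_(i < n) \sum_(j < n) G (x i) (x j) * T (y i) (y j) =
    \sum_(k < n) (d k)%:R *
      G (\sum_(i < n) b i k *: x i) (\sum_(i < n) b i k *: x i).
  transitivity (\sum_(i < n) \sum_(j < n) \sum_(k < n)
      (d k)%:R * ((b i k)^* * b j k * G (x i) (x j))).
    apply: eq_bigr => i _; apply: eq_bigr => j _.
    rewrite !yE // (psd_orthogonal_sum Tp _ _ eE) mulr_sumr.
    by apply: eq_bigr => k _; ring.
  under eq_bigr do rewrite exchange_big.
  rewrite exchange_big; apply: eq_bigr => k _.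
  rewrite (psd_suml Gp) mulr_sumr; apply: eq_bigr => i _.
  rewrite (psd_sumr Gp) mulr_sumr; apply: eq_bigr => j _.
  by rewrite (psdZl Gp) (psdZr Gp); ring.
by apply: sumr_ge0 => k _; rewrite mulr_ge0 ?ler0n ?psd_ge0.
Qed.

(** * Linear maps out of tensor spaces *)

Section LinearMaps.
Variables (K : pzRingType) (E F : lmodType K) (f : E -> F).
Hypothesis f_lin : linear f.

Lemma lin0 : f 0 = 0.
Proof. by have := f_lin (-1) 0 0; rewrite !scaler0 addr0 scaleN1r addNr. Qed.

Lemma linZ a x : f (a *: x) = a *: f x.
Proof. by rewrite -[a *: x]addr0 f_lin lin0 addr0. Qed.

Lemma linD x y : f (x + y) = f x + f y.
Proof. by rewrite -[x]scale1r f_lin !scale1r. Qed.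

Lemma lin_sum (I : Type) (r : seq I) (P : pred I) (g : I -> E) :
  f (\sum_(i <- r | P i) g i) = \sum_(i <- r | P i) f (g i).
Proof. exact: (big_morph f linD lin0). Qed.
End LinearMaps.

Lemma linear_comp (K : pzRingType) (E F H : lmodType K) (f : E -> F)
  (g : F -> H) : linear f -> linear g -> linear (g \o f).
Proof. by move=> fl gl a x y; rewrite /= fl gl. Qed.

Section Extensionality.
Variables (K : fieldType) (V : lmodType K).

Lemma tensor_ext (E : lmodType K) (f g : tensor V -> E) :
  linear f -> linear g -> (forall w, f (word w) = g (word w)) -> f =1 g.
Proof.
move=> fl gl fg; elim/presented_ind => [|a w X IH]; first by rewrite !lin0.
by rewrite fl gl IH; congr (_ *: _ + _); exact: fg.
Qed.

Lemma tprod_ext (M N E : lmodType K) (f g : tprod M N -> E) :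
  linear f -> linear g -> (forall x y, f (tens x y) = g (tens x y)) -> f =1 g.
Proof.
move=> fl gl fg; elim/presented_ind => [|a [x y] X IH]; first by rewrite !lin0.
by rewrite fl gl IH; congr (_ *: _ + _); exact: fg.
Qed.

Lemma tens_linl (M N : lmodType K) (y : N) : linear (fun x : M => tens x y).
Proof. by have [tl _] := tens_bilinear M N; exact: tl. Qed.

Lemma tens_linr (M N : lmodType K) (x : M) : linear (fun y : N => tens x y).
Proof. by have [_ tr] := tens_bilinear M N; exact: tr. Qed.

Lemma tensor_ext2 (E : lmodType K) (f g : tensor V -> tensor V -> E) :
  (forall Y, linear (f^~ Y)) -> (forall X, linear (f X)) ->
  (forall Y, linear (g^~ Y)) -> (forall X, linear (g X)) ->
  (forall u w, f (word u) (word w) = g (word u) (word w)) -> f =2 g.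
Proof.
move=> fl fr gl gr fg X Y; move: X; apply: tensor_ext => // u.
by move: Y; apply: tensor_ext.
Qed.

Lemma tprod_tensor_ext (E : lmodType K) (f g : tprod (tensor V) (tensor V) -> E) :
  linear f -> linear g ->
  (forall u w, f (tens (word u) (word w)) = g (tens (word u) (word w))) ->
  f =1 g.
Proof.
move=> fl gl fg; apply: tprod_ext => // X Y.
apply: (@tensor_ext2 _ (fun X Y => f (tens X Y)) (fun X Y => g (tens X Y))) => //.
- by move=> ? ? ? ?; rewrite /= tens_linl fl.
- by move=> ? ? ? ?; rewrite /= tens_linr fl.
- by move=> ? ? ? ?; rewrite /= tens_linl gl.
- by move=> ? ? ? ?; rewrite /= tens_linr gl.
Qed.

Definition tprod_map (M N M' N' : lmodType K) (f : M -> M') (g : N -> N') :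
  tprod M N -> tprod M' N' := tprod_lift (fun x y => tens (f x) (g y)).

Section TprodMap.
Variables (M N M' N' : lmodType K) (f : M -> M') (g : N -> N').
Hypotheses (f_lin : linear f) (g_lin : linear g).

Let map_bilinear : bilinear_for *:%R *:%R (fun x y => tens (f x) (g y)).
Proof.
split=> [y|x] a z z' /=; first by rewrite f_lin tens_linl.
by rewrite g_lin tens_linr.
Qed.

Lemma tprod_map_linear : linear (tprod_map f g).
Proof. exact: tprod_lift_linear. Qed.

Lemma tprod_mapE x y : tprod_map f g (tens x y) = tens (f x) (g y).
Proof. exact: tprod_liftE. Qed.
End TprodMap.

Lemma tmul_linl (Y : tensor V) : linear (fun X => tmul X Y).
Proof. by have [tl _] := tmul_bilinear V; exact: tl. Qed.

Lemma tmul_linr (X : tensor V) : linear (tmul X).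
Proof. by have [_ tr] := tmul_bilinear V; exact: tr. Qed.

Lemma tmul1l (X : tensor V) : tmul (word [::]) X = X.
Proof.
move: X; apply: tensor_ext => [|? ? ?|w]; rewrite ?tmul_word //.
exact: tmul_linr.
Qed.

Lemma tmulA (X Y Z : tensor V) : tmul X (tmul Y Z) = tmul (tmul X Y) Z.
Proof.
move: X; apply: tensor_ext => [a X X'|a X X'|u]; rewrite ?tmul_linl //.
move: Y; apply: tensor_ext => [a X X'|a X X'|w].
- by rewrite tmul_linl tmul_linr.
- by rewrite tmul_linr tmul_linl.
move: Z; apply: tensor_ext => [a X X'|a X X'|v]; rewrite ?tmul_linr //.
by rewrite !tmul_word catA.
Qed.

Lemma word_letterP a (x y : V) :
  word [:: a *: x + y] = a *: word [:: x] + word [:: y].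
Proof. exact: (word_multilinear [::] [::]). Qed.

End Extensionality.

(** * Homogeneous components *)

Section Homogeneous.
Variables (K : fieldType) (V : lmodType K).
Implicit Types X Y : tensor V.

Definition hproj (k : nat) : tensor V -> tensor V :=
  tensor_lift (fun w => if size w == k then word w else 0).

Let hproj_multilinear k :
  multilinear (fun w : seq V => if size w == k then word w else 0).
Proof.
move=> u w a x y; rewrite !size_cat /=; case: ifP => _.
  exact: word_multilinear.
by rewrite scaler0 addr0.
Qed.

Lemma hproj_linear k : linear (hproj k).
Proof. exact/tensor_lift_linear/hproj_multilinear. Qed.

Lemma hproj_word k w : hproj k (word w) = if size w == k then word w else 0.
Proof. exact: tensor_liftE (hproj_multilinear k). Qed.

(** The [k]-th tensor power as the image of a linear projection. *)
Definition homog (k : nat) X : Prop := hproj k X = X.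

Lemma homog_word w : homog (size w) (word w).
Proof. by rewrite /homog hproj_word eqxx. Qed.

Lemma homog0 k : homog k 0.
Proof. exact: (lin0 (hproj_linear k)). Qed.

Lemma homogP k a X Y : homog k X -> homog k Y -> homog k (a *: X + Y).
Proof. by move=> hX hY; rewrite /homog hproj_linear hX hY. Qed.

Lemma homogZ k a X : homog k X -> homog k (a *: X).
Proof. by move=> hX; rewrite -[_ *: _]addr0; apply: homogP => //; exact: homog0. Qed.

Lemma homog_sum k (I : Type) (r : seq I) (F : I -> tensor V) :
  (forall i, homog k (F i)) -> homog k (\sum_(i <- r) F i).
Proof.
by move=> hF; rewrite /homog (lin_sum (hproj_linear k)); apply: eq_bigr => i _; exact: hF.
Qed.

Lemma hproj_hproj k l X : hproj k (hproj l X) = if k == l then hproj k X else 0.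
Proof.
move: X; apply: tensor_ext => [|a X Y|w].
- by move=> a X Y; rewrite !hproj_linear.
- by case: eqP => _; rewrite ?hproj_linear // scaler0 addr0.
- rewrite hproj_word; case: eqP => [<-|wl]; last first.
    rewrite (lin0 (hproj_linear k)) hproj_word; case: eqP => // ->.
    by case: eqP.
  by rewrite hproj_word eq_sym; case: eqP => // ->; rewrite eqxx.
Qed.

Lemma homog_hproj k X : homog k (hproj k X).
Proof. by rewrite /homog hproj_hproj eqxx. Qed.

(** The projection to degree [k] sends a linear combination of words to the part
    that consists of words of length [k]. *)
Lemma homog_ind k (P : tensor V -> Prop) : P 0 ->
  (forall a w X, size w = k -> homog k X -> P X -> P (a *: word w + X)) ->
  forall X, homog k X -> P X.
Proof.
move=> P0 Pcons X <-; elim/presented_ind: X => [|a w X IH].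
  by rewrite (lin0 (hproj_linear k)).
rewrite hproj_linear -/(word w) hproj_word; case: eqP => [wk|_].
  by apply: Pcons => //; exact: homog_hproj.
by rewrite scaler0 add0r.
Qed.

(** Any large [m] will do, so that two tensors can be decomposed over the same
    range of degrees. *)
Lemma hproj_sum X : exists n, forall m, (n <= m)%N -> X = \sum_(k < m) hproj k X.
Proof.
elim/presented_ind: X => [|a w X [n IH]].
  by exists 0%N => m _; rewrite big1 // => k _; rewrite (lin0 (hproj_linear k)).
exists (maxn (size w).+1 n) => m; rewrite geq_max => /andP[wm nm].
under [RHS]eq_bigr do rewrite hproj_linear.
rewrite big_split /= -scaler_sumr; congr (_ *: _ + _); last exact: IH.
rewrite (bigD1 (Ordinal wm)) //= big1 ?addr0 => [|i /eqP iw].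
  by rewrite -/(word w) hproj_word eqxx.
rewrite -/(word w) hproj_word; case: eqP => // wi.
by case: iw; exact/val_inj.
Qed.

(** Splitting off one letter: the step of the inductions on the degree. *)
Lemma homog_rcons k X : homog k.+1 X -> exists n (A : nat -> tensor V) (x : nat -> V),
  (forall i, homog k (A i)) /\ X = \sum_(i < n) tmul (A i) (word [:: x i]).
Proof.
elim/homog_ind => [|a w Y]; first by exists 0%N, (fun _ => 0), (fun _ => 0);
  split=> [_|]; [exact: homog0|rewrite big_ord0].
case/lastP: w => // w z; rewrite size_rcons => -[wk] _ [n [A [x [hA ->]]]].
exists n.+1, (fun i => if i == n then a *: word w else A i),
  (fun i => if i == n then z else x i); split=> [i|].
  by case: eqP => // _; apply: homogZ; rewrite -wk; exact: homog_word.
rewrite big_ord_recr /= eqxx (linZ (tmul_linl _)) tmul_word cats1 addrC.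
congr (_ + _); apply: eq_bigr => i _; by rewrite (ltn_eqF (ltn_ord i)).
Qed.

Lemma homog_cons k X : homog k.+1 X -> exists n (x : nat -> V) (A : nat -> tensor V),
  (forall i, homog k (A i)) /\ X = \sum_(i < n) tmul (word [:: x i]) (A i).
Proof.
elim/homog_ind => [|a w Y]; first by exists 0%N, (fun _ => 0), (fun _ => 0);
  split=> [_|]; [exact: homog0|rewrite big_ord0].
case: w => // z w [wk] _ [n [x [A [hA ->]]]].
exists n.+1, (fun i => if i == n then z else x i),
  (fun i => if i == n then a *: word w else A i); split=> [i|].
  by case: eqP => // _; apply: homogZ; rewrite -wk; exact: homog_word.
rewrite big_ord_recr /= eqxx (linZ (tmul_linr _)) tmul_word addrC.
congr (_ + _); apply: eq_bigr => i _; by rewrite (ltn_eqF (ltn_ord i)).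
Qed.

End Homogeneous.

(** * Symmetrisation *)

Section Picks.
Variable T : Type.

(** All ways of taking a letter out of a word. This recursion on the first letter
    is what makes the contractions below derivations. *)
Fixpoint picks (w : seq T) : seq (T * seq T) :=
  if w is y :: w' then (y, w') :: [seq (p.1, y :: p.2) | p <- picks w'] else [::].

Lemma picksE x0 w : picks w =
  [seq (nth x0 w j, take j w ++ drop j.+1 w) | j <- iota 0 (size w)].
Proof.
elim: w => //= y w ->; rewrite drop0; congr cons.
by rewrite (iotaDl 1) -!map_comp; apply: eq_map.
Qed.
End Picks.

Section SymWord.
Variables (K : numFieldType) (V : lmodType K).
Implicit Types u w : seq V.

(** The degree is kept apart from the word, so that words of the same length are
    symmetrised over the same group of permutations. *)
Definition symn n w : tensor V :=
  n`!%:R^-1 *: \sum_(s : 'S_n) word [seq nth 0 w (s i) | i : 'I_n].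

Lemma sym_word_perm u w : perm_eq u w -> sym_word u = sym_word w.
Proof.
move=> uw; have e := perm_size uw; rewrite /sym_word -/(symn (size u) u).
rewrite -/(symn (size w) w) e /symn; congr (_ *: _).
have [p up] : exists p : 'S_(size w), u = [tuple tnth (in_tuple w) (p i) | i < size w].
  by apply/(tuple_permP (t := in_tuple w)).
rewrite [RHS](reindex_inj (mulIg p)); apply: eq_bigr => s _.
congr word; apply: eq_map => i; rewrite permM [in LHS]up.
by rewrite (nth_map i) ?size_enum_ord // (tnth_nth 0) nth_ord_enum.
Qed.

Lemma perm_sym_letters w (s : 'S_(size w)) :
  perm_eq [seq nth 0 w (s i) | i : 'I_(size w)] w.
Proof.
apply/(tuple_permP (t := in_tuple w)); exists s; apply: eq_map => i.
by rewrite (tnth_nth 0).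
Qed.

Lemma card_Sn_neq0 n : (n`!%:R : K) != 0.
Proof. by rewrite pnatr_eq0 -lt0n fact_gt0. Qed.

Lemma Symop_sym_word w : Symop (sym_word w) = sym_word w.
Proof.
rewrite /sym_word (linZ (@Symop_linear _ _)) (lin_sum (@Symop_linear _ _)).
rewrite (eq_bigr (fun=> sym_word w)) => [|s _]; last first.
  by rewrite Symop_word; apply: sym_word_perm; exact: perm_sym_letters.
rewrite sumr_const card_Sn -scaler_nat scalerA mulVf ?card_Sn_neq0 //.
by rewrite scale1r.
Qed.

Lemma SymopK (X : tensor V) : Symop (Symop X) = Symop X.
Proof.
move: X; apply: tensor_ext => [||w].
- exact: linear_comp (@Symop_linear _ _) (@Symop_linear _ _).
- exact: Symop_linear.
- by rewrite Symop_word Symop_sym_word.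
Qed.

Lemma Symop_perm u w : perm_eq u w -> Symop (word u) = Symop (word w).
Proof. by rewrite !Symop_word; exact: sym_word_perm. Qed.

Lemma Symop_tmulC (X Y : tensor V) : Symop (tmul X Y) = Symop (tmul Y X).
Proof.
move: X Y; apply: tensor_ext2 => [Y|X|Y|X|u w].
- exact: linear_comp (tmul_linl Y) (@Symop_linear _ _).
- exact: linear_comp (tmul_linr X) (@Symop_linear _ _).
- exact: linear_comp (tmul_linr Y) (@Symop_linear _ _).
- exact: linear_comp (tmul_linl X) (@Symop_linear _ _).
- by rewrite !tmul_word; apply: Symop_perm; rewrite perm_catC.
Qed.

Lemma Symop_tmull (X Y : tensor V) : Symop (tmul (Symop X) Y) = Symop (tmul X Y).
Proof.
move: X Y; apply: tensor_ext2 => [Y|X|Y|X|u w].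
- by move=> a X X'; rewrite /= Symop_linear tmul_linl Symop_linear.
- exact: linear_comp (tmul_linr _) (@Symop_linear _ _).
- exact: linear_comp (tmul_linl Y) (@Symop_linear _ _).
- exact: linear_comp (tmul_linr X) (@Symop_linear _ _).
rewrite Symop_word tmul_word /sym_word (linZ (tmul_linl _)).
rewrite (linZ (@Symop_linear _ _)) (lin_sum (tmul_linl _)).
rewrite (lin_sum (@Symop_linear _ _)).
rewrite (eq_bigr (fun=> Symop (word (u ++ w)))) => [|s _]; last first.
  by rewrite tmul_word; apply: Symop_perm; rewrite perm_cat2r perm_sym_letters.
rewrite sumr_const card_Sn -scaler_nat scalerA mulVf ?card_Sn_neq0 //.
by rewrite scale1r.
Qed.

Lemma Symop_tmulr (X Y : tensor V) : Symop (tmul X (Symop Y)) = Symop (tmul X Y).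
Proof. by rewrite Symop_tmulC Symop_tmull Symop_tmulC. Qed.

(** A permutation of [n + 1] letters is determined by the image of [i0] and by a
    permutation of the [n] others. *)
Let sum_lift_perm n (i0 : 'I_n.+1) (F : 'S_n.+1 -> tensor V) :
  \sum_s F s = \sum_(j < n.+1) \sum_(s : 'S_n) F (lift_perm i0 j s).
Proof.
rewrite (partition_big (fun s : 'S_n.+1 => s i0) xpredT) //=.
apply: eq_bigr => j _.
rewrite (reindex (lift_perm i0 j)); last first.
  pose ulsf i (s : 'S_n.+1) k := odflt k (unlift (s i) (s (lift i k))).
  have ulsfK i (s : 'S_n.+1) k : lift (s i) (ulsf i s k) = s (lift i k).
    rewrite /ulsf; have := neq_lift i k.
    by rewrite -(can_eq (permK s)) => /unlift_some[] ? ? ->.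
  have inj_ulsf : injective (ulsf i0 _).
    move=> s; apply: can_inj (ulsf (s i0) s^-1%g) _ => k'.
    by rewrite {1}/ulsf ulsfK !permK liftK.
  exists (fun s => perm (inj_ulsf s)) => [s _ | s].
    by apply/permP=> k'; rewrite permE /ulsf lift_perm_lift lift_perm_id liftK.
  move/(s _ =P _) => si0; apply/permP=> k.
  case: (unliftP i0 k) => [k'|] ->; rewrite ?lift_perm_id //.
  by rewrite lift_perm_lift -si0 permE ulsfK.
by apply: eq_bigl => s; rewrite lift_perm_id eqxx.
Qed.

Let nth_remove w (j k : nat) :
  nth 0 (take j w ++ drop j.+1 w) k = nth 0 w (bump j k).
Proof.
rewrite nth_cat size_take_min /bump; case: ltnP => h.
  by rewrite leqNgt (leq_trans h) ?geq_minl //= nth_take // (leq_trans h) // geq_minl.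
have [jw|jw] := ltnP j (size w).
  move: h; rewrite (minn_idPl (ltnW jw)) => h; rewrite h nth_drop; congr nth; lia.
move: h; rewrite (minn_idPr jw) => h; rewrite !nth_default //.
  exact: leq_trans h (leq_addl _ _).
by rewrite drop_oversize // (leq_trans jw).
Qed.

Let size_remove w (j : nat) : (j < size w)%N ->
  size (take j w ++ drop j.+1 w) = (size w).-1.
Proof. by move=> jw; rewrite size_cat size_take size_drop jw; lia. Qed.

(** Sorting the permutations by the letter that they put at the end. *)
Lemma sym_word_rcons w : (0 < size w)%N -> sym_word w =
  (size w)%:R^-1 *: \sum_(p <- picks w) tmul (sym_word p.2) (word [:: p.1]).
Proof.
move=> w0; have [n wn] : exists n, size w = n.+1.
  by exists (size w).-1; rewrite prednK.
rewrite /sym_word -/(symn (size w) w) wn /symn factS natrM invfM -scalerA.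
congr (_ *: _); rewrite (picksE 0) big_map wn -[iota _ _]/(index_iota 0 n.+1).
rewrite big_mkord (sum_lift_perm ord_max) scaler_sumr; apply: eq_bigr => j _ /=.
have sj : size (take j w ++ drop j.+1 w) = n by rewrite size_remove wn //=.
rewrite -/(symn (size (take j w ++ drop j.+1 w)) (take j w ++ drop j.+1 w)) sj.
rewrite (linZ (tmul_linl _)) (lin_sum (tmul_linl _)); congr (_ *: _).
apply: eq_bigr => s _; rewrite tmul_word; congr word.
rewrite /image_mem enum_ordSr map_rcons -cats1 lift_perm_id; congr cat.
rewrite -map_comp; apply: eq_map => i /=; rewrite nth_remove.
have -> : widen_ord (leqnSn n) i = lift ord_max i by apply/val_inj; rewrite /= /bump leqNgt ltn_ord.
by rewrite lift_perm_lift.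
Qed.

Lemma sym_word_cons w : (0 < size w)%N -> sym_word w =
  (size w)%:R^-1 *: \sum_(p <- picks w) tmul (word [:: p.1]) (sym_word p.2).
Proof.
move=> w0; have [n wn] : exists n, size w = n.+1.
  by exists (size w).-1; rewrite prednK.
rewrite /sym_word -/(symn (size w) w) wn /symn factS natrM invfM -scalerA.
congr (_ *: _); rewrite (picksE 0) big_map wn -[iota _ _]/(index_iota 0 n.+1).
rewrite big_mkord (sum_lift_perm ord0) scaler_sumr; apply: eq_bigr => j _ /=.
have sj : size (take j w ++ drop j.+1 w) = n by rewrite size_remove wn //=.
rewrite -/(symn (size (take j w ++ drop j.+1 w)) (take j w ++ drop j.+1 w)) sj.
rewrite (linZ (tmul_linr _)) (lin_sum (tmul_linr _)); congr (_ *: _).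
apply: eq_bigr => s _; rewrite tmul_word; congr word.
rewrite /image_mem enum_ordSl /= lift_perm_id; congr cons.
rewrite -map_comp; apply: eq_map => i /=; rewrite nth_remove.
by rewrite lift_perm_lift.
Qed.

Lemma homog_Symop k (X : tensor V) : homog k X -> homog k (Symop X).
Proof.
elim/homog_ind => [|a w Y wk _ IH].
  by rewrite (lin0 (@Symop_linear _ _)); exact: homog0.
rewrite Symop_linear; apply: homogP => //; rewrite Symop_word /sym_word.
apply: homogZ; apply: homog_sum => s; rewrite -wk.
rewrite -[X in homog X](perm_size (perm_sym_letters s)); exact: homog_word.
Qed.

End SymWord.

(** * The star product on the whole tensor algebra *)

Lemma size_picks (T : eqType) (w : seq T) p :
  p \in picks w -> (size p.2).+1 = size w.
Proof.
elim: w p => //= y w IH p; rewrite inE => /predU1P[->//|].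
by case/mapP => q /IH qw -> /=; rewrite qw.
Qed.

Section LetterContraction.
Variables (K : fieldType) (V : lmodType K).

Definition contr_word (phi : V -> K) (w : seq V) : tensor V :=
  \sum_(p <- picks w) phi p.1 *: word p.2.

Definition contr (phi : V -> K) : tensor V -> tensor V :=
  tensor_lift (contr_word phi).

Lemma contr_word_cons phi x w : contr_word phi (x :: w) =
  phi x *: word w + tmul (word [:: x]) (contr_word phi w).
Proof.
rewrite /contr_word /= big_cons big_map (lin_sum (tmul_linr _)); congr (_ + _).
by apply: eq_bigr => p _; rewrite (linZ (tmul_linr _)) tmul_word.
Qed.

Section LinearFunctional.
Variable phi : V -> K.
Hypothesis phi_lin : forall a x y, phi (a *: x + y) = a * phi x + phi y.

Let contr_word_multilinear : multilinear (contr_word phi).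
Proof.
elim=> [|z u IH] w a x y; rewrite /= !contr_word_cons.
  rewrite phi_lin word_letterP tmul_linl scalerDl -scalerA scalerDr.
  by rewrite addrACA.
rewrite word_multilinear IH tmul_linr !scalerDr !scalerA addrACA.
by rewrite [a * _]mulrC.
Qed.

Lemma contr_linear : linear (contr phi).
Proof. exact: tensor_lift_linear. Qed.

Lemma contr_wordE w : contr phi (word w) = contr_word phi w.
Proof. exact: tensor_liftE. Qed.

(** The Leibniz rule: the letter that is contracted is [x] or a letter of [X]. *)
Lemma contr_letter x (X : tensor V) :
  contr phi (tmul (word [:: x]) X) = phi x *: X + tmul (word [:: x]) (contr phi X).
Proof.
move: X; apply: tensor_ext => [|a X Y|w].
- exact: linear_comp (tmul_linr _) contr_linear.
- rewrite contr_linear tmul_linr !scalerDr addrACA !scalerA.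
  by rewrite [a * _]mulrC.
- by rewrite tmul_word !contr_wordE contr_word_cons.
Qed.
End LinearFunctional.

(** Taking out a letter leaves the order of the other letters unchanged: it does
    not matter which of two letters is taken out first. *)
Lemma contrC (phi psi : V -> K) (X : tensor V) :
  (forall a x y, phi (a *: x + y) = a * phi x + phi y) ->
  (forall a x y, psi (a *: x + y) = a * psi x + psi y) ->
  contr phi (contr psi X) = contr psi (contr phi X).
Proof.
move=> fl pl; move: X; apply: tensor_ext => [||w].
- exact: linear_comp (contr_linear pl) (contr_linear fl).
- exact: linear_comp (contr_linear fl) (contr_linear pl).
elim: w => [|x w IH].
  rewrite !contr_wordE // /contr_word !big_nil.
  by rewrite !(lin0 (contr_linear _)).
rewrite -[x :: w]/([:: x] ++ w) -tmul_word !contr_letter // !linD //;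
  try exact: contr_linear.
rewrite !(linZ (contr_linear _)) // !contr_letter // IH.
by rewrite addrA addrA [psi x *: _ + _]addrC.
Qed.

Lemma contrP a (phi psi : V -> K) (X : tensor V) :
  contr (fun y => a * phi y + psi y) X = a *: contr phi X + contr psi X.
Proof.
rewrite /contr /tensor_lift -plift_fun; congr plift; apply/funext => w.
rewrite /contr_word scaler_sumr -big_split /=; apply: eq_bigr => p _.
by rewrite scalerDl scalerA.
Qed.

End LetterContraction.

Section TensorStar.
Variables (K : numFieldType) (V : lmodType K) (Lam : V -> V -> K^o).
Hypothesis LamB : bilinear_for *:%R *:%R Lam.
Local Notation T := (tensor V).
Local Notation letter x := (word [:: x] : T).

Let Lam_linr z a x y : Lam z (a *: x + y) = a * Lam z x + Lam z y.
Proof. by have [_ lr] := LamB; exact: lr. Qed.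

Let Lam_lin z a x y : Lam (a *: x + y) z = a * Lam x z + Lam y z.
Proof. by have [ll _] := LamB; exact: ll. Qed.

Definition lcontr (x : V) : T -> T := contr (Lam x).

Let lcontr_linear x : linear (lcontr x).
Proof. exact: contr_linear. Qed.

Let lcontrP a x y (X : T) : lcontr (a *: x + y) X = a *: lcontr x X + lcontr y X.
Proof.
rewrite /lcontr -contrP; congr contr; apply/funext => z.
by rewrite (Lam_lin z).
Qed.

Let lcontrC x y (X : T) : lcontr x (lcontr y X) = lcontr y (lcontr x X).
Proof. exact: contrC. Qed.

Let lcontr1 x : lcontr x (word [::]) = 0.
Proof. by rewrite /lcontr contr_wordE // /contr_word big_nil. Qed.

(** The contraction of every letter on the left with every letter on the right:
    on symmetric tensors it agrees with [PLam], which only sees the two letters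
    that face each other, and it is easier to commute with other operators. *)
Definition fullP_word (u : seq V) (Y : T) : tprod T T :=
  \sum_(p <- picks u) tens (word p.2) (lcontr p.1 Y).

Definition fullP : tprod T T -> tprod T T :=
  tprod_lift (fun X Y => tensor_lift (fullP_word^~ Y) X).

Definition lmul (x : V) : tprod T T -> tprod T T :=
  tprod_map (tmul (letter x)) id.

Definition rcontr (x : V) : tprod T T -> tprod T T := tprod_map id (lcontr x).

Let id_linear : linear (id : T -> T). Proof. by []. Qed.

Lemma lmul_linear x : linear (lmul x).
Proof. exact: tprod_map_linear (tmul_linr _) id_linear. Qed.

Lemma lmulE x X Y : lmul x (tens X Y) = tens (tmul (letter x) X) Y.
Proof. exact: tprod_mapE (tmul_linr _) id_linear _ _. Qed.

Lemma rcontr_linear x : linear (rcontr x).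
Proof. exact: tprod_map_linear id_linear (lcontr_linear x). Qed.

Lemma rcontrE x X Y : rcontr x (tens X Y) = tens X (lcontr x Y).
Proof. exact: tprod_mapE id_linear (lcontr_linear x) _ _. Qed.

Lemma fullP_word_cons x u Y :
  fullP_word (x :: u) Y = tens (word u) (lcontr x Y) + lmul x (fullP_word u Y).
Proof.
rewrite /fullP_word /= big_cons big_map (lin_sum (lmul_linear x)).
by congr (_ + _); apply: eq_bigr => p _; rewrite lmulE tmul_word.
Qed.

Let lmulP a x y Z : lmul (a *: x + y) Z = a *: lmul x Z + lmul y Z.
Proof.
move: Z; apply: tprod_ext => [|b Z Z'|X Y].
- exact: lmul_linear.
- by rewrite !lmul_linear !scalerDr addrACA !scalerA [a * b]mulrC.
- by rewrite !lmulE word_letterP tmul_linl tens_linl.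
Qed.

Let fullP_word_multilinear Y : multilinear (fullP_word^~ Y).
Proof.
elim=> [|z u IH] w a x y; rewrite /= !fullP_word_cons.
  by rewrite lcontrP tens_linr lmulP scalerDr addrACA.
by rewrite word_multilinear tens_linl IH lmul_linear scalerDr addrACA.
Qed.

Let fullP_word_linear u : linear (fullP_word u).
Proof.
move=> a Y Y'; rewrite /fullP_word scaler_sumr -big_split /=.
by apply: eq_bigr => p _; rewrite lcontr_linear tens_linr.
Qed.

Let fullP_bilinear :
  bilinear_for *:%R *:%R (fun X Y => tensor_lift (fullP_word^~ Y) X).
Proof.
split=> [Y|X] a Z Z'; first exact: (tensor_lift_linear (fullP_word_multilinear Y)).
rewrite /= /tensor_lift -plift_fun; congr plift; apply/funext => u.
exact: fullP_word_linear.
Qed.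

Lemma fullP_linear : linear fullP.
Proof. exact: tprod_lift_linear. Qed.

Lemma fullPE u Y : fullP (tens (word u) Y) = fullP_word u Y.
Proof. by rewrite /fullP tprod_liftE // tensor_liftE. Qed.

Let iter_fullP_linear t : linear (iter t fullP).
Proof. by elim: t => [|t IH] a Z Z'; rewrite //= IH fullP_linear. Qed.

(** The new letter [x] is either left alone or contracted with a letter on the
    right. *)
Lemma fullP_lmul x Z : fullP (lmul x Z) = lmul x (fullP Z) + rcontr x Z.
Proof.
move: Z; apply: tprod_tensor_ext => [|a Z Z'|u w].
- exact: linear_comp (lmul_linear x) fullP_linear.
- by rewrite fullP_linear rcontr_linear lmul_linear scalerDr addrACA.
- by rewrite lmulE tmul_word !fullPE fullP_word_cons rcontrE addrC.
Qed.

Lemma fullP_rcontr x Z : fullP (rcontr x Z) = rcontr x (fullP Z).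
Proof.
move: Z; apply: tprod_tensor_ext => [||u w].
- exact: linear_comp (rcontr_linear x) fullP_linear.
- exact: linear_comp fullP_linear (rcontr_linear x).
rewrite rcontrE !fullPE /fullP_word (lin_sum (rcontr_linear x)).
by apply: eq_bigr => p _; rewrite rcontrE lcontrC.
Qed.

(** [fullP] commutes with the commutator of [fullP] and [lmul x], which makes the
    Leibniz rule for its powers exact. *)
Lemma iter_fullP_lmul t x Z : iter t.+1 fullP (lmul x Z) =
  lmul x (iter t.+1 fullP Z) + t.+1%:R *: rcontr x (iter t fullP Z).
Proof.
elim: t => [|t IH]; first by rewrite /= fullP_lmul scale1r.
rewrite iterS IH (linD fullP_linear) fullP_lmul (linZ fullP_linear).
rewrite fullP_rcontr -addrA; congr (_ + _).
by rewrite -[t.+2]addn1 addnC natrD scalerDl scale1r.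
Qed.

Definition tmulL : tprod T T -> T := tprod_lift (@tmul K V).

Lemma tmulL_linear : linear tmulL.
Proof. exact/tprod_lift_linear/tmul_bilinear. Qed.

Lemma tmulLE X Y : tmulL (tens X Y) = tmul X Y.
Proof. exact/tprod_liftE/tmul_bilinear. Qed.

Lemma tmulL_lmul x Z : tmulL (lmul x Z) = tmul (letter x) (tmulL Z).
Proof.
move: Z; apply: tprod_ext => [||X Y].
- exact: linear_comp (lmul_linear x) tmulL_linear.
- exact: linear_comp tmulL_linear (tmul_linr _).
- by rewrite lmulE !tmulLE tmulA.
Qed.

Definition tstar_term t (X Y : T) : T :=
  t`!%:R^-1 *: tmulL (iter t fullP (tens X Y)).

Lemma tstar_term_linl t Y : linear (fun X => tstar_term t X Y).
Proof.
move=> a X X'; rewrite /tstar_term tens_linl iter_fullP_linear tmulL_linear.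
by rewrite scalerDr !scalerA mulrC.
Qed.

Lemma tstar_term0 X Y : tstar_term 0 X Y = tmul X Y.
Proof. by rewrite /tstar_term invr1 scale1r tmulLE. Qed.

Lemma tstar_term_nil t Y : tstar_term t.+1 (word [::]) Y = 0.
Proof.
rewrite /tstar_term iterSr fullPE /fullP_word big_nil.
by rewrite (lin0 (iter_fullP_linear t)) (lin0 tmulL_linear) scaler0.
Qed.

(** The factor [t + 1] of the Leibniz rule turns [(t+1)!] into [t!]. *)
Lemma tstar_term_letter t x X Y : tstar_term t.+1 (tmul (letter x) X) Y =
  tmul (letter x) (tstar_term t.+1 X Y) + tstar_term t X (lcontr x Y).
Proof.
have fact0 n : n`!%:R != 0 :> K by rewrite pnatr_eq0 -lt0n fact_gt0.
rewrite /tstar_term -lmulE iter_fullP_lmul (linD tmulL_linear) tmulL_lmul.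
rewrite scalerDr (linZ (tmul_linr _)) (linZ tmulL_linear); congr (_ + _).
have comm : rcontr x (iter t fullP (tens X Y)) = iter t fullP (tens X (lcontr x Y)).
  rewrite -rcontrE; elim: t => //= t IH; by rewrite -IH fullP_rcontr.
rewrite comm scalerA factS natrM invfM mulrAC mulVf ?mul1r //.
Qed.

(** The recursion of [tstar_term_letter], summed over [t]. *)
Fixpoint tstar_word (u : seq V) (Y : T) : T :=
  if u is x :: u' then tmul (letter x) (tstar_word u' Y) + tstar_word u' (lcontr x Y)
  else Y.

Definition tstar (X Y : T) : T := tensor_lift (tstar_word^~ Y) X.

Let tstar_word_linear u : linear (tstar_word u).
Proof.
elim: u => [|x u IH] a Y Y' //=.
by rewrite IH tmul_linr lcontr_linear IH scalerDr addrACA.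
Qed.

Let tstar_word_multilinear Y : multilinear (tstar_word^~ Y).
Proof.
move=> u; elim: u Y => [|z u IH] Y w a x y /=.
  rewrite word_letterP tmul_linl lcontrP tstar_word_linear scalerDr.
  by rewrite addrACA.
by rewrite !IH tmul_linr scalerDr addrACA.
Qed.

Lemma tstar_linl Y : linear (fun X => tstar X Y).
Proof. exact: (tensor_lift_linear (tstar_word_multilinear Y)). Qed.

Lemma tstar_wordE u Y : tstar (word u) Y = tstar_word u Y.
Proof. exact: (tensor_liftE _ (tstar_word_multilinear Y)). Qed.

Lemma tstar_linr X : linear (tstar X).
Proof.
move=> a Y Y'; rewrite /tstar /tensor_lift -plift_fun; congr plift.
by apply/funext => u; exact: tstar_word_linear.
Qed.

Lemma tstar_letter x X Y :
  tstar (tmul (letter x) X) Y = tmul (letter x) (tstar X Y) + tstar X (lcontr x Y).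
Proof.
move: X; apply: tensor_ext => [|a X X'|u].
- exact: linear_comp (tmul_linr _) (tstar_linl Y).
- by rewrite !tstar_linl tmul_linr scalerDr addrACA.
- by rewrite tmul_word !tstar_wordE.
Qed.

Lemma tstar1l Y : tstar (word [::]) Y = Y.
Proof. exact: tstar_wordE. Qed.

Lemma tstar1r X : tstar X (word [::]) = X.
Proof.
move: X; apply: tensor_ext => [||u]; first exact: tstar_linl.
  by [].
elim: u => [|x u IH]; first exact: tstar1l.
rewrite -[x :: u]/([:: x] ++ u) -tmul_word tstar_letter IH lcontr1.
by rewrite (lin0 (tstar_linr _)) addr0.
Qed.

Lemma lcontr_letter x y X :
  lcontr x (tmul (letter y) X) = Lam x y *: X + tmul (letter y) (lcontr x X).
Proof. exact: contr_letter. Qed.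

(** A derivation of the tensor product that commutes with all contractions is a
    derivation of [tstar]. *)
Lemma lcontr_tstar x X Y :
  lcontr x (tstar X Y) = tstar (lcontr x X) Y + tstar X (lcontr x Y).
Proof.
move: X; apply: tensor_ext => [|a X X'|u].
- exact: linear_comp (tstar_linl Y) (lcontr_linear x).
- by rewrite !(tstar_linl, lcontr_linear) scalerDr addrACA.
elim: u Y => [|y u IH] Y.
  by rewrite lcontr1 !tstar1l (lin0 (tstar_linl _)) add0r.
rewrite -[y :: u]/([:: y] ++ u) -tmul_word !(tstar_letter, lcontr_letter).
rewrite (linD (lcontr_linear x)) lcontr_letter !IH (linD (tmul_linr _)).
rewrite (linD (tstar_linl Y)) (linZ (tstar_linl Y)) tstar_letter.
rewrite (lcontrC x y) -!addrA; congr (_ + (_ + _)).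
by rewrite addrCA.
Qed.

(** Associativity holds before symmetrisation. Left multiplication by a letter
    becomes, up to the derivation [lcontr x] of [tstar], a left multiplication for
    [tstar]; this reduces the identity to shorter left factors. *)
Lemma tstarA X Y Z : tstar X (tstar Y Z) = tstar (tstar X Y) Z.
Proof.
move: X; apply: tensor_ext => [||u].
- exact: tstar_linl.
- exact: linear_comp (tstar_linl Y) (tstar_linl Z).
elim: u Y Z => [|x u IH] Y Z; first by rewrite !tstar1l.
rewrite -[x :: u]/([:: x] ++ u) -tmul_word !tstar_letter (linD (tstar_linl Z)).
rewrite tstar_letter IH lcontr_tstar (linD (tstar_linr _)) !IH.
by rewrite -addrA [X in _ + X]addrC.
Qed.

Lemma tstar_sum X : exists n, forall m, (n <= m)%N -> forall Y,
  \sum_(t < m) tstar_term t X Y = tstar X Y.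
Proof.
have base u m Y : (size u < m)%N ->
    \sum_(t < m) tstar_term t (word u) Y = tstar (word u) Y.
  elim: u m Y => [|x u IH] [//|m] Y.
    rewrite big_ord_recl tstar_term0 tmul1l big1 ?addr0 ?tstar1l // => t _.
    exact: tstar_term_nil.
  rewrite ltnS => um; rewrite -[x :: u]/([:: x] ++ u) -tmul_word tstar_letter.
  rewrite big_ord_recl tstar_term0 -tmulA.
  under eq_bigr do rewrite tstar_term_letter.
  rewrite big_split /= -(lin_sum (tmul_linr _)) addrA -(linD (tmul_linr _)).
  rewrite -(tstar_term0 (word u)) IH //; congr (tmul _ _ + _).
  rewrite -(IH m.+1); last exact: leqW.
  by rewrite [RHS]big_ord_recl.
elim/presented_ind: X => [|a u X [n IH]].
  exists 0%N => m _ Y; rewrite (lin0 (tstar_linl Y)) big1 // => t _.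
  exact: (lin0 (tstar_term_linl t Y)).
exists (maxn (size u).+1 n) => m; rewrite geq_max => /andP[um nm] Y.
under eq_bigr do rewrite tstar_term_linl.
by rewrite big_split /= -scaler_sumr IH // base // tstar_linl.
Qed.

(** * The star product on symmetric tensors *)

(** [PLam] multiplies by the two degrees: the formula needs homogeneous factors. *)
Lemma PLam_letters k l (A B : T) x y : homog k A -> homog l B ->
  PLam Lam (tens (tmul A (letter x)) (tmul (letter y) B)) =
  (k.+1 * l.+1)%:R * Lam x y *: tens A B.
Proof.
have PL := PLam_linear LamB.
move=> hA hB; elim/homog_ind: A / hA => [|a u A uk _ IH].
  rewrite (lin0 (tmul_linl _)) !(lin0 (tens_linl _)) (lin0 PL).
  by rewrite scaler0.
rewrite tmul_linl !tens_linl PL IH scalerDr; congr (_ + _).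
rewrite scalerA mulrC -scalerA; congr (_ *: _).
move=> {IH}; elim/homog_ind: B / hB => [|b w B wl _ IH].
  by rewrite (lin0 (tmul_linr _)) !(lin0 (tens_linr _)) (lin0 PL) !scaler0.
rewrite tmul_linr !tens_linr PL IH !scalerDr; congr (_ + _).
rewrite !tmul_word PLam_tens // /PLam_word cats1 size_rcons last_rcons /=.
rewrite -cats1 take_size_cat // uk wl !scalerA; congr (_ *: _).
by rewrite natrM; ring.
Qed.

Lemma PLam_nill Y : PLam Lam (tens (word [::]) Y) = 0.
Proof.
have PL := PLam_linear LamB.
move: Y; apply: tensor_ext => [||w].
- exact: linear_comp (tens_linr _) PL.
- by move=> a X Y; rewrite scaler0 addr0.
- by rewrite PLam_tens // /PLam_word mul0n mul0r scale0r.
Qed.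

Lemma PLam_nilr X : PLam Lam (tens X (word [::])) = 0.
Proof.
have PL := PLam_linear LamB.
move: X; apply: tensor_ext => [||w].
- exact: linear_comp (tens_linl _) PL.
- by move=> a X Y; rewrite scaler0 addr0.
- by rewrite PLam_tens // /PLam_word muln0 mul0r scale0r.
Qed.

Definition Sym2 : tprod T T -> tprod T T := tprod_map (@Symop K V) (@Symop K V).

Let Sym_lin := @Symop_linear K V.

Lemma Sym2_linear : linear Sym2.
Proof. exact: tprod_map_linear. Qed.

Lemma Sym2E X Y : Sym2 (tens X Y) = tens (Symop X) (Symop Y).
Proof. exact: tprod_mapE. Qed.

Let sym_word_nil : sym_word ([::] : seq V) = word [::].
Proof.
rewrite /sym_word /= invr1 scale1r (eq_bigr (fun=> word [::])) => [|s _].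
  by rewrite sumr_const card_Sn.
by congr word; apply: size0nil; rewrite size_map size_enum_ord.
Qed.

Let homog_sym_word (w : seq V) : homog (size w) (sym_word w).
Proof. by rewrite -Symop_word; exact/homog_Symop/homog_word. Qed.

(** In a symmetrised word of length [k], each letter stands in the facing position
    with weight [1/k] ([sym_word_rcons] and [sym_word_cons]). The factor [k l] of
    [PLam] cancels these weights, and all pairs of letters are contracted. *)
Lemma PLam_Sym2 Z : PLam Lam (Sym2 Z) = Sym2 (fullP Z).
Proof.
have PL := PLam_linear LamB.
move: Z; apply: tprod_tensor_ext => [||u w].
- exact: linear_comp Sym2_linear PL.
- exact: linear_comp fullP_linear Sym2_linear.
rewrite Sym2E fullPE !Symop_word /fullP_word (lin_sum Sym2_linear).
have [->|u0] := eqVneq u [::].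
  by rewrite sym_word_nil PLam_nill big_nil.
have [->|w0] := eqVneq w [::].
  rewrite sym_word_nil PLam_nilr big1 // => p _.
  by rewrite lcontr1 (lin0 (tens_linr _)) (lin0 Sym2_linear).
have su : (0 < size u)%N by rewrite lt0n size_eq0.
have sw : (0 < size w)%N by rewrite lt0n size_eq0.
rewrite sym_word_rcons // (sym_word_cons sw).
rewrite (linZ (tens_linl _)) (linZ PL) (lin_sum (tens_linl _)) (lin_sum PL).
rewrite scaler_sumr !big_seq; apply: eq_bigr => p /size_picks pu.
rewrite Sym2E Symop_word /lcontr contr_wordE // /contr_word (lin_sum Sym_lin).
rewrite (linZ (tens_linr _)) (linZ PL) !(lin_sum (tens_linr _)) (lin_sum PL).
rewrite !scaler_sumr !big_seq; apply: eq_bigr => q /size_picks qw.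
rewrite (PLam_letters _ _ (homog_sym_word _) (homog_sym_word _)) pu qw.
rewrite (linZ Sym_lin) (linZ (tens_linr _)) Symop_word !scalerA natrM.
congr (_ *: _); have /negPf un : (size u)%:R != 0 :> K by rewrite pnatr_eq0 -lt0n.
have /negPf wn : (size w)%:R != 0 :> K by rewrite pnatr_eq0 -lt0n.
by field; rewrite un wn.
Qed.

Lemma iter_PLam_Sym2 t Z : iter t (PLam Lam) (Sym2 Z) = Sym2 (iter t fullP Z).
Proof. by elim: t => //= t ->; rewrite PLam_Sym2. Qed.

Lemma mu_vee_Sym2 Z : symval (mu_vee (Sym2 Z)) = Symop (tmulL Z).
Proof.
have muL := @mu_vee_linear K V.
move: Z; apply: tprod_ext => [a Z Z'||X Y].
- by rewrite Sym2_linear muL.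
- exact: linear_comp tmulL_linear Sym_lin.
- by rewrite Sym2E mu_vee_tens tmulLE Symop_tmull Symop_tmulr.
Qed.

Lemma star_term_symproj t X Y :
  star_term Lam t (symproj X) (symproj Y) = symproj (tstar_term t X Y).
Proof.
apply: val_inj; rewrite /star_term /= -Sym2E iter_PLam_Sym2 mu_vee_Sym2.
by rewrite /tstar_term (linZ Sym_lin).
Qed.

Lemma symprojP (A : symtensor V) : exists X, A = symproj X.
Proof.
case: A => X /= hX; have /asboolP[Y XY] := hX; exists Y.
exact: val_inj.
Qed.

Lemma star_sum (A B : symtensor V) : exists n, forall m, (n <= m)%N ->
  star Lam A B = \sum_(t < m) star_term Lam t A B.
Proof.
have [n nA] := iter_PLam_eq0 LamB (symval A).
exists n.+1 => m nm; rewrite (fsbig_ord _ _ (fun t => star_term Lam t A B)).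
apply/esym/fsbig_widen => // t [_ /= /negP]; rewrite -leqNgt => mt.
rewrite /star_term nA ?(leq_trans nm) //.
by rewrite (lin0 (@mu_vee_linear _ _)) scaler0.
Qed.

(** This transports the algebraic properties of [tstar] to the star product. *)
Lemma star_symproj X Y : star Lam (symproj X) (symproj Y) = symproj (tstar X Y).
Proof.
have [n nS] := star_sum (symproj X) (symproj Y).
have [m mS] := tstar_sum X.
rewrite (nS _ (leq_maxl n m)) -(mS _ (leq_maxr n m)).
rewrite (lin_sum (@symproj_linear _ _)).
by apply: eq_bigr => t _; rewrite star_term_symproj.
Qed.

Lemma star_bilinear : bilinear_for *:%R *:%R (star Lam).
Proof.
have sl := @symproj_linear K V.
split=> [B|A] a A' B' /=.
  have [X ->] := symprojP A'; have [Y ->] := symprojP B'; have [Z ->] := symprojP B.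
  by rewrite -sl !star_symproj tstar_linl sl.
have [X ->] := symprojP A'; have [Y ->] := symprojP B'; have [Z ->] := symprojP A.
by rewrite -sl !star_symproj tstar_linr sl.
Qed.

Lemma starA : associative (star Lam).
Proof.
move=> A B D; have [X ->] := symprojP A; have [Y ->] := symprojP B.
by have [Z ->] := symprojP D; rewrite !star_symproj tstarA.
Qed.

Lemma star_unit : exists e, left_id e (star Lam) /\ right_id e (star Lam).
Proof.
exists (symproj (word [::])); split=> A; have [X ->] := symprojP A.
  by rewrite star_symproj tstar1l.
by rewrite star_symproj tstar1r.
Qed.

End TensorStar.

(** * Hilbert seminorms on the tensor algebra *)

Lemma sum_Cauchy_Schwarz (C : numClosedFieldType) n (a b : nat -> C) :
  (forall i, 0 <= a i) -> (forall i, 0 <= b i) ->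
  (\sum_(i < n) a i * b i) ^+ 2 <=
  (\sum_(i < n) a i ^+ 2) * (\sum_(i < n) b i ^+ 2).
Proof.
move=> a0 b0; elim: n => [|n IH]; first by rewrite !big_ord0 expr0n mul0r.
rewrite !big_ord_recr /=; move: IH.
set S := \sum_(i < n) a i * b i; set A := \sum_(i < n) a i ^+ 2.
set B := \sum_(i < n) b i ^+ 2 => IH.
have S0 : 0 <= S by apply: sumr_ge0 => i _; rewrite mulr_ge0.
have A0 : 0 <= A by apply: sumr_ge0 => i _; rewrite exprn_ge0.
have B0 : 0 <= B by apply: sumr_ge0 => i _; rewrite exprn_ge0.
have Sle : S <= sqrtC A * sqrtC B.
  rewrite -(ler_pXn2r (ltn0Sn 1)) ?nnegrE ?mulr_ge0 ?sqrtC_ge0 //.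
  by rewrite exprMn !sqrtCK.
have aR : a n \is Num.real by rewrite ger0_real.
have bR : b n \is Num.real by rewrite ger0_real.
have AR : sqrtC A \is Num.real by rewrite ger0_real ?sqrtC_ge0.
have BR : sqrtC B \is Num.real by rewrite ger0_real ?sqrtC_ge0.
have : 0 <= (sqrtC A * b n - sqrtC B * a n) ^+ 2.
  by apply: real_exprn_even_ge0 => //; rewrite rpredB ?rpredM.
have -> : (sqrtC A * b n - sqrtC B * a n) ^+ 2 =
    A * b n ^+ 2 + B * a n ^+ 2 - 2 * (sqrtC A * sqrtC B) * (a n * b n).
  by rewrite -{2}[A]sqrtCK -{2}[B]sqrtCK; ring.
rewrite subr_ge0 => le1.
have -> : (A + a n ^+ 2) * (B + b n ^+ 2) =
   A * B + (A * b n ^+ 2 + B * a n ^+ 2) + (a n * b n) ^+ 2 by ring.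
have -> : (S + a n * b n) ^+ 2 = S ^+ 2 + 2 * S * (a n * b n) + (a n * b n) ^+ 2.
  by ring.
rewrite lerD2r lerD //; apply: le_trans le1.
by rewrite ler_wpM2r ?mulr_ge0 // ler_wpM2l.
Qed.

Section HilbertTensor.
Variables (R : realType) (V : tvsType R[i]).
Local Notation C := R[i].
Local Notation T := (tensor V).
Local Notation letter x := (word [:: x] : T).
Implicit Types (h : hilbert_form V) (X Y A B : T).

Lemma hform_psd h : psd_form (h : V -> V -> C).
Proof.
split=> [a x y z|x y|x]; [exact: hform_linear|exact: hform_herm|exact: hform_ge0].
Qed.

Let tformPr h X a Y Z : tform h X (a *: Y + Z) = a * tform h X Y + tform h X Z.
Proof. exact: tform_linear. Qed.

Let tform0r h X : tform h X 0 = 0.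
Proof. exact: (lin0 (tform_linear h X)). Qed.

Let tform0l h X : tform h 0 X = 0.
Proof. by rewrite tform_herm tform0r rmorph0. Qed.

Let tformZ h a b X Y : tform h (a *: X) (b *: Y) = a^* * b * tform h X Y.
Proof.
rewrite -[a *: X]addr0 -[b *: Y]addr0 tform_antilinear tform0l tformPr.
by rewrite tform0r !addr0 mulrA.
Qed.

Lemma tform_orth h k l X Y : homog k X -> homog l Y -> k != l -> tform h X Y = 0.
Proof.
move=> hX hY kl; elim/homog_ind: X / hX => [|a u X uk _ IH].
  exact: tform0l.
rewrite tform_antilinear IH addr0; apply/eqP; rewrite mulf_eq0; apply/orP; right.
apply/eqP; elim/homog_ind: Y / hY {IH} => [|b w Y wl _ IH]; first exact: tform0r.
by rewrite tformPr IH tform_words /tform_word uk wl (negPf kl) mulr0 addr0.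
Qed.

Let tform_cat h u u' w w' : size u = size u' -> size w = size w' ->
  tform_word h (u ++ w) (u' ++ w') =
  'C(size u + size w, size u)%:R * tform_word h u u' * tform_word h w w'.
Proof.
move=> eu ew; rewrite /tform_word !size_cat -!eu -!ew !eqxx zip_cat // big_cat /=.
rewrite -(bin_fact (leq_addr (size w) (size u))) addKn !natrM.
by ring.
Qed.

(** The binomial coefficient is the quotient of the factor [(k+l)!] of the left-hand
    side by the factors [k!] and [l!] of the right-hand side. *)
Lemma tform_tmul h k l A A' B B' : homog k A -> homog k A' -> homog l B ->
  homog l B' -> tform h (tmul A B) (tmul A' B') =
  'C(k + l, k)%:R * tform h A A' * tform h B B'.
Proof.
move=> hA hA' hB hB'; elim/homog_ind: A / hA => [|a u A uk _ IH].
  by rewrite (lin0 (tmul_linl _)) !tform0l mulr0 mul0r.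
rewrite tmul_linl !tform_antilinear IH mulrDr mulrDl; congr (_ + _).
rewrite mulrCA -!mulrA; congr (_ * _); move=> {IH}.
elim/homog_ind: A' / hA' => [|a' u' A' uk' _ IH].
  by rewrite (lin0 (tmul_linl _)) !tform0r mul0r mulr0.
rewrite tmul_linl !tformPr IH mulrDl mulrDr; congr (_ + _).
rewrite -mulrA mulrCA; congr (_ * _); move=> {IH}.
rewrite mulrA; elim/homog_ind: B / hB => [|b w B wl _ IH].
  by rewrite (lin0 (tmul_linr _)) !tform0l !mulr0.
rewrite tmul_linr !tform_antilinear IH !mulrDr; congr (_ + _).
rewrite [RHS]mulrCA; congr (_ * _); move=> {IH}.
elim/homog_ind: B' / hB' => [|b' w' B' wl' _ IH].
  by rewrite (lin0 (tmul_linr _)) !tform0r !mulr0.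
rewrite tmul_linr !tformPr IH !mulrDr; congr (_ + _).
rewrite [RHS]mulrCA; congr (_ * _); move=> {IH}.
by rewrite !tmul_word !tform_words tform_cat ?uk ?wl // -mulrA.
Qed.

Lemma tform_letter h x y : tform h (letter x) (letter y) = h x y.
Proof. by rewrite tform_words /tform_word /= mul1r big_seq1. Qed.

Lemma tform_rcons h k A A' x y : homog k A -> homog k A' ->
  tform h (tmul A (letter x)) (tmul A' (letter y)) =
  k.+1%:R * (h x y * tform h A A').
Proof.
move=> hA hA'; rewrite (tform_tmul h hA hA' (homog_word [:: x]) (homog_word [:: y])).
by rewrite tform_letter /= addn1 binSn mulrAC -mulrA.
Qed.

Lemma tform_cons h k A A' x y : homog k A -> homog k A' ->
  tform h (tmul (letter x) A) (tmul (letter y) A') =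
  k.+1%:R * (h x y * tform h A A').
Proof.
move=> hA hA'; rewrite (tform_tmul h (homog_word [:: x]) (homog_word [:: y]) hA hA').
by rewrite tform_letter /= add1n bin1 mulrA.
Qed.

(** Restricting to one degree makes positivity a statement that can be proved by
    induction, one tensor factor at a time. *)
Definition tform_deg h k X Y : C := tform h (hproj k X) (hproj k Y).

Let tform_deg_homog h k X Y : homog k X -> homog k Y ->
  tform_deg h k X Y = tform h X Y.
Proof. by rewrite /tform_deg => -> ->. Qed.

Let tform_deg_lin h k X a Y Z :
  tform_deg h k X (a *: Y + Z) = a * tform_deg h k X Y + tform_deg h k X Z.
Proof. by rewrite /tform_deg hproj_linear tformPr. Qed.

Let tform_deg_herm h k X Y : tform_deg h k Y X = (tform_deg h k X Y)^*.
Proof. exact: tform_herm. Qed.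

Lemma homog0E X : homog 0 X -> exists c : C, X = c *: word [::].
Proof.
elim/homog_ind => [|a [|//] Y _ _ [c ->]]; first by exists 0; rewrite scale0r.
by exists (a + c); rewrite scalerDl.
Qed.

Let tform_rcons_sum h k n (A : nat -> T) (x : nat -> V) :
  (forall i, homog k (A i)) ->
  tform h (\sum_(i < n) tmul (A i) (letter (x i)))
          (\sum_(i < n) tmul (A i) (letter (x i))) =
  k.+1%:R * \sum_(i < n) \sum_(j < n) h (x i) (x j) * tform h (A i) (A j).
Proof.
move=> hA; set X := \sum_(i < n) _.
have tsumr Y m (F : 'I_m -> T) : tform h Y (\sum_i F i) = \sum_i tform h Y (F i).
  exact: (lin_sum (tform_linear h Y)).
have tsuml Y m (F : 'I_m -> T) : tform h (\sum_i F i) Y = \sum_i tform h (F i) Y.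
  rewrite tform_herm tsumr rmorph_sum; apply: eq_bigr => i _.
  by rewrite [RHS]tform_herm.
rewrite /X tsuml mulr_sumr; apply: eq_bigr => i _.
rewrite tsumr mulr_sumr; apply: eq_bigr => j _; exact: tform_rcons.
Qed.

(** Positivity passes to one more tensor factor by the Schur product theorem. *)
Lemma tform_deg_psd h k : psd_form (tform_deg h k).
Proof.
split=> [a x0 y0 z0||]; [exact: tform_deg_lin|exact: tform_deg_herm|].
suff pos X : homog k X -> 0 <= tform h X X by move=> X; apply/pos/homog_hproj.
elim: k X => [|k IH] X hX.
  have [c ->] := homog0E hX.
  rewrite tformZ tform_words /tform_word /= mul1r big_nil mulr1 mulrC -normCK.
  by rewrite exprn_ge0.
have [n [A [x [hA ->]]]] := homog_rcons hX.
have Tp : psd_form (tform_deg h k).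
  split=> [a x0 y0 z0||]; [exact: tform_deg_lin|exact: tform_deg_herm|move=> Y].
  exact/IH/homog_hproj.
rewrite (tform_rcons_sum _ _ _ hA) mulr_ge0 ?ler0n //.
have := psd_Schur n x A (hform_psd h) Tp; congr (_ <= _).
apply: eq_bigr => i _; apply: eq_bigr => j _; by rewrite tform_deg_homog.
Qed.

Lemma tform_deg_sum h X Y : exists n, forall m, (n <= m)%N ->
  tform h X Y = \sum_(k < m) tform_deg h k X Y.
Proof.
have [n nX] := hproj_sum X; have [n' nY] := hproj_sum Y.
exists (maxn n n') => m; rewrite geq_max => /andP[nm nm'].
rewrite {1}(nY _ nm') (lin_sum (tform_linear h X)); apply: eq_bigr => k _.
rewrite {1}(nX _ nm) tform_herm (lin_sum (tform_linear h _)) rmorph_sum.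
rewrite (bigD1 k) //= [X in _ + X]big1 ?addr0 => [|l lk]; last first.
  rewrite (tform_orth h (homog_hproj k Y) (homog_hproj l X)) ?rmorph0 //.
  by rewrite eq_sym; apply: contra lk => /eqP kl; apply/eqP/val_inj.
by rewrite -tform_herm.
Qed.

Lemma tform_psd h : psd_form (tform h).
Proof.
split=> [a X Y Z|X Y|X]; [exact: tformPr|exact: tform_herm|].
have [n /(_ _ (leqnn n)) ->] := tform_deg_sum h X X.
by apply: sumr_ge0 => k _; exact: psd_ge0 (tform_deg_psd h k) X.
Qed.

Lemma tnormE h : tnorm h = psd_norm (tform h).
Proof. by []. Qed.

Lemma tnorm_ge0 h X : 0 <= tnorm h X.
Proof. exact: psd_norm_ge0 (tform_psd h) X. Qed.

Lemma tnormD h X Y : tnorm h (X + Y) <= tnorm h X + tnorm h Y.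
Proof. by rewrite tnormE; apply: psd_normD; exact: tform_psd. Qed.

Lemma tnormZ h a X : tnorm h (a *: X) = `|a| * tnorm h X.
Proof. by rewrite tnormE; apply: psd_normZ; exact: tform_psd. Qed.

Lemma tnorm0 h : tnorm h 0 = 0.
Proof. by rewrite tnormE; apply: psd_norm0; exact: tform_psd. Qed.

Lemma tnorm_sum h (I : Type) (r : seq I) (P : pred I) (F : I -> T) :
  tnorm h (\sum_(i <- r | P i) F i) <= \sum_(i <- r | P i) tnorm h (F i).
Proof. by rewrite tnormE; apply: psd_norm_sum; exact: tform_psd. Qed.

Lemma tnorm_sqr h X : tnorm h X ^+ 2 = tform h X X.
Proof. exact: sqrtCK. Qed.

Lemma tnorm_le h h' X Y : tform h X X <= tform h' Y Y -> tnorm h X <= tnorm h' Y.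
Proof.
by rewrite -!tnorm_sqr ler_pXn2r // nnegrE; exact: tnorm_ge0.
Qed.

Lemma tform_deg_le h k X : tform_deg h k X X <= tform h X X.
Proof.
have [n /(_ (maxn n k.+1) (leq_maxl _ _)) ->] := tform_deg_sum h X X.
have kn : (k < maxn n k.+1)%N by rewrite leq_max ltnSn orbT.
rewrite (bigD1 (Ordinal kn)) //= lerDl; apply: sumr_ge0 => l _.
exact: psd_ge0 (tform_deg_psd h l) X.
Qed.

Lemma tnorm_hproj h k X : tnorm h (hproj k X) <= tnorm h X.
Proof. by apply: tnorm_le; exact: tform_deg_le. Qed.

(** Replacing [h] by [h'] in one tensor factor at a time: the difference of the
    two forms splits into a term with [h' - h] in the last factor and a term with
    the difference of the forms of lower degree. *)
Lemma tnorm_mono h h' : (forall x, (h x x : C) <= h' x x) ->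
  forall X, tnorm h X <= tnorm h' X.
Proof.
move=> hh'; pose d x y : C := h' x y - h x y.
have dp : psd_form d by exact: psd_formB (hform_psd h') (hform_psd h) hh'.
have deg k X : homog k X -> tform h X X <= tform h' X X.
  elim: k X => [|k IH] X hX.
    have [c ->] := homog0E hX.
    by rewrite !tformZ !tform_words /tform_word /= !big_nil.
  have [n [A [x [hA ->]]]] := homog_rcons hX.
  pose D X Y := tform_deg h' k X Y - tform_deg h k X Y.
  have Dp : psd_form D.
    apply: psd_formB (tform_deg_psd h' k) (tform_deg_psd h k) _ => Y.
    exact/IH/homog_hproj.
  rewrite !(tform_rcons_sum _ _ _ hA) ler_wpM2l ?ler0n // -subr_ge0 -sumrB.
  have := addr_ge0 (psd_Schur n x A dp (tform_deg_psd h' k))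
                   (psd_Schur n x A (hform_psd h) Dp).
  rewrite -big_split /=; congr (_ <= _); apply: eq_bigr => i _.
  rewrite -big_split -sumrB /=; apply: eq_bigr => j _.
  by rewrite /d /D !tform_deg_homog //; ring.
move=> X; apply: tnorm_le.
have [n nX] := tform_deg_sum h X X; have [n' nX'] := tform_deg_sum h' X X.
rewrite (nX _ (leq_maxl n n')) (nX' _ (leq_maxr n n')).
by apply: ler_sum => k _; exact/deg/homog_hproj.
Qed.

Definition hsum h h' : hilbert_form V.
Proof.
refine (@HilbertForm _ _ (fun x y => h x y + h' x y) _ _ _ _ _).
- by move=> x a y z; rewrite !hform_linear scalerDr addrACA.
- by move=> y a x z; rewrite !hform_antilinear mulrDr addrACA.
- by move=> x y; rewrite (hform_herm h) (hform_herm h') rmorphD.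
- by move=> x; apply: addr_ge0; exact: hform_ge0.
- by move=> p; apply: cvgD; exact: hform_continuous.
Defined.

Definition hscale (c : C) (c0 : 0 <= c) h : hilbert_form V.
Proof.
refine (@HilbertForm _ _ (fun x y => c * (h x y : C)) _ _ _ _ _).
- move=> x a y z; have [hl _ _] := hform_psd h.
  by rewrite hl mulrDr mulrCA.
- move=> y a x z; rewrite hform_antilinear mulrDr mulrCA //.
- by move=> x y; rewrite hform_herm rmorphM /= (conj_Creal (ger0_real c0)).
- by move=> x; apply: mulr_ge0 => //; exact: hform_ge0.
- by move=> p; apply: cvgMr; exact: hform_continuous.
Defined.

Lemma tform_hscale c (c0 : 0 <= c) h k X Y : homog k X -> homog k Y ->
  tform (hscale c0 h) X Y = c ^+ k * tform h X Y.
Proof.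
move=> hX hY; elim/homog_ind: X / hX => [|a u X uk _ IH].
  by rewrite !tform0l mulr0.
rewrite !tform_antilinear IH mulrDr mulrCA; congr (_ * _ + _) => {IH}.
elim/homog_ind: Y / hY => [|b w Y wk _ IH]; first by rewrite !tform0r mulr0.
rewrite !tformPr IH mulrDr mulrCA; congr (_ * _ + _) => {IH}.
rewrite !tform_words /tform_word uk wk eqxx mulrCA; congr (_ * _).
rewrite big_split /= big_const_seq count_predT size_zip uk wk minnn.
by rewrite iter_mulr_1.
Qed.

End HilbertTensor.

(** * The continuity estimate *)

Lemma tens_scale2 (K : fieldType) (M N : lmodType K) a b (x : M) (y : N) :
  tens (a *: (b *: x)) y = (a * b) *: tens x y.
Proof. by rewrite !(linZ (tens_linl _)) scalerA. Qed.

(** The estimate of one contraction depends on the form on the tensor algebra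
    only through its compatibility with splitting off the last or the first
    letter. *)
Section Contraction.
Variables (C : numClosedFieldType) (V : lmodType C).
Variables (h : V -> V -> C) (F : tensor V -> tensor V -> C) (Lam : V -> V -> C^o).
Local Notation letter x := (word [:: x] : tensor V).
Hypotheses (hp : psd_form h) (Fp : psd_form F).
Hypothesis F_rcons : forall k A A' x y, homog k A -> homog k A' ->
  F (tmul A (letter x)) (tmul A' (letter y)) = k.+1%:R * (h x y * F A A').
Hypothesis F_cons : forall k A A' x y, homog k A -> homog k A' ->
  F (tmul (letter x) A) (tmul (letter y) A') = k.+1%:R * (h x y * F A A').
Hypothesis LamB : bilinear_for *:%R *:%R Lam.
Hypothesis Lam_bound : forall x y, `|Lam x y| <= psd_norm h x * psd_norm h y.

Let Lam_linr z a x y : Lam z (a *: x + y) = a * Lam z x + Lam z y.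
Proof. by have [_ lr] := LamB; exact: lr. Qed.

Let Lam_lin z a x y : Lam (a *: x + y) z = a * Lam x z + Lam y z.
Proof. by have [ll _] := LamB; exact: ll. Qed.

Let Lam_sumr z n (b : 'I_n -> C) (x : 'I_n -> V) :
  Lam z (\sum_(i < n) b i *: x i) = \sum_(i < n) b i * Lam z (x i).
Proof.
have ll : linear (Lam z : V -> C^o) by move=> a x' y; exact: Lam_linr.
by rewrite (lin_sum ll); apply: eq_bigr => i _; rewrite (linZ ll).
Qed.

(** Bessel's inequality for the functional [Lam x]: its bound is applied to the
    combination of the [e c] with coefficients [(Lam x (e c))^*]. *)
Let Lam_Bessel n (e : nat -> V) (d : nat -> bool) x :
  (forall i j, (i < n)%N -> (j < n)%N -> h (e i) (e j) = ((i == j) && d i)%:R) ->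
  \sum_(c < n) (Lam x (e c))^* * Lam x (e c) <= h x x.
Proof.
move=> eE; set S := \sum_(c < n) _.
pose y := \sum_(c < n) (Lam x (e c))^* *: e c.
have S0 : 0 <= S by apply: sumr_ge0 => c _; rewrite mulrC -normCK exprn_ge0.
have Ly : Lam x y = S by rewrite /y Lam_sumr.
have yS : h y y <= S.
  pose b c : C := (Lam x (e c))^*.
  rewrite (psd_orthogonal_sum hp b b eE : h y y = _); apply: ler_sum => c _.
  rewrite /b conjCK mulrC [X in _ <= X]mulrC ler_piMr ?ler1n ?leq_b1 //.
    by rewrite -normCK exprn_ge0.
  by rewrite (ler_nat _ _ 1) leq_b1.
have [->|Sneq0] := eqVneq S 0; first exact: (psd_ge0 hp).
have Sgt0 : 0 < S by rewrite lt_def Sneq0.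
have := Lam_bound x y; rewrite Ly ger0_norm // => le1.
have : S ^+ 2 <= h x x * S.
  apply: (@le_trans _ _ (h x x * h y y)); last first.
    by rewrite ler_wpM2l // (psd_ge0 hp).
  rewrite -[h x x]sqrtCK -[h y y]sqrtCK -exprMn ler_pXn2r // nnegrE.
  by rewrite mulr_ge0 // sqrtC_ge0 (psd_ge0 hp).
by rewrite expr2 ler_pM2r.
Qed.

(** One contraction. The letters [y b] are expanded in a finite orthogonal family
    [e c]: this writes the result as a sum of pure tensors indexed by [c], whose
    left factors are controlled by the Schur product theorem applied to [h] minus
    the rank-[m] form of Bessel's inequality. *)
Lemma PLam_letters_step k l X Y : homog k.+1 X -> homog l.+1 Y ->
  exists m (A B : nat -> tensor V), [/\ forall i, homog k (A i), forall i, homog l (B i),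
    PLam Lam (tens X Y) = \sum_(i < m) tens (A i) (B i)
  & (\sum_(i < m) psd_norm F (A i) * psd_norm F (B i)) ^+ 2 <=
    (k.+1 * l.+1)%:R * (F X X * F Y Y)].
Proof.
move=> /homog_rcons[n [A [x [hA XE]]]] /homog_cons[m [y [B [hB YE]]]].
have [e [d [b [eE yE]]]] := psd_Gram_Schmidt hp y m.
pose N : C := (k.+1 * l.+1)%:R.
pose B' c := \sum_(j < m) b j c *: B j.
pose A' c := \sum_(i < n) Lam (x i) (e c) *: A i.
have hA' c : homog k (A' c) by apply: homog_sum => i; exact/homogZ/hA.
have hB' c : homog l (B' c) by apply: homog_sum => i; exact/homogZ/hB.
have YE' : Y = \sum_(c < m) tmul (letter (e c)) (B' c).
  rewrite YE; under [RHS]eq_bigr do rewrite /B' (lin_sum (tmul_linr _)).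
  rewrite exchange_big; apply: eq_bigr => j _ /=.
  have ltl (Z : tensor V) : linear (fun v : V => tmul (letter v) Z).
    by move=> a u w; rewrite word_letterP tmul_linl.
  rewrite {1}yE // (lin_sum (ltl _)); apply: eq_bigr => c _.
  by rewrite (linZ (ltl _)) (linZ (tmul_linr _)).
have PL := PLam_linear LamB.
exists m, (fun c => N *: A' c), B'; split=> // [c||].
- exact: homogZ.
- rewrite XE YE' (lin_sum (tens_linr _)) (lin_sum PL); apply: eq_bigr => c _.
  rewrite (lin_sum (tens_linl _)) (lin_sum PL) /A' scaler_sumr.
  rewrite (lin_sum (tens_linl _)); apply: eq_bigr => i _.
  rewrite (PLam_letters LamB _ _ (hA i) (hB' c)) tens_scale2; reflexivity.
have TX : F X X =
    k.+1%:R * \sum_(i < n) \sum_(j < n) h (x i) (x j) * F (A i) (A j).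
  rewrite XE (psd_suml Fp) mulr_sumr; apply: eq_bigr => i _.
  rewrite (psd_sumr Fp) mulr_sumr; apply: eq_bigr => j _.
  exact: F_rcons.
have TY : F Y Y = l.+1%:R * \sum_(c < m) (d c)%:R * F (B' c) (B' c).
  rewrite {1 2}YE' (psd_suml Fp) mulr_sumr; apply: eq_bigr => c _.
  rewrite (psd_sumr Fp) (bigD1 c) //= big1 ?addr0 => [|j jc].
    by rewrite (F_cons _ _ (hB' _) (hB' _)) eE // eqxx.
  rewrite (F_cons _ _ (hB' _) (hB' _)) eE //; case: eqP => [cj|_].
    by case/eqP: jc; apply/val_inj.
  by rewrite mul0r mulr0.
have sumA : \sum_(c < m) psd_norm F (A' c) ^+ 2 <=
    \sum_(i < n) \sum_(j < n) h (x i) (x j) * F (A i) (A j).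
  pose G u v : C := h u v - \sum_(c < m) (Lam u (e c))^* * Lam v (e c).
  have Gp : psd_form G.
    split=> [a u v w|u v|u]; last by rewrite subr_ge0; exact: Lam_Bessel eE.
      rewrite /G; have [hl _ _] := hp; rewrite hl.
      under eq_bigr do rewrite Lam_lin mulrDr mulrCA.
      by rewrite big_split /= -mulr_sumr; ring.
    have [_ hH _] := hp; rewrite /G rmorphB /= -hH rmorph_sum; congr (_ - _).
    by apply: eq_bigr => c _; rewrite rmorphM /= conjCK mulrC.
  rewrite -subr_ge0; have := psd_Schur n x A Gp Fp.
  congr (_ <= _); rewrite /G.
  under eq_bigr do under eq_bigr do rewrite mulrBl.
  under eq_bigr do rewrite sumrB.
  rewrite sumrB; congr (_ - _).
  under eq_bigr do under eq_bigr do rewrite mulr_suml.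
  under eq_bigr do rewrite exchange_big.
  rewrite exchange_big; apply: eq_bigr => c _.
  rewrite psd_norm_sqr /A' (psd_suml Fp); apply: eq_bigr => i _.
  rewrite (psd_sumr Fp); apply: eq_bigr => j _.
  rewrite (psdZl Fp) (psdZr Fp) mulrA; reflexivity.
have A'0 c : (c < m)%N -> ~~ d c -> psd_norm F (A' c) = 0.
  move=> cm /negPf dc; rewrite /A' big1 ?(psd_norm0 Fp) // => i _.
  have := Lam_bound (x i) (e c).
  have -> : psd_norm h (e c) = 0 by rewrite /psd_norm eE // dc andbF sqrtC0.
  by rewrite mulr0 normr_le0 => /eqP ->; rewrite scale0r.
rewrite (eq_bigr (fun c : 'I_m =>
    N * (psd_norm F (A' c) * ((d c)%:R * psd_norm F (B' c))))) => [|c _]; last first.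
  rewrite (psd_normZ Fp) ger0_norm ?ler0n // -mulrA; congr (_ * _).
  case dc: (d c); first by rewrite mul1r.
  by rewrite A'0 ?dc // !mul0r.
rewrite -mulr_sumr exprMn.
have CS := @sum_Cauchy_Schwarz C m (fun c => psd_norm F (A' c))
  (fun c => (d c)%:R * psd_norm F (B' c)).
apply: (@le_trans _ _ (N ^+ 2 *
   ((\sum_(i < n) \sum_(j < n) h (x i) (x j) * F (A i) (A j)) *
    (\sum_(c < m) (d c)%:R * F (B' c) (B' c))))).
  rewrite ler_wpM2l ?exprn_ge0 ?ler0n //.
  apply: le_trans (CS _ _) _ => [c|c|]; rewrite ?mulr_ge0 ?ler0n ?(psd_norm_ge0 Fp) //.
  have -> : \sum_(c < m) (d c)%:R * F (B' c) (B' c) =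
     \sum_(c < m) ((d c)%:R * psd_norm F (B' c)) ^+ 2.
    apply: eq_bigr => c _; rewrite exprMn psd_norm_sqr; congr (_ * _).
    by case: (d c); rewrite ?expr1n ?expr0n.
  rewrite ler_wpM2r //; apply: sumr_ge0 => c _.
  by rewrite exprn_ge0 ?mulr_ge0 ?ler0n ?(psd_norm_ge0 Fp).
rewrite TX TY /N natrM le_eqVlt; apply/orP; left; apply/eqP; ring.
Qed.

End Contraction.

Section Estimate.
Variables (R : realType) (V : tvsType R[i]).
Local Notation C := R[i].
Local Notation T := (tensor V).
Local Notation letter x := (word [:: x] : T).
Implicit Types (h : hilbert_form V) (X Y A B : T).

Lemma tform_wordE h u w : size u = size w -> tform_word h u w =
  (size w)`!%:R * \prod_(i < size w) (h (nth 0 u i) (nth 0 w i) : C).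
Proof.
move=> uw; rewrite /tform_word uw eqxx (big_nth (0, 0)) size_zip uw minnn.
rewrite big_mkord; congr (_ * _); apply: eq_bigr => i _.
by rewrite nth_zip.
Qed.

(** Moving a permutation from one argument to the other replaces it by its
    inverse. *)
Lemma tform_Symop h X Y : tform h (Symop X) Y = tform h X (Symop Y).
Proof.
have Sl := @Symop_linear C V.
have words u w : tform h (sym_word u) (word w) = tform h (word u) (sym_word w).
  have [uw|uw] := eqVneq (size u) (size w); last first.
    have hom_sym (v : seq V) : homog (size v) (sym_word v).
      by rewrite -Symop_word; exact/homog_Symop/homog_word.
    by rewrite (tform_orth h (hom_sym u) (homog_word w) uw)
               (tform_orth h (homog_word u) (hom_sym w) uw).
  rewrite /sym_word -!/(symn _ _) uw /symn.
  rewrite (psdZl (tform_psd h)) (psdZr (tform_psd h)) fmorphV rmorph_nat.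
  congr (_ * _); rewrite (psd_sumr (tform_psd h)) (psd_suml (tform_psd h)).
  rewrite (reindex_inj invg_inj); apply: eq_bigr => s _.
  have szw (v : seq V) (t : 'S_(size w)) :
    size [seq nth 0 v (t i) | i : 'I_(size w)] = size w.
    by rewrite size_map size_enum_ord.
  have nthw (v : seq V) (t : 'S_(size w)) (i : 'I_(size w)) :
    nth 0 [seq nth 0 v (t j) | j : 'I_(size w)] i = nth 0 v (t i).
    by rewrite (nth_map i) ?size_enum_ord // nth_ord_enum.
  rewrite !tform_words !tform_wordE ?szw //; congr (_ * _).
  rewrite (reindex_inj (@perm_inj _ s)); apply: eq_bigr => i _.
  by rewrite !nthw permK.
elim/presented_ind: X => [|a u X IH].
  by rewrite (lin0 Sl) !(psd0l (tform_psd h)).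
rewrite Sl !tform_antilinear IH -/(word u) Symop_word; congr (_ * _ + _) => {IH}.
elim/presented_ind: Y => [|b w Y IH].
  by rewrite (lin0 Sl) !(psd0r (tform_psd h)).
rewrite Sl !tform_linear IH -/(word w) Symop_word words; reflexivity.
Qed.

(** A self-adjoint projection is a contraction. *)
Lemma tnorm_Symop h X : tnorm h (Symop X) <= tnorm h X.
Proof.
have [->|X0] := eqVneq (tnorm h (Symop X)) 0; first exact: tnorm_ge0.
have SX : 0 < tnorm h (Symop X) by rewrite lt_def X0 tnorm_ge0.
rewrite -(ler_pM2r SX) -expr2 tnorm_sqr tform_Symop SymopK.
apply: le_trans (psd_norm_bound (tform_psd h) _ _).
by rewrite real_ler_norm // -SymopK -tform_Symop ger0_real // (psd_ge0 (tform_psd h)).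
Qed.

Lemma tnorm_tmul h k l X Y : homog k X -> homog l Y ->
  tnorm h (tmul X Y) = sqrtC 'C(k + l, k)%:R * tnorm h X * tnorm h Y.
Proof.
move=> hX hY; rewrite /tnorm (tform_tmul h hX hX hY hY).
by rewrite !sqrtCM ?nnegrE ?mulr_ge0 ?ler0n ?(psd_ge0 (tform_psd h)).
Qed.

Variables (Lam : V -> V -> C^o) (h : hilbert_form V).
Hypothesis LamB : bilinear_for *:%R *:%R Lam.
Hypothesis Lam_bound : forall x y, `|Lam x y| <= hnorm h x * hnorm h y.

Lemma PLam_step k l X Y : homog k.+1 X -> homog l.+1 Y ->
  exists m (A B : nat -> T), [/\ forall i, homog k (A i), forall i, homog l (B i),
    PLam Lam (tens X Y) = \sum_(i < m) tens (A i) (B i)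
  & (\sum_(i < m) tnorm h (A i) * tnorm h (B i)) ^+ 2 <=
    (k.+1 * l.+1)%:R * (tform h X X * tform h Y Y)].
Proof.
apply: (PLam_letters_step (hform_psd h) (tform_psd h) _ _ LamB Lam_bound).
- exact: tform_rcons.
- exact: tform_cons.
Qed.

(** The projective norm is an infimum over representations as sums of pure tensors.
    Exhibiting one representation is enough here, and it keeps the degrees of the
    factors under control. *)
Definition pnorm_le k l (Z : tprod T T) (c : C) := exists s : seq (T * T),
  [/\ forall p, p \in s -> homog k p.1 /\ homog l p.2,
      Z = \sum_(p <- s) tens p.1 p.2
    & \sum_(p <- s) tnorm h p.1 * tnorm h p.2 <= c].

Lemma pnorm_leD k l Z Z' c c' : pnorm_le k l Z c -> pnorm_le k l Z' c' ->
  pnorm_le k l (Z + Z') (c + c').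
Proof.
move=> [s [hs -> sc]] [s' [hs' -> sc']]; exists (s ++ s'); split.
- by move=> p; rewrite mem_cat => /orP[/hs|/hs'].
- by rewrite big_cat.
- by rewrite big_cat lerD.
Qed.

Lemma pnorm_le_PLam k l Z c : pnorm_le k.+1 l.+1 Z c ->
  pnorm_le k l (PLam Lam Z) (sqrtC (k.+1 * l.+1)%:R * c).
Proof.
have PL := PLam_linear LamB.
set r := sqrtC _; have r0 : 0 <= r by rewrite sqrtC_ge0 ler0n.
case=> s [hs -> sc].
suff [s' [hs' sE sc']] : pnorm_le k l (PLam Lam (\sum_(p <- s) tens p.1 p.2))
    (r * \sum_(p <- s) tnorm h p.1 * tnorm h p.2).
  by exists s'; split => //; apply: le_trans sc' _; rewrite ler_wpM2l.
rewrite (lin_sum PL) mulr_sumr; elim: s hs {sc} => [_|p s IH hs].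
  by exists [::]; rewrite !big_nil.
rewrite !big_cons; apply: pnorm_leD; last first.
  by apply: IH => q qs; apply: hs; rewrite inE qs orbT.
have [hp1 hp2] := hs p (mem_head _ _).
have [m [A [B [hA hB -> AB]]]] := PLam_step hp1 hp2.
exists [seq (A i, B i) | i <- index_iota 0 m]; split.
- by move=> q /mapP[i _ ->]; split; [exact: hA|exact: hB].
- by rewrite big_map big_mkord.
- rewrite big_map big_mkord -(ler_pXn2r (ltn0Sn 1)) ?nnegrE ?mulr_ge0 ?tnorm_ge0 //.
    by rewrite !exprMn !tnorm_sqr sqrtCK.
  by apply: sumr_ge0 => i _; rewrite mulr_ge0 ?tnorm_ge0.
Qed.

Lemma pnorm_le_iter k l t Z c : (t <= k)%N -> (t <= l)%N -> pnorm_le k l Z c ->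
  pnorm_le (k - t) (l - t) (iter t (PLam Lam) Z) (sqrtC (k ^_ t * l ^_ t)%:R * c).
Proof.
elim: t => [|t IH] tk tl Zc; first by rewrite !subn0 !ffactn0 sqrtC1 mul1r.
have := IH (ltnW tk) (ltnW tl) Zc; rewrite -(subnSK tk) -(subnSK tl).
move=> /pnorm_le_PLam; congr pnorm_le; rewrite mulrA; congr (_ * _).
rewrite -sqrtCM ?nnegrE ?ler0n // -natrM !ffactnSr (subnSK tk) (subnSK tl).
by congr (sqrtC _%:R); ring.
Qed.

Let iterPL t : linear (iter t (PLam Lam)) := iter_PLam_linear LamB t.

Lemma pnorm_le_vanish k l t Z c : (k < t)%N || (l < t)%N ->
  pnorm_le k l Z c -> iter t (PLam Lam) Z = 0.
Proof.
have PL := PLam_linear LamB.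
have base k' l' Z' c' : k' = 0%N \/ l' = 0%N -> pnorm_le k' l' Z' c' ->
    PLam Lam Z' = 0.
  move=> kl [s [hs -> _]]; rewrite (lin_sum PL) big_seq big1 // => p /hs[h1 h2].
  case: kl => e; rewrite {}e in h1 h2.
    have [a ->] := homog0E h1.
    by rewrite (linZ (tens_linl _)) (linZ PL) PLam_nill // scaler0.
  have [a ->] := homog0E h2.
  by rewrite (linZ (tens_linr _)) (linZ PL) PLam_nilr // scaler0.
move=> klt Zc; pose m := minn k l.
have mt : (m < t)%N by rewrite /m gtn_min.
have := pnorm_le_iter (geq_minl k l) (geq_minr k l) Zc; rewrite -/m => Pm.
rewrite -(subnK mt) iterD iterS (base _ _ _ _ _ Pm).
  by rewrite (lin0 (iterPL _)).
by rewrite /m /minn; case: ifP => _; rewrite subnn; [left|right].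
Qed.

Lemma tnorm_mu_vee k l Z c : pnorm_le k l Z c ->
  tnorm h (symval (mu_vee Z)) <= sqrtC 'C(k + l, k)%:R * c.
Proof.
case=> s [hs -> sc]; apply: (@le_trans _ _ (sqrtC 'C(k + l, k)%:R *
    \sum_(p <- s) tnorm h p.1 * tnorm h p.2)); last first.
  by rewrite ler_wpM2l // sqrtC_ge0 ler0n.
rewrite (lin_sum (@mu_vee_linear _ _)) (big_morph (@symval _ V) (id1 := 0) (op1 := +%R)) //.
apply: le_trans (tnorm_sum _ _ _ _) _; rewrite mulr_sumr !big_seq.
apply: ler_sum => p /hs[h1 h2]; rewrite mu_vee_tens.
by apply: le_trans (tnorm_Symop _ _) _; rewrite (tnorm_tmul h h1 h2) mulrA.
Qed.

Lemma bin_le_exp2 n k : ('C(n, k) <= 2 ^ n)%N.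
Proof.
elim: n k => [[|k]|n IH [|k]]; rewrite ?bin0 ?expn_gt0 //.
by rewrite binS expnS mul2n -addnn leq_add.
Qed.

(** The accumulated constant is the square root of
    [k^_t * l^_t * 'C(k + l - 2 t, k - t)]. As [k^_t = 'C(k, t) * t!], this is [t!]
    times the square root of a product of three binomial coefficients, which is at
    most [4 ^ (k + l)]. *)
Lemma star_term_homog k l t X Y : homog k X -> homog l Y ->
  tnorm h (symval (mu_vee (iter t (PLam Lam) (tens X Y)))) <=
  t`!%:R * (2 ^+ k * tnorm h X) * (2 ^+ l * tnorm h Y).
Proof.
move=> hX hY.
have P0 : pnorm_le k l (tens X Y) (tnorm h X * tnorm h Y).
  by exists [:: (X, Y)]; split=> [p||]; rewrite ?big_seq1 // inE => /eqP ->.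
have [klt|] := boolP ((k < t)%N || (l < t)%N).
  rewrite (pnorm_le_vanish klt P0) (lin0 (@mu_vee_linear _ _)) tnorm0.
  by rewrite !mulr_ge0 ?exprn_ge0 ?tnorm_ge0 ?ler0n.
rewrite negb_or -!leqNgt => /andP[tk tl].
apply: le_trans (tnorm_mu_vee (pnorm_le_iter tk tl P0)) _.
have -> : t`!%:R * (2 ^+ k * tnorm h X) * (2 ^+ l * tnorm h Y) =
    (t`! * 2 ^ (k + l))%:R * (tnorm h X * tnorm h Y) :> C.
  by rewrite natrM natrX exprD; ring.
rewrite mulrA ler_wpM2r ?mulr_ge0 ?tnorm_ge0 // -sqrtCM ?nnegrE ?ler0n // -natrM.
rewrite -(ler_pXn2r (ltn0Sn 1)) ?nnegrE ?sqrtC_ge0 ?ler0n // sqrtCK -natrX ler_nat.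
rewrite -!bin_ffact expnMn expnD expnMn -!expnM.
have : ('C(k - t + (l - t), k - t) <= 2 ^ (k + l))%N.
  by apply: leq_trans (bin_le_exp2 _ _) _; rewrite leq_pexp2l //; lia.
rewrite expnD => le3; have le1 := bin_le_exp2 k t; have le2 := bin_le_exp2 l t.
have := leq_mul (leq_mul le1 le2) le3 => le4.
have := leq_mul (leqnn (t`! * t`!)%N) le4; congr (_ <= _)%N; first by ring.
by rewrite !expnM -!mulnn; ring.
Qed.

(** The factors [2 ^+ k] are absorbed by the degreewise scaling of the seminorm,
    [tnorm (16 h) = 4 ^+ k * tnorm h] in degree [k], with a factor [2 ^- k] to
    spare that makes the sum over the degrees converge. *)
Lemma sum_tnorm_hproj X n :
  \sum_(k < n) 2 ^+ k * tnorm h (hproj k X) <= 2 * tnorm (hscale (ler0n C 16) h) X.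
Proof.
set N := tnorm _ X; have N0 : 0 <= N by exact: tnorm_ge0.
apply: (@le_trans _ _ (\sum_(k < n) 2 ^- k * N)).
  apply: ler_sum => k _; have := tnorm_hproj (hscale (ler0n C 16) h) k X; rewrite -/N.
  rewrite {1}/tnorm (tform_hscale (ler0n C 16) h (homog_hproj k X) (homog_hproj k X)).
  rewrite sqrtCM ?nnegrE ?exprn_ge0 ?ler0n ?(psd_ge0 (tform_psd h)) //.
  have -> : sqrtC (16 ^+ k) = (2 ^+ k * 2 ^+ k : C).
    rewrite -exprMn (_ : 16 = (2 * 2) ^+ 2); last by rewrite -natrM -natrX.
    by rewrite exprAC sqrCK // exprn_ge0 // mulr_ge0 ?ler0n.
  by move=> le1; rewrite ler_pdivlMl ?exprn_gt0 ?ltr0n // mulrA.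
rewrite -mulr_suml ler_wpM2r //.
suff -> : \sum_(k < n) 2 ^- k = 2 - 2 * 2 ^- n :> C.
  by rewrite gerBl mulr_ge0 ?ler0n // invr_ge0 exprn_ge0 ?ler0n.
elim: n => [|n IH]; first by rewrite big_ord0 invr1; ring.
rewrite big_ord_recr /= IH exprS; field.
by rewrite expf_neq0 // pnatr_eq0.
Qed.

Lemma star_term_bound t (A B : symtensor V) :
  tnorm h (symval (star_term Lam t A B)) <=
  4 * tnorm (hscale (ler0n C 16) h) (symval A) * tnorm (hscale (ler0n C 16) h) (symval B).
Proof.
set X := symval A; set Y := symval B.
have [n /(_ _ (leqnn n)) XE] := hproj_sum X.
have [m /(_ _ (leqnn m)) YE] := hproj_sum Y.
have tf0 : 0 < t`!%:R :> C by rewrite ltr0n fact_gt0.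
rewrite /star_term -/X -/Y /= tnormZ ger0_norm ?invr_ge0 ?ler0n //.
rewrite mulrC ler_pdivrMr //.
apply: (@le_trans _ _ (\sum_(k < n) \sum_(l < m) t`!%:R *
    (2 ^+ k * tnorm h (hproj k X)) * (2 ^+ l * tnorm h (hproj l Y)))).
  rewrite {1}XE (lin_sum (tens_linl _)) (lin_sum (iterPL t)).
  rewrite (lin_sum (@mu_vee_linear _ _)) (big_morph (@symval _ V) (id1 := 0) (op1 := +%R)) //.
  apply: le_trans (tnorm_sum _ _ _ _) _; apply: ler_sum => k _.
  rewrite {1}YE (lin_sum (tens_linr _)) (lin_sum (iterPL t)).
  rewrite (lin_sum (@mu_vee_linear _ _)) (big_morph (@symval _ V) (id1 := 0) (op1 := +%R)) //.
  apply: le_trans (tnorm_sum _ _ _ _) _; apply: ler_sum => l _.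
  exact: star_term_homog (homog_hproj k X) (homog_hproj l Y).
under eq_bigr do rewrite -mulr_sumr.
rewrite -mulr_suml -mulr_sumr -[_ * _ * \sum_(_ < m) _]mulrA mulrC ler_wpM2r ?ler0n //.
set a := tnorm _ X; set b := tnorm _ Y.
have -> : 4 * a * b = (2 * a) * (2 * b) by ring.
rewrite ler_pM ?sum_tnorm_hproj //; apply: sumr_ge0 => k _;
  by rewrite mulr_ge0 ?exprn_ge0 ?tnorm_ge0 ?ler0n.
Qed.

End Estimate.

(** * Topologies given by seminorms *)

(** Over any field of scalars; for complex scalars it unfolds to [seminorm]. *)
Definition is_seminorm (C : numFieldType) (E : lmodType C) (p : E -> C) : Prop :=
  [/\ forall x, 0 <= p x,
      forall x y, p (x + y) <= p x + p y
    & forall a x, p (a *: x) = `|a| * p x].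

Section Seminorms.
Variables (C : numFieldType) (E : lmodType C).
Implicit Types p q : E -> C.

Section OneSeminorm.
Variable p : E -> C.
Hypothesis psn : is_seminorm p.

Lemma sn_ge0 x : 0 <= p x. Proof. by case: psn. Qed.
Lemma snD x y : p (x + y) <= p x + p y. Proof. by case: psn. Qed.
Lemma snZ a x : p (a *: x) = `|a| * p x. Proof. by case: psn. Qed.

Lemma sn0 : p 0 = 0.
Proof. by rewrite -(scale0r (0 : E)) snZ normr0 mul0r. Qed.

Lemma snN x : p (- x) = p x.
Proof. by rewrite -scaleN1r snZ normrN1 mul1r. Qed.

Lemma snB x y : p (x - y) <= p x + p y.
Proof. by rewrite -(snN y); exact: snD. Qed.

Lemma sn_distC x y : p (x - y) = p (y - x).
Proof. by rewrite -snN opprB. Qed.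

Lemma sn_dist z x y : p (x - y) <= p (x - z) + p (z - y).
Proof. by rewrite -[x - y](subrKA z); exact: snD. Qed.

Lemma sn_le_dist y x : p x <= p y + p (x - y).
Proof. by rewrite -{1}(subrK y x) addrC; exact: snD. Qed.

Lemma sn_sum (I : Type) (r : seq I) (P : pred I) (F : I -> E) :
  p (\sum_(i <- r | P i) F i) <= \sum_(i <- r | P i) p (F i).
Proof.
elim/big_rec2: _ => [|i a x _ ax]; first by rewrite sn0.
by apply: le_trans (snD _ _) _; rewrite lerD2l.
Qed.

Lemma sn_real x : p x \is Num.real.
Proof. by rewrite ger0_real // sn_ge0. Qed.

Lemma sn_dist_norm x y : `|p x - p y| <= p (x - y).
Proof.
rewrite real_ler_norml ?rpredB ?sn_real // lerBlDr lerNl opprB lerBlDr.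
by rewrite addrC (sn_distC x) sn_le_dist addrC sn_distC sn_le_dist.
Qed.

Lemma sn_scale c : 0 <= c -> is_seminorm (fun x => c * p x).
Proof.
move=> c0; split=> [x|x y|a x]; first by rewrite mulr_ge0 // sn_ge0.
  by rewrite -mulrDr ler_wpM2l // snD.
by rewrite snZ mulrCA.
Qed.
End OneSeminorm.

Lemma sn_add p q : is_seminorm p -> is_seminorm q ->
  is_seminorm (fun x => p x + q x).
Proof.
move=> sp sq; split=> [x|x y|a x]; first by rewrite addr_ge0 // sn_ge0.
  by rewrite addrACA lerD // snD.
by rewrite !snZ // mulrDr.
Qed.

(** A ball of one seminorm inside the unit ball of another one: by homogeneity
    this is a global inequality. *)
Lemma sn_dominated p q e : is_seminorm p -> is_seminorm q -> 0 < e ->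
  (forall x, q x < e -> p x < 1) -> forall x, p x <= 2 / e * q x.
Proof.
move=> sp sq e0 qp x; have [q0|q0] := eqVneq (q x) 0.
  rewrite q0 mulr0; have [->//|p0] := eqVneq (p x) 0.
  have := qp ((p x)^-1 *: x); rewrite !snZ // q0 mulr0 => /(_ e0).
  by rewrite ger0_norm ?invr_ge0 ?sn_ge0 // mulVf // ltxx.
have qx : 0 < q x by rewrite lt_def q0 sn_ge0.
have c0 : 0 < e / 2 / q x by rewrite !divr_gt0 // ltr0n.
have := qp ((e / 2 / q x) *: x); rewrite !snZ // gtr0_norm // mulfVK // => lt1.
have : e / 2 / q x * p x < 1.
  by apply: lt1; rewrite ltr_pdivrMr ?ltr0n // ltr_pMr // ltr1n.
have -> : 2 / e * q x = (e / 2 / q x)^-1 * 1.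
  by field; rewrite q0 lt0r_neq0.
by move/ltW; rewrite ler_pdivlMl.
Qed.

End Seminorms.

(** The family [Q] is implicitly directed: a single seminorm is enough for each
    neighbourhood. *)
Definition seminorm_basis (C : numFieldType) (S : preTopologicalLmodType C)
    (Q : (S -> C) -> Prop) : Prop :=
  (forall q, Q q -> is_seminorm q) /\
  forall (x : S) (U : set S), nbhs x U <->
    exists q, Q q /\ exists e, 0 < e /\ forall y, q (y - x) < e -> U y.

Section SeminormBasis.
Local Open Scope convex_scope.
Variables (C : numFieldType) (S : preTopologicalLmodType C).
Variable Q : (S -> C) -> Prop.
Hypothesis Qbasis : seminorm_basis Q.

Let Qsn q : Q q -> is_seminorm q. Proof. by case: Qbasis => + _; apply. Qed.
Let Qnbhs x U : nbhs x U <->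
  exists q, Q q /\ exists e, 0 < e /\ forall y, q (y - x) < e -> U y.
Proof. by case: Qbasis => _; apply. Qed.

Lemma basis_ball q x e : Q q -> 0 < e -> nbhs x [set y | q (y - x) < e].
Proof. by move=> Qq e0; apply/Qnbhs; exists q; split => //; exists e. Qed.

Lemma basis_add_continuous : continuous (fun p : S * S => p.1 + p.2).
Proof.
move=> [x y] U /Qnbhs[q [Qq [e [e0 qU]]]].
have e2 : 0 < e / 2 by rewrite divr_gt0 // ltr0n.
exists ([set x' | q (x' - x) < e / 2], [set y' | q (y' - y) < e / 2]).
  by split; exact: basis_ball.
move=> [x' y'] [/= hx hy]; apply: qU.
have sq := Qsn Qq; rewrite opprD addrACA; apply: le_lt_trans (snD sq _ _) _.
by rewrite [e]splitr ltrD.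
Qed.

Lemma basis_scale_continuous : continuous (fun p : C^o * S => p.1 *: p.2).
Proof.
move=> [a x] U /Qnbhs[q [Qq [e [e0 qU]]]]; have sq := Qsn Qq.
have K0 : 0 < `|a| + q x + 1 + e by rewrite ltr_wpDl // !addr_ge0 // (sn_ge0 sq).
pose d := e / (`|a| + q x + 1 + e).
have d0 : 0 < d by rewrite divr_gt0.
have d1 : d <= 1.
  by rewrite ler_pdivrMr // mul1r lerDr !addr_ge0 ?(sn_ge0 sq).
exists ([set b : C^o | `|a - b| < d], [set y | q (y - x) < d]).
  split; last exact: basis_ball.
  by apply/nbhs_ballP; exists d.
move=> [b y] [/= hb hy]; apply: qU => /=.
have -> : b *: y - a *: x = (b - a) *: x + a *: (y - x) + (b - a) *: (y - x).
  by rewrite addrAC -scalerDr (addrC x) subrK scalerBl scalerBr addrA subrK.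
apply: le_lt_trans (snD sq _ _) _; rewrite !snZ //.
have hb' : `|b - a| < d by rewrite distrC.
apply: (@le_lt_trans _ _ (d * (`|a| + q x + 1))).
  apply: (@le_trans _ _ (`|b - a| * q x + `|a| * q (y - x) + `|b - a| * q (y - x))).
    by rewrite lerD2r; apply: le_trans (snD sq _ _) _; rewrite !snZ.
  rewrite mulrDr mulr1 mulrDr; apply: lerD.
    by rewrite addrC mulrC lerD // ler_pM // ?(sn_ge0 sq) // ?ltW.
  rewrite -[X in _ <= X]mulr1; apply: ler_pM; rewrite ?(sn_ge0 sq) // ?ltW //.
  exact: lt_le_trans d1.
rewrite /d -mulrA gtr_pMr // mulrC ltr_pdivrMr // mul1r.
by rewrite ltrDl.
Qed.

Let ball_open q x (e : C) : Q q -> open [set y | q (y - x) < e].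
Proof.
move=> Qq; rewrite openE => y /= hy; have sq := Qsn Qq.
apply/Qnbhs; exists q; split => //; exists (e - q (y - x)).
split=> [|z hz]; first by rewrite subr_gt0.
by apply: le_lt_trans (sn_dist sq y z x) _; rewrite -ltrBrDr.
Qed.

Let ball_convex q x (e : C) : Q q ->
  convex_set ([set y | q (y - x) < e] : set (convex_lmodType S)).
Proof.
move=> Qq y z l; rewrite !inE /= => hy hz; have sq := Qsn Qq.
have a0 : 0 <= l%:num by [].
have b0 : 0 <= 1 - l%:num by rewrite subr_ge0.
set a := l%:num in a0 b0 *; set b := 1 - a in b0 *.
have ab1 : a + b = 1 by rewrite addrC subrK.
have -> : (y <| l |> z : S) - x = a *: (y - x) + b *: (z - x).
  by rewrite !scalerBr addrACA -opprD -scalerDl ab1 scale1r.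
apply: le_lt_trans (snD sq _ _) _; rewrite !(snZ sq) !ger0_norm //.
have -> : e = a * e + b * e by rewrite -mulrDl ab1 mul1r.
have [az|an] := eqVneq a 0.
  by rewrite /b az !mul0r !add0r subr0 !mul1r.
have ap : 0 < a by rewrite lt_def an.
by rewrite ltr_leD // ?ltr_pM2l // ler_wpM2l // ltW.
Qed.

Lemma basis_locally_convex : exists2 B : set_system S,
  (forall b, b \in B -> convex_set (b : set (convex_lmodType S))) & basis B.
Proof.
exists [set U | exists q x e, Q q /\ U = [set y | q (y - x) < e]].
  by move=> b; rewrite inE => -[q [x [e [Qq ->]]]]; exact: ball_convex.
split=> [b [q [x [e [Qq ->]]]]|x U /Qnbhs[q [Qq [e [e0 qU]]]]].
  exact: ball_open.
exists [set y | q (y - x) < e] => //; split; first by exists q, x, e.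
by rewrite /= subrr (sn0 (Qsn Qq)).
Qed.

End SeminormBasis.

(** The Lipschitz estimate of a bounded bilinear map, in a form that passes to
    limits and to convergent sums. *)
Definition bilipschitz (C : numFieldType) (S S' : lmodType C) (m : S -> S -> S')
    (p : S' -> C) (q : S -> C) (c : C) : Prop :=
  forall x x' y y', p (m x y - m x' y') <= c * (q (x - x') * q y + q x' * q (y - y')).

Lemma bilinear_bilipschitz (C : numFieldType) (S S' : lmodType C)
    (m : S -> S -> S') p q c : bilinear_for *:%R *:%R m ->
  is_seminorm p -> (forall x y, p (m x y) <= c * q x * q y) ->
  bilipschitz m p q c.
Proof.
move=> [ml mr] sp mb x x' y y'.
have lB : m (x - x') y = m x y - m x' y.
  have ll : linear (m^~ y) by exact: ml.
  by rewrite -scaleN1r (linD ll) (linZ ll) scaleN1r.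
have rB : m x' (y - y') = m x' y - m x' y'.
  have ll : linear (m x') by exact: mr.
  by rewrite -scaleN1r (linD ll) (linZ ll) scaleN1r.
have -> : m x y - m x' y' = m (x - x') y + m x' (y - y') by rewrite lB rB subrKA.
apply: le_trans (snD sp _ _) _; rewrite mulrDr !mulrA; exact: lerD.
Qed.

Lemma bilipschitz_continuous (C : numFieldType) (S S' : preTopologicalLmodType C)
    (Q : (S -> C) -> Prop) (Q' : (S' -> C) -> Prop) (m : S -> S -> S') :
  seminorm_basis Q -> seminorm_basis Q' ->
  (forall p, Q' p -> exists q c, [/\ Q q, 0 <= c & bilipschitz m p q c]) ->
  continuous (fun z : S * S => m z.1 z.2).
Proof.
move=> Qb Q'b mb [x y] U.
have [Qsn _] := Qb; have [Q'sn /(_ (m x y) U) Q'nbhs] := Q'b.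
case/Q'nbhs => p [Pp [e [e0 pU]]]; have [q [c [Qq c0 qm]]] := mb p Pp.
have sq := Qsn _ Qq; have sp := Q'sn _ Pp.
have q0 := sn_ge0 sq.
(* The radius [d = e / K] is at most 1, which bounds [q y'] by [q y + 1]. *)
pose K := c * (q y + 1 + q x) + 1 + e.
have K0 : 0 < K by rewrite ltr_wpDl // !addr_ge0 // mulr_ge0 // !addr_ge0.
pose d := e / K; have d0 : 0 < d by rewrite divr_gt0.
have d1 : d <= 1.
  by rewrite ler_pdivrMr // mul1r lerDr !addr_ge0 // mulr_ge0 // !addr_ge0.
exists ([set z | q (z - x) < d], [set z | q (z - y) < d]).
  by split; exact: (basis_ball Qb).
move=> [x' y'] [/= hx hy]; apply: pU; apply: le_lt_trans (qm _ _ _ _) _.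
apply: (@le_lt_trans _ _ (d * (c * (q y + 1 + q x)))); last first.
  rewrite /d -mulrA gtr_pMr // mulrC ltr_pdivrMr // mul1r /K -[ltRHS]addrA ltrDl.
  by rewrite ltr_wpDl.
rewrite [leRHS]mulrCA ler_wpM2l // mulrDr; apply: lerD; last first.
  by rewrite mulrC ler_wpM2r // ltW.
apply: ler_pM => //; first exact: ltW.
apply: le_trans (sn_le_dist sq y y') _; rewrite lerD2l.
exact: le_trans (ltW hy) d1.
Qed.

(** * The seminorms of a locally convex space *)

Section Gauge.
Variables (R : realType) (E : lmodType R[i]) (W : set E).
Local Notation C := R[i].
Local Notation rc := (real_complex R).
Hypothesis W_absorbing : forall x, exists2 r : R, 0 < r & W ((rc r)^-1 *: x).
Hypothesis W_convex : forall x y (s t : R), 0 < s -> 0 < t -> W x -> W y ->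
  W (rc (s / (s + t)) *: x + rc (t / (s + t)) *: y).
Hypothesis W_balanced : forall x (a : C), `|a| <= 1 -> W x -> W (a *: x).

Let scalings x := [set r : R | 0 < r /\ W ((rc r)^-1 *: x)].

(** The Minkowski functional of [W]. *)
Definition gauge (x : E) : C := rc (inf (scalings x)).

Let has_inf_scalings x : has_inf (scalings x).
Proof.
split; first by have [r r0 Wr] := W_absorbing x; exists r.
by exists 0 => r [/ltW].
Qed.

Let gauge_ge0R x : 0 <= inf (scalings x).
Proof. by apply: lb_le_inf; [case: (has_inf_scalings x)|move=> r [/ltW]]. Qed.

Let gauge_leR x r : scalings x r -> inf (scalings x) <= r.
Proof. by apply: ge_inf; case: (has_inf_scalings x). Qed.

Let norm_rc (a : C) : exists2 n : R, 0 <= n & `|a| = rc n.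
Proof. by rewrite normc_def; eexists; [|reflexivity]; exact: sqrtr_ge0. Qed.

Let gaugeZ_le a x : a != 0 -> gauge (a *: x) <= `|a| * gauge x.
Proof.
move=> a0; have [n n0 an] := norm_rc a.
have {}n0 : 0 < n.
  by rewrite lt_def n0 andbT; apply: contra a0 => /eqP n0'; rewrite -normr_eq0 an n0'.
have rn0 : rc n != 0 by rewrite fmorph_eq0 gt_eqF.
rewrite an /gauge -rmorphM lecR mulrC -ler_pdivrMr //.
apply: lb_le_inf => [|r [r0 Wr]]; first by case: (has_inf_scalings x).
rewrite ler_pdivrMr //; apply: gauge_leR; split; first exact: mulr_gt0.
rewrite rmorphM invfM scalerA.
have -> : (rc r)^-1 / rc n * a = (a / rc n) * (rc r)^-1 by rewrite mulrC mulrA mulrAC.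
rewrite -scalerA; apply: W_balanced => //.
by rewrite normrM normfV an gtr0_norm ?mulfV // ltcR.
Qed.

Lemma gauge_seminorm : seminorm gauge.
Proof.
have g0 : gauge 0 = 0.
  apply/eqP; rewrite fmorph_eq0 eq_le gauge_ge0R andbT.
  apply/ler_addgt0Pr => e e0; rewrite add0r; apply: gauge_leR; split => //.
  have [r _] := W_absorbing 0; rewrite !scaler0 //.
split=> [x|x y|a x]; first by rewrite ler0c.
- rewrite -rmorphD lecR; apply/ler_addgt0Pr => e e0.
  have e2 : 0 < e / 2 by rewrite divr_gt0.
  have [s [s0 Ws] ltse] := inf_adherent e2 (has_inf_scalings x).
  have [t [t0 Wt] ltte] := inf_adherent e2 (has_inf_scalings y).
  apply: (@le_trans _ _ (s + t)); last first.
    by rewrite [e]splitr addrACA; apply: lerD; exact: ltW.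
  apply: gauge_leR; split; first exact: addr_gt0.
  have := W_convex s0 t0 Ws Wt; rewrite !scalerA !rmorphM !fmorphV /=.
  have s' : rc s != 0 by rewrite fmorph_eq0 gt_eqF.
  have t' : rc t != 0 by rewrite fmorph_eq0 gt_eqF.
  by rewrite mulrAC mulfV // mul1r mulrAC mulfV // mul1r -scalerDr.
- have [->|a0] := eqVneq a 0; first by rewrite scale0r normr0 mul0r g0.
  apply/eqP; rewrite eq_le gaugeZ_le //=.
  have := gaugeZ_le (a *: x) (invr_neq0 a0).
  rewrite scalerA mulVf // scale1r normfV.
  by rewrite ler_pdivlMl ?normr_gt0.
Qed.

Lemma gauge_le1 x : W x -> gauge x <= 1.
Proof.
move=> Wx; rewrite -(rmorph1 rc) lecR; apply: gauge_leR; split => //.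
by rewrite rmorph1 invr1 scale1r.
Qed.

Lemma gauge_lt1 x : gauge x < 1 -> W x.
Proof.
rewrite -(rmorph1 rc) ltcR => g1.
have e0 : 0 < 1 - inf (scalings x) by rewrite subr_gt0.
have [r [r0 Wr]] := inf_adherent e0 (has_inf_scalings x).
rewrite addrC subrK => r1.
have -> : x = rc r *: ((rc r)^-1 *: x).
  by rewrite scalerA mulfV ?scale1r // fmorph_eq0 gt_eqF.
apply: W_balanced => //; rewrite gtr0_norm ?ltcR // -(rmorph1 rc) lecR.
exact: ltW.
Qed.

End Gauge.

Section LocallyConvexSeminorms.
Variables (R : realType) (E : tvsType R[i]).
Local Notation C := R[i].
Local Notation rc := (real_complex R).

Lemma nbhs_scale (x : E) (a : C) (U : set E) : nbhs (a *: x) U ->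
  nbhs x [set y | U (a *: y)].
Proof.
move=> aU; have := @scale_continuous _ E (a, x) U aU.
move=> [[A B] [/= nA nB] AB]; apply: filterS nB => y By.
by apply: (AB (a, y)); split => //; exact: nbhs_singleton.
Qed.

Lemma nbhs_shift (x y : E) (U : set E) : nbhs (x + y) U ->
  nbhs x [set z | U (z + y)].
Proof.
move=> aU; have := @add_continuous E (x, y) U aU.
move=> [[A B] [/= nA nB] AB]; apply: filterS nA => z Az.
by apply: (AB (z, y)); split => //; exact: nbhs_singleton.
Qed.

Lemma seminorm_continuous (q : E -> C^o) : seminorm q ->
  nbhs (0 : E) [set x | q x <= 1] -> continuous q.
Proof.
move=> sq nq x U /nbhs_ballP[e /= e0 eU].
have sq' : is_seminorm q := sq.
have e20 : e / 2 != 0 by rewrite gt_eqF // divr_gt0 // ltr0n.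
have : nbhs (x - x) [set y | q ((e / 2)^-1 *: y) <= 1].
  by rewrite subrr; apply: (@nbhs_scale _ _ [set y | q y <= 1]); rewrite scaler0.
move=> /nbhs_shift; apply: filterS => y /=.
rewrite (snZ sq') gtr0_norm ?invr_gt0 ?divr_gt0 ?ltr0n //.
rewrite ler_pdivrMl ?divr_gt0 ?ltr0n // mulr1 => qyx; apply: eU.
apply: (@le_lt_trans _ _ (e / 2)); last by rewrite ltr_pdivrMr ?ltr0n // ltr_pMr // ltr1n.
by apply: le_trans qyx; rewrite (sn_distC sq'); exact: (sn_dist_norm sq').
Qed.

Definition continuous_seminorm (q : E -> C) : Prop :=
  seminorm q /\ continuous (q : E -> C^o).

(** The neighbourhoods of 0 of a locally convex space contain unit balls of
    continuous seminorms: gauges of balanced parts of convex neighbourhoods. *)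
Lemma nbhs0_seminorm (N : set E) : nbhs (0 : E) N ->
  exists q : E -> C, continuous_seminorm q /\ forall x, q x <= 1 -> N x.
Proof.
move=> nN; have [B cB [Bo Bb]] := @locally_convex _ E.
have [b [Bbb b0] bN] := Bb (0 : E) N nN.
have nb : nbhs (0 : E) b by apply: open_nbhs_nbhs; split => //; exact: Bo.
(* The largest balanced subset of [b]. *)
pose W := [set x : E | forall a : C, `|a| <= 1 -> b (a *: x)].
have nW : nbhs (0 : E) W.
  have : nbhs ((0 : C) *: (0 : E)) b by rewrite scaler0.
  move=> /(@scale_continuous _ E (0, 0)) [[A D] [/= nA nD] AD].
  have /nbhs_ballP[d /= d0 dA] := nA.
  have d20 : d / 2 != 0 by rewrite gt_eqF // divr_gt0 // ltr0n.
  have : nbhs (0 : E) [set x | D ((d / 2)^-1 *: x)].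
    by apply: nbhs_scale; rewrite scaler0.
  apply: filterS => x /= Dx a a1.
  have -> : a *: x = (a * (d / 2)) *: ((d / 2)^-1 *: x).
    by rewrite scalerA mulfK.
  apply: (AD (a * (d / 2), (d / 2)^-1 *: x)); split => //; apply: dA.
  rewrite /ball /= sub0r normrN normrM [`|d / 2|]gtr0_norm ?divr_gt0 ?ltr0n //.
  apply: (@le_lt_trans _ _ (d / 2)); first by rewrite ler_piMl // divr_ge0 ?ler0n ?ltW.
  by rewrite ltr_pdivrMr ?ltr0n // ltr_pMr // ltr1n.
have W_absorbing x : exists2 r : R, 0 < r & W ((rc r)^-1 *: x).
  have : nbhs ((0 : C) *: x) W by rewrite scale0r.
  move=> /(@scale_continuous _ E (0, x)) [[A D] [/= nA nD] AD].
  have /nbhs_ballP[d /= d0 dA] := nA.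
  have /complex_realP[k dE] := gtr0_real d0.
  have rd0 : 0 < k by rewrite -ltcR -dE.
  exists (2 / k); first by rewrite divr_gt0.
  apply: (AD ((rc (2 / k))^-1, x)); split; last exact: nbhs_singleton.
  apply: dA; rewrite /ball /= sub0r normrN -fmorphV invf_div.
  rewrite gtr0_norm ?ltcR ?divr_gt0 // dE ltcR.
  by rewrite ltr_pdivrMr // ltr_pMr // ltr1n.
have W_balanced x (a : C) : `|a| <= 1 -> W x -> W (a *: x).
  move=> a1 Wx a' a'1; rewrite scalerA; apply: Wx.
  by rewrite normrM mulr_ile1.
have W_convex x y (s t : R) : 0 < s -> 0 < t -> W x -> W y ->
    W (rc (s / (s + t)) *: x + rc (t / (s + t)) *: y).
  move=> s0 t0 Wx Wy a a1; have st0 : 0 < s + t by rewrite addr_gt0.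
  have l0 : 0 <= rc (s / (s + t)) by rewrite ler0c divr_ge0 ?ltW.
  have l1 : rc (s / (s + t)) <= 1.
    by rewrite -(rmorph1 rc) lecR ler_pdivrMr // mul1r lerDl ltW.
  have bB : b \in B by rewrite inE.
  have tE : rc (t / (s + t)) = 1 - rc (s / (s + t)).
    rewrite -(rmorph1 rc) -rmorphB; congr (rc _).
    by field; rewrite gt_eqF.
  have := cB b bB (a *: x) (a *: y) (Itv01 l0 l1).
  rewrite !inE => /(_ (Wx a a1) (Wy a a1)).
  rewrite tE scalerDr !scalerA [a * rc _]mulrC [a * (1 - _)]mulrC -!scalerA.
  by [].
exists (fun x => 2 * gauge W x).
have sg := gauge_seminorm W_absorbing W_convex W_balanced.
have s2 : seminorm (fun x => 2 * gauge W x : C^o).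
  by apply: (@sn_scale _ _ (gauge W)) => //; rewrite ler0n.
split; first split=> //.
  apply: seminorm_continuous => //.
  have : nbhs (0 : E) [set x | W ((2 : C) *: x)].
    by apply: nbhs_scale; rewrite scaler0.
  apply: filterS => x /= /(gauge_le1 W_absorbing).
  by rewrite (snZ (sg : is_seminorm _)) ger0_norm ?ler0n.
move=> x g2; apply: bN; rewrite -[x]scale1r; apply: (gauge_lt1 W_absorbing W_balanced).
  rewrite -(@ltr_pM2l _ 2) ?ltr0n // (le_lt_trans g2) // mulr1 ltr1n //.
by rewrite normr1.
Qed.

Lemma continuous_seminorm_basis : seminorm_basis continuous_seminorm.
Proof.
split=> [q [] //|x U]; split=> [nU|[q [[sq cq] [e [e0 qU]]]]].
  have : nbhs (0 + x) U by rewrite add0r.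
  move=> /nbhs_shift /nbhs0_seminorm[q [sq qU]].
  exists q; split=> //.
  by exists 1; split=> // y /ltW /qU /=; rewrite subrK.
have sq' : is_seminorm q := sq.
have : nbhs (x - x) [set y | q y < e].
  rewrite subrr.
  have : nbhs (0 : E) ((q : E -> C^o) @^-1` [set r : C^o | `|q 0 - r| < e]).
    by apply: cq; apply/nbhs_ballP; exists e.
  apply: filterS => y /=.
  by rewrite (sn0 sq') sub0r normrN ger0_norm // (sn_ge0 sq').
by move=> /nbhs_shift; apply: filterS.
Qed.

Lemma continuous_seminormD p q : continuous_seminorm p -> continuous_seminorm q ->
  continuous_seminorm (fun x => p x + q x).
Proof.
move=> [sp cp] [sq cq]; split; first exact: (@sn_add _ _ p q).
by move=> x; exact: (cvgD (cp x) (cq x)).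
Qed.

Lemma continuous_seminormZ c q : 0 <= c -> continuous_seminorm q ->
  continuous_seminorm (fun x => c * q x).
Proof.
move=> c0 [sq cq]; split; first exact: (@sn_scale _ _ q).
by move=> x; exact: (cvgMr (cq x)).
Qed.

End LocallyConvexSeminorms.

(** A jointly continuous bilinear form is bounded by one continuous seminorm in
    each variable. *)
Lemma bilinear_form_bound (R : realType) (V : tvsType R[i]) (Lam : V -> V -> R[i]^o) :
  bilinear_for *:%R *:%R Lam -> continuous (fun p : V * V => Lam p.1 p.2) ->
  exists q : V -> R[i], continuous_seminorm q /\
    forall x y, `|Lam x y| <= q x * q y.
Proof.
move=> [Ll Lr] Lc; have L0 : Lam 0 0 = 0 by exact: lin0 (Lr 0).
have n1 : nbhs (Lam (0 : V) 0) [set z : R[i]^o | `|z| < 1].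
  rewrite L0; apply/nbhs_ballP; exists 1; first exact: ltr01.
  by move=> z; rewrite /ball /= sub0r normrN.
have [[A B] [/= nA nB] AB] := Lc (0, 0) _ n1.
have [q [[sq cq] qAB]] := nbhs0_seminorm (filterI nA nB).
have sq' : is_seminorm q := sq.
have unit x y : q x <= 1 -> q y <= 1 -> `|Lam x y| < 1.
  by move=> /qAB[Ax _] /qAB[_ By]; exact: (AB (x, y)).
have Lz a x b y : Lam (a *: x) (b *: y) = a * (b * Lam x y).
  by rewrite (linZ (Ll _)) (linZ (Lr _)).
exists q; split=> // x y.
(* If [q x = 0], all multiples of [x] lie in the unit ball of [q]: this forces
   [Lam x y = 0]. *)
have [x0|x0] := eqVneq (q x) 0; last have [y0|y0] := eqVneq (q y) 0.
- rewrite x0 mul0r normr_le0; apply/eqP; apply/eqP; apply: contraT => L1.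
  have b0 : 0 < 1 + q y by rewrite ltr_pwDl // (sn_ge0 sq').
  have := unit (((1 + q y) / Lam x y) *: x) ((1 + q y)^-1 *: y).
  rewrite Lz !(snZ sq') x0 mulr0 ler01 => /(_ isT).
  rewrite gtr0_norm ?invr_gt0 // ler_pdivrMl // mulr1 lerDr ler01 => /(_ isT).
  rewrite (_ : _ * _ = 1) ?normr1 ?ltxx //.
  by rewrite mulrACA mulfV ?gt_eqF // mulVf // mulr1.
- rewrite y0 mulr0 normr_le0; apply/eqP; apply/eqP; apply: contraT => L1.
  have b0 : 0 < 1 + q x by rewrite ltr_pwDl // (sn_ge0 sq').
  have := unit ((1 + q x)^-1 *: x) (((1 + q x) / Lam x y) *: y).
  rewrite Lz !(snZ sq') y0 mulr0 ler01 => H; move: H.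
  rewrite gtr0_norm ?invr_gt0 // ler_pdivrMl // mulr1 lerDr ler01 => /(_ isT isT).
  rewrite (_ : _ * _ = 1) ?normr1 ?ltxx //.
  by rewrite mulfVK // mulVf ?gt_eqF.
have qx : 0 < q x by rewrite lt_def x0 (sn_ge0 sq').
have qy : 0 < q y by rewrite lt_def y0 (sn_ge0 sq').
have nx : `|(q x)^-1| = (q x)^-1 by rewrite gtr0_norm ?invr_gt0.
have ny : `|(q y)^-1| = (q y)^-1 by rewrite gtr0_norm ?invr_gt0.
have := unit ((q x)^-1 *: x) ((q y)^-1 *: y).
rewrite Lz !(snZ sq') nx ny !mulVf // lexx => /(_ isT isT) /ltW.
rewrite !normrM nx ny mulrA -invfM ler_pdivrMl ?mulr1 ?mulr_gt0 //.
Qed.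

(** * Continuity of the star product *)

Section GeometricSums.
Variable C : numFieldType.

Lemma sum_half_lt n m : \sum_(n <= t < m) 2 ^- t <= 2 * 2 ^- n :> C.
Proof.
have [mn|/ltnW nm] := leqP m n.
  by rewrite big_geq // mulr_ge0 ?invr_ge0 ?exprn_ge0 ?ler0n.
suff -> : \sum_(n <= t < m) 2 ^- t = 2 * 2 ^- n - 2 * 2 ^- m :> C.
  by rewrite gerBl mulr_ge0 ?invr_ge0 ?exprn_ge0 ?ler0n.
elim: m nm => [|m IH]; first by rewrite leqn0 => /eqP ->; rewrite big_geq // subrr.
rewrite leq_eqVlt => /predU1P[<-|nm]; first by rewrite big_geq // subrr.
rewrite big_nat_recr //= IH //; rewrite exprS; field.
by rewrite !expf_neq0 // pnatr_eq0.
Qed.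
Lemma geometric_cancel (b c d : C) t : b != 0 ->
  b ^+ t * (c * (2 * b)^-1 ^+ t * d) = c * d * 2 ^- t.
Proof.
move=> b0; rewrite invfM exprMn !exprVn; field.
by rewrite !expf_neq0 ?pnatr_eq0.
Qed.
End GeometricSums.

Section Rescaling.
Variables (K : fieldType) (V : lmodType K).

Lemma bilinear_scale (Lam : V -> V -> K^o) (z : K) : bilinear_for *:%R *:%R Lam ->
  bilinear_for *:%R *:%R (fun x y => z *: Lam x y : K^o).
Proof.
move=> [Ll Lr]; split=> [y|x] a u w /=.
  by rewrite (Ll y) scalerDr !scalerA [z * a]mulrC.
by rewrite (Lr x) scalerDr !scalerA [z * a]mulrC.
Qed.

Lemma PLam_scale (Lam : V -> V -> K^o) (z : K) Z :
  bilinear_for *:%R *:%R Lam ->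
  PLam (fun x y => z *: Lam x y) Z = z *: PLam Lam Z.
Proof.
move=> LamB; have zLamB := bilinear_scale z LamB.
move: Z; apply: tprod_tensor_ext => [||u w].
- exact: PLam_linear.
- by move=> a Z Z'; rewrite (PLam_linear LamB) scalerDr !scalerA mulrC.
rewrite !PLam_tens // /PLam_word scalerA; congr (_ *: _).
by rewrite mulrCA.
Qed.

Lemma star_term_scale (Lam : V -> V -> K^o) (z : K) t A B :
  bilinear_for *:%R *:%R Lam ->
  star_term (fun x y => z *: Lam x y) t A B = z ^+ t *: star_term Lam t A B.
Proof.
move=> LamB; rewrite /star_term.
have -> : iter t (PLam (fun x y => z *: Lam x y)) (tens (symval A) (symval B)) =
    z ^+ t *: iter t (PLam Lam) (tens (symval A) (symval B)).
  elim: t => [|t IH]; first by rewrite scale1r.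
  by rewrite !iterS IH PLam_scale // (linZ (PLam_linear LamB)) scalerA exprS.
by rewrite (linZ (@mu_vee_linear _ _)) !scalerA mulrC.
Qed.

Lemma star_term_bilinear (Lam : V -> V -> K^o) t : bilinear_for *:%R *:%R Lam ->
  bilinear_for *:%R *:%R (star_term Lam t).
Proof.
move=> LamB; have il := iter_PLam_linear LamB t; have ml := @mu_vee_linear K V.
split=> [B|A] a X Y; rewrite /star_term /=.
  by rewrite tens_linl il ml scalerDr !scalerA mulrC.
by rewrite tens_linr il ml scalerDr !scalerA mulrC.
Qed.

Lemma symvalD (A B : symtensor V) : symval (A + B) = symval A + symval B.
Proof. by []. Qed.

Lemma symvalZ a (A : symtensor V) : symval (a *: A) = a *: symval A.
Proof. by []. Qed.

End Rescaling.

Section SymTopology.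
Variables (R : realType) (V : tvsType R[i]).
Local Notation C := R[i].
Implicit Types h : hilbert_form V.

Definition hzero : hilbert_form V.
Proof.
refine (@HilbertForm _ _ (fun _ _ => 0) _ _ _ _ _).
- by move=> x a y z; rewrite scaler0 addr0.
- by move=> y a x z; rewrite mulr0 addr0.
- by move=> x y; rewrite rmorph0.
- by move=> x.
- by move=> p; exact: cvg_cst.
Defined.

Lemma tnorm_hsuml h h' X : tnorm h X <= tnorm (hsum h h') X.
Proof. by apply: tnorm_mono => x; rewrite lerDl; exact: hform_ge0. Qed.

Lemma tnorm_hsumr h h' X : tnorm h' X <= tnorm (hsum h h') X.
Proof. by apply: tnorm_mono => x; rewrite lerDr; exact: hform_ge0. Qed.

(** Finitely many Hilbert forms are dominated by their sum. *)
Lemma tnorm_all_bound (s : seq (hilbert_form V)) : exists h, forall X (e : C),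
  tnorm h X < e -> all (fun h' => tnorm h' X < e) s.
Proof.
elim: s => [|h' s [h hs]]; first by exists hzero.
exists (hsum h' h) => X e Xe /=; rewrite (le_lt_trans (tnorm_hsuml _ _ _) Xe) /=.
exact: hs (le_lt_trans (tnorm_hsumr _ _ _) Xe).
Qed.

Definition sym_norm h (A : symtensor V) : C := tnorm h (symval A).

Lemma sym_norm_seminorm h : is_seminorm (sym_norm h).
Proof.
split=> [A|A B|a A]; first exact: tnorm_ge0.
  rewrite /sym_norm symvalD; exact: tnormD.
rewrite /sym_norm symvalZ; exact: tnormZ.
Qed.

Lemma tnorm_ball_open h (X : tensor V) (e : C) : open [set Y | tnorm h (Y - X) < e].
Proof.
move=> Y /= hY; exists [:: h], (e - tnorm h (Y - X)); split.
  by rewrite subr_gt0.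
move=> Z /= /andP[hZ _]; have -> : Z - X = (Z - Y) + (Y - X) by rewrite subrKA.
by apply: le_lt_trans (tnormD _ _ _) _; rewrite -ltrBrDr.
Qed.

Lemma symtensor_basis :
  seminorm_basis (fun q : symtensor V -> C => exists h, q = sym_norm h).
Proof.
split=> [q [h ->]|A U]; first exact: sym_norm_seminorm.
split=> [|[q [[h ->] [e [e0 qU]]]]].
  rewrite nbhsE => -[W [[B Bo BW] WA] WU].
  have BA : B (symval A) by move: WA; rewrite -BW.
  have [s [e [e0 sB]]] := Bo _ BA; have [h hs] := tnorm_all_bound s.
  exists (sym_norm h); split; first by exists h.
  exists e; split=> // D hD; apply: WU; rewrite -BW /=.
  by apply: sB; exact: hs.
rewrite nbhsE; exists [set D | sym_norm h (D - A) < e]; last exact: qU.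
split; last by rewrite /= subrr (sn0 (sym_norm_seminorm h)).
by exists [set Y | tnorm h (Y - symval A) < e] => //; exact: tnorm_ball_open.
Qed.

Hypothesis V_hilbert : hilbert_topology V.
Variable Lam : V -> V -> C^o.
Hypothesis LamB : bilinear_for *:%R *:%R Lam.
Hypothesis Lam_continuous : continuous (fun p : V * V => Lam p.1 p.2).

(** Enlarging the seminorm makes [Lam] as small as desired, which gives the terms
    any prescribed geometric rate of decay. *)
Lemma star_term_geometric h (r : C) : 0 < r -> exists h' (c : C), 0 <= c /\
  forall t A B, sym_norm h (star_term Lam t A B) <=
    c * r ^+ t * sym_norm h' A * sym_norm h' B.
Proof.
move=> r0; have [q [[sq cq] Lq]] := bilinear_form_bound LamB Lam_continuous.
have [g qg] := V_hilbert sq cq.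
(* Besides [r^-1 <= c], which gives the rate, [1 <= c] makes [h2] dominate [h]. *)
pose c := 1 + r^-1; have c1 : 1 <= c by rewrite lerDl invr_ge0 ltW.
have c0 : 0 < c by apply: lt_le_trans c1.
have c0' := ltW c0; have cn0 : c != 0 by rewrite gt_eqF.
pose h2 := hscale c0' (hsum h g).
pose Lam' x y : C^o := c *: Lam x y.
have Lam'B : bilinear_for *:%R *:%R Lam' := bilinear_scale c LamB.
have gh2 x : sqrtC c * hnorm g x <= hnorm h2 x.
  rewrite /hnorm -sqrtCM ?nnegrE // ?hform_ge0 //.
  rewrite ler_sqrtC ?nnegrE ?mulr_ge0 ?hform_ge0 //.
  by rewrite /h2 /= ler_wpM2l // lerDr hform_ge0.
have Lam'_bound x y : `|Lam' x y| <= hnorm h2 x * hnorm h2 y.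
  have q0 z : 0 <= q z by case: sq.
  have g0 z : 0 <= hnorm g z by rewrite sqrtC_ge0 hform_ge0.
  have s0 : 0 <= sqrtC c by rewrite sqrtC_ge0.
  apply: (@le_trans _ _ ((sqrtC c * hnorm g x) * (sqrtC c * hnorm g y))).
    rewrite mulrACA -expr2 sqrtCK normrM (ger0_norm c0') ler_wpM2l //.
    by apply: le_trans (Lq x y) _; apply: ler_pM.
  by apply: ler_pM => //; exact: mulr_ge0.
have LamE : Lam = fun x y => c^-1 *: Lam' x y.
  by apply/funext => x; apply/funext => y; rewrite /Lam' scalerA mulVf // scale1r.
exists (hscale (ler0n C 16) h2), 4; split=> [|t A B]; first by rewrite ler0n.
rewrite {1}LamE star_term_scale // (snZ (sym_norm_seminorm h)).
have hh2 X : tnorm h X <= tnorm h2 X.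
  apply: tnorm_mono => x; rewrite /h2 /=; apply: (@le_trans _ _ (h x x + g x x : C)).
    by rewrite lerDl hform_ge0.
  by rewrite ler_peMl // addr_ge0 // hform_ge0.
apply: (@le_trans _ _ (r ^+ t * (4 * sym_norm (hscale (ler0n C 16) h2) A *
    sym_norm (hscale (ler0n C 16) h2) B))); last by rewrite !mulrA [r ^+ t * 4]mulrC.
apply: ler_pM => //; first exact: tnorm_ge0.
  rewrite normrX; apply: lerXn2r; rewrite ?nnegrE ?normr_ge0 ?(ltW r0) //.
  rewrite gtr0_norm ?invr_gt0 // -(invrK r) lef_pV2 ?posrE ?invr_gt0 //.
  by rewrite lerDr.
apply: le_trans (hh2 _) _.
exact: star_term_bound Lam'B Lam'_bound t A B.
Qed.

Lemma star_bound h : exists h' (c : C), 0 <= c /\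
  forall A B, sym_norm h (star Lam A B) <= c * sym_norm h' A * sym_norm h' B.
Proof.
have r0 : 0 < 2^-1 :> C by rewrite invr_gt0 ltr0n.
have [h' [c [c0 hc]]] := star_term_geometric h r0.
exists h', (c * 2); split=> [|A B]; first by rewrite mulr_ge0 ?ler0n.
have [n /(_ _ (leqnn n)) ->] := star_sum LamB A B.
apply: le_trans (sn_sum (sym_norm_seminorm h) _ _ _) _.
apply: (@le_trans _ _ (\sum_(t < n) 2 ^- t * (c * sym_norm h' A * sym_norm h' B))).
  apply: ler_sum => t _; apply: le_trans (hc t A B) _.
  by rewrite exprVn -!mulrA mulrCA.
have K0 : 0 <= c * sym_norm h' A * sym_norm h' B.
  by rewrite !mulr_ge0 // tnorm_ge0.
rewrite -mulr_suml; have := sum_half_lt C 0 n; rewrite invr1 mulr1 big_mkord => le2.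
by apply: le_trans (ler_wpM2r K0 le2) _; rewrite mulrA mulrA [2 * c]mulrC.
Qed.

Lemma star_continuous : continuous (fun p : symtensor V * symtensor V => star Lam p.1 p.2).
Proof.
apply: (bilipschitz_continuous symtensor_basis symtensor_basis) => p [h ->].
have [h' [c [c0 hc]]] := star_bound h; exists (sym_norm h'), c; split => //.
  by exists h'.
apply: bilinear_bilipschitz hc; first exact: star_bilinear.
exact: sym_norm_seminorm.
Qed.

Lemma star_lc_algebra : lc_algebra (star Lam).
Proof.
split; last exact: star_continuous.
  split; [exact: (basis_add_continuous symtensor_basis)
         |exact: (basis_scale_continuous symtensor_basis)
         |exact: (basis_locally_convex symtensor_basis)].
by split; [exact: star_bilinear|exact: starA|exact: star_unit].
Qed.

End SymTopology.

(** * Power series in a complete locally convex space *)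

Section Limits.
Variable C : numFieldType.

Lemma le_of_le_add (x y K : C) : x \is Num.real -> y \is Num.real -> 0 <= K ->
  (forall e, 0 < e -> e <= 1 -> x <= y + K * e) -> x <= y.
Proof.
move=> xR yR K0 xy; rewrite real_leNgt //; apply/negP => ltyx.
pose d := x - y; have d0 : 0 < d by rewrite subr_gt0.
have Kd : 0 < K + d by rewrite ltr_wpDl.
have e0 : 0 < d / (K + d) by rewrite divr_gt0.
have e1 : d / (K + d) <= 1 by rewrite ler_pdivrMr // mul1r lerDr.
have := xy _ e0 e1; rewrite -lerBlDl -/d mulrA ler_pdivlMr //.
by rewrite mulrC ler_pM2r // gerDl (lt_geF d0).
Qed.

Hypothesis archi : forall e : C, 0 < e -> exists n, 2 ^- n < e.

Lemma le_of_le_add_half (x y K : C) : x \is Num.real -> y \is Num.real -> 0 <= K ->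
  (forall n, x <= y + K * 2 ^- n) -> x <= y.
Proof.
move=> xR yR K0 xy; apply: (le_of_le_add xR yR K0) => e /archi[n ne] _.
by apply: le_trans (xy n) _; rewrite lerD2l ler_wpM2l // ltW.
Qed.

End Limits.

Section Completeness.
Variables (C : numFieldType) (E : lmodType C) (Q : (E -> C) -> Prop).
Hypothesis Qsn : forall q, Q q -> is_seminorm q.
Hypothesis QZ : forall c q, 0 <= c -> Q q -> Q (fun x => c * q x).
Hypothesis Q_separated : forall x, (forall q, Q q -> q x = 0) -> x = 0.
Hypothesis Q_complete : forall F : set_system E, ProperFilter F ->
  (forall q, Q q -> exists2 A, F A & forall x y, A x -> A y -> q (x - y) <= 1) ->
  exists l, forall q, Q q -> F [set x | q (x - l) < 1].
Hypothesis archi : forall e : C, 0 < e -> exists n, 2 ^- n < e.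

Lemma separated_eq x y : (forall q, Q q -> forall e, 0 < e -> q (x - y) < e) -> x = y.
Proof.
move=> xy; apply/eqP; rewrite -subr_eq0; apply/eqP; apply: Q_separated => q Qq.
apply/eqP; apply: contraT => q0.
have qp : 0 < q (x - y) by rewrite lt_def q0 (sn_ge0 (Qsn Qq)).
by have := xy q Qq _ qp; rewrite ltxx.
Qed.

Section PowerSeries.
Variable M : nat -> E.
Hypothesis M_rate : forall q, Q q -> forall r, 0 < r ->
  exists c, 0 <= c /\ forall t, q (M t) <= c * r ^+ t.

Definition series_bound (q : E -> C) (B c : C) : Prop :=
  0 <= c /\ forall t, B ^+ t * q (M t) <= c * 2 ^- t.

Lemma series_bound_exists q B : Q q -> 0 <= B -> exists c, series_bound q B c.
Proof.
move=> Qq B0; have B1 : 0 < 2 * (B + 1) by rewrite mulr_gt0 ?ltr0n // ltr_wpDl.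
have rp : 0 < (2 * (B + 1))^-1 by rewrite invr_gt0.
have [c [c0 Mc]] := M_rate Qq rp; exists c; split => // t.
apply: (@le_trans _ _ ((B + 1) ^+ t * q (M t))).
  rewrite ler_wpM2r ?(sn_ge0 (Qsn Qq)) // lerXn2r ?nnegrE ?addr_ge0 //.
  by rewrite lerDl.
have Bt : 0 < (B + 1) ^+ t by rewrite exprn_gt0 // ltr_wpDl.
apply: (@le_trans _ _ ((B + 1) ^+ t * (c * (2 * (B + 1))^-1 ^+ t))).
  by rewrite ler_wpM2l // ltW.
rewrite invfM exprMn exprVn mulrC -!mulrA ler_wpM2l // exprVn.
by rewrite mulVf ?mulr1 // gt_eqF.
Qed.

(** The bounds on the remainders hold uniformly for all coefficient sequences
    under a given geometric majorant: they give both the uniqueness of the sum and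
    all the uniform estimates that follow. *)
Definition is_psum (a : nat -> C) (S : E) : Prop :=
  forall q A B c n, Q q -> 0 <= A -> (forall t, `|a t| <= A * B ^+ t) ->
  series_bound q B c -> q (S - \sum_(t < n) a t *: M t) <= 2 * A * c * 2 ^- n.

Let psum_diff a q A B c n m : Q q -> 0 <= A -> (forall t, `|a t| <= A * B ^+ t) ->
  series_bound q B c -> (n <= m)%N ->
  q (\sum_(t < m) a t *: M t - \sum_(t < n) a t *: M t) <= 2 * A * c * 2 ^- n.
Proof.
move=> Qq A0 aB [c0 Mc] nm; have sq := Qsn Qq.
rewrite -!(big_mkord xpredT (fun t => a t *: M t)) (big_cat_nat _ nm) //=.
rewrite addrAC subrr add0r; apply: le_trans (sn_sum sq _ _ _) _.
apply: (@le_trans _ _ (\sum_(n <= t < m) A * c * 2 ^- t)).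
  apply: ler_sum => t _; rewrite (snZ sq) -mulrA.
  apply: le_trans (ler_wpM2r (sn_ge0 sq _) (aB t)) _.
  by rewrite -mulrA ler_wpM2l.
rewrite -mulr_sumr; apply: le_trans (ler_wpM2l _ (sum_half_lt C n m)) _.
  exact: mulr_ge0.
by rewrite mulrCA !mulrA.
Qed.

Lemma psum_exists a A B : 0 <= A -> 0 <= B -> (forall t, `|a t| <= A * B ^+ t) ->
  exists S, is_psum a S.
Proof.
move=> A0 B0 aB; pose u n := \sum_(t < n) a t *: M t.
have [l lu] : exists l, forall q, Q q -> (u @ \oo) [set x | q (x - l) < 1].
  apply: Q_complete => q Qq; have sq := Qsn Qq.
  have [c cB] := series_bound_exists Qq B0.
  have K0 : 0 <= 2 * A * c * 2 by case: cB => c0 _; rewrite !mulr_ge0 ?ler0n.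
  have [n nK] : exists n, 2 ^- n < (2 * A * c * 2 + 1)^-1.
    by apply: archi; rewrite invr_gt0 ltr_wpDl.
  exists (u @` [set k | (n <= k)%N]).
    by exists n => // k /= nk; exists k.
  move=> _ _ [k /= nk <-] [k' /= nk' <-]; apply: le_trans (sn_dist sq (u n) _ _) _.
  rewrite (sn_distC sq (u n)).
  apply: le_trans (lerD (psum_diff Qq A0 aB cB nk) (psum_diff Qq A0 aB cB nk')) _.
  apply: (@le_trans _ _ ((2 * A * c * 2 + 1) * 2 ^- n)).
    rewrite -mulr2n -[X in X <= _]mulr_natr mulrAC.
    by rewrite ler_wpM2r ?lerDl // invr_ge0 exprn_ge0 ?ler0n.
  have K1 : 0 < 2 * A * c * 2 + 1 by rewrite ltr_wpDl.
  by rewrite mulrC -ler_pdivlMr // mul1r ltW.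
exists l => q A' B' c n Qq A'0 aB' cB; have sq := Qsn Qq; rewrite -/(u n).
have [c0 _] := cB.
have K0 : 0 <= 2 * A' * c by rewrite !mulr_ge0 ?ler0n.
apply: (@le_of_le_add _ _ _ 1); rewrite ?(sn_real sq) //.
  by rewrite ger0_real // mulr_ge0 // invr_ge0 exprn_ge0 ?ler0n.
move=> e e0 _; rewrite mul1r.
have e'0 : 0 <= e^-1 by rewrite invr_ge0 ltW.
have [m _ lm] := lu _ (QZ e'0 Qq).
have := lm (maxn n m) (leq_maxr n m) => /=.
rewrite mulrC ltr_pdivrMr // mul1r => le1.
apply: le_trans (sn_dist sq (u (maxn n m)) _ _) _; rewrite addrC lerD //.
  exact: psum_diff A'0 aB' cB (leq_maxl n m).
by rewrite (sn_distC sq) ltW.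
Qed.

Lemma psum_eq a S A B x N : 0 <= A -> 0 <= B ->
  (forall t, `|a t| <= A * B ^+ t) -> is_psum a S ->
  (forall n, (N <= n)%N -> x = \sum_(t < n) a t *: M t) -> S = x.
Proof.
move=> A0 B0 aB aS xE; apply: separated_eq => q Qq e e0.
have [c cB] := series_bound_exists Qq B0; have [c0 _] := cB.
have K1 : 0 < 2 * A * c + 1 by rewrite ltr_wpDl ?mulr_ge0 ?ler0n.
have [n ne] : exists n, 2 ^- n < e / (2 * A * c + 1).
  by apply: archi; rewrite divr_gt0.
have h2 k : 0 < 2 ^- k :> C by rewrite invr_gt0 exprn_gt0 ?ltr0n.
rewrite (xE _ (leq_maxr n N)); apply: le_lt_trans (aS q A B c _ Qq A0 aB cB) _.
apply: (@le_lt_trans _ _ ((2 * A * c + 1) * 2 ^- n)).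
  apply: ler_pM; rewrite ?mulr_ge0 ?ler0n ?(ltW (h2 _)) ?lerDl //.
  by rewrite lef_pV2 ?posrE ?exprn_gt0 ?ltr0n // ler_weXn2l ?ler1n // leq_maxl.
by rewrite mulrC -ltr_pdivlMr.
Qed.

Variable f : C -> E.
Hypothesis f_psum : forall z, is_psum (fun t => z ^+ t) (f z).

Lemma f_remainder q B c z n : Q q -> `|z| <= B -> series_bound q B c ->
  q (f z - \sum_(t < n) z ^+ t *: M t) <= 2 * c * 2 ^- n.
Proof.
move=> Qq zB cB.
have zt t : `|z ^+ t| <= 1 * B ^+ t.
  by rewrite mul1r normrX lerXn2r ?nnegrE //; exact: le_trans zB.
by have := @f_psum z q 1 B c n Qq ler01 zt cB; rewrite mulr1.
Qed.

Let tpow (B : C) t : 0 <= B -> t%:R * B ^+ t.-1 <= (B + 1) ^+ t.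
Proof.
move=> B0; elim: t => [|t IH]; first by rewrite mul0r expr0 ler01.
have e0 k : 0 <= (B + 1) ^+ k by rewrite exprn_ge0 // addr_ge0.
have : B ^+ t <= (B + 1) ^+ t by rewrite lerXn2r ?nnegrE ?addr_ge0 // lerDl.
rewrite /= exprS mulrDl mul1r -natr1 mulrDl mul1r => le1; apply: lerD le1.
case: t IH => [|t] IH; first by rewrite mul0r mulr_ge0.
by rewrite /= in IH *; rewrite exprS mulrCA ler_wpM2l.
Qed.

(** Second-order Taylor bound for a power. The base [`|z| + 2] instead of [`|z| + 1]
    leaves room for the term [t * z ^+ t.-1] in the induction step. *)
Let pow_Taylor (z h : C) t : `|h| <= 1 ->
  `|(z + h) ^+ t - z ^+ t - t%:R * h * z ^+ t.-1| <= `|h| ^+ 2 * (`|z| + 2) ^+ t.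
Proof.
move=> h1; elim: t => [|t IH].
  by rewrite !expr0 subrr mul0r mul0r subr0 normr0 mulr1 exprn_ge0.
set D := _ - _ in IH.
have -> : (z + h) ^+ t.+1 - z ^+ t.+1 - t.+1%:R * h * z ^+ t.+1.-1 =
    (z + h) * D + t%:R * h ^+ 2 * z ^+ t.-1.
  rewrite /D -natr1; case: t {IH D} => [|t] /=.
    by rewrite !expr0 !expr1; ring.
  by rewrite !exprS; ring.
apply: le_trans (ler_normD _ _) _.
have le1 : `|(z + h) * D| <= `|h| ^+ 2 * ((`|z| + 1) * (`|z| + 2) ^+ t).
  rewrite normrM mulrCA ler_pM //; apply: le_trans (ler_normD _ _) _.
  by rewrite lerD2l.
have le2 : `|t%:R * h ^+ 2 * z ^+ t.-1| <= `|h| ^+ 2 * (`|z| + 2) ^+ t.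
  rewrite !normrM normr_nat !normrX mulrAC mulrC ler_wpM2l ?exprn_ge0 //.
  apply: le_trans (tpow t (normr_ge0 z)) _.
  by rewrite lerXn2r ?nnegrE ?addr_ge0 // ?lerD2l ?ler1n // ler0n.
apply: le_trans (lerD le1 le2) _.
rewrite -mulrDr ler_wpM2l ?exprn_ge0 // -{2}[_ ^+ t]mul1r -mulrDl -addrA.
by rewrite -exprS -natr1.
Qed.

(** Differentiation term by term, with a quadratic remainder. *)
Lemma psum_derivative z : exists l, forall q, Q q -> exists c, 0 <= c /\
  forall h, `|h| <= 1 -> q (f (z + h) - f z - h *: l) <= c * `|h| ^+ 2.
Proof.
pose a t := t%:R * z ^+ t.-1.
have aB t : `|a t| <= 1 * (`|z| + 2) ^+ t.
  rewrite /a mul1r normrM normr_nat normrX.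
  apply: le_trans (tpow t (normr_ge0 z)) _.
  by rewrite lerXn2r ?nnegrE ?addr_ge0 ?ler0n // lerD2l ler1n.
have B0 : 0 <= `|z| + 2 by rewrite addr_ge0 ?ler0n.
have [l al] := psum_exists ler01 B0 aB.
exists l => q Qq; have sq := Qsn Qq.
have [c cB] := series_bound_exists Qq B0; have [c0 Mc] := cB.
exists (2 * c); split=> [|h h1]; first by rewrite mulr_ge0 ?ler0n.
have h0 : 0 <= c * `|h| ^+ 2 by rewrite mulr_ge0 ?exprn_ge0.
apply: (@le_of_le_add_half _ archi _ _ (2 * c + 2 * c + 2 * c)).
- exact: sn_real.
- by rewrite ger0_real // !mulr_ge0 ?ler0n ?exprn_ge0.
- by rewrite !addr_ge0 // mulr_ge0 ?ler0n.
move=> n; pose P w := \sum_(t < n) w ^+ t *: M t.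
pose L := \sum_(t < n) a t *: M t.
have -> : f (z + h) - f z - h *: l = (P (z + h) - P z - h *: L) +
   ((f (z + h) - P (z + h)) - (f z - P z) - h *: (l - L)).
  have swap (x p y r : E) : x - p - (y - r) = x - y - (p - r).
    by rewrite opprD addrACA -opprD.
  by rewrite scalerBr (swap _ _ (f z)) (swap (f (z + h) - f z)) [RHS]addrC subrK.
have PL : P (z + h) - P z - h *: L =
    \sum_(t < n) ((z + h) ^+ t - z ^+ t - t%:R * h * z ^+ t.-1) *: M t.
  rewrite /P /L scaler_sumr -!sumrB; apply: eq_bigr => t _.
  by rewrite !scalerBl scalerA /a mulrA [h * _]mulrC.
have le1 : q (P (z + h) - P z - h *: L) <= 2 * c * `|h| ^+ 2.
  rewrite PL; apply: le_trans (sn_sum sq _ _ _) _.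
  apply: (@le_trans _ _ (\sum_(0 <= t < n) `|h| ^+ 2 * c * 2 ^- t)).
    rewrite big_mkord; apply: ler_sum => t _; rewrite (snZ sq) -[leRHS]mulrA.
    apply: le_trans (ler_wpM2r (sn_ge0 sq _) (pow_Taylor z t h1)) _.
    by rewrite -mulrA ler_wpM2l // exprn_ge0.
  rewrite -mulr_sumr; have := sum_half_lt C 0 n; rewrite invr1 mulr1 => le2.
  apply: le_trans (ler_wpM2l _ le2) _; first by rewrite mulr_ge0 ?exprn_ge0.
  by rewrite le_eqVlt; apply/orP; left; apply/eqP; ring.
have zh : `|z + h| <= `|z| + 2.
  apply: le_trans (ler_normD _ _) _; rewrite lerD2l (le_trans h1) //.
  by rewrite ler1n.
have z2 : `|z| <= `|z| + 2 by rewrite lerDl ler0n.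
apply: le_trans (snD sq _ _) _; apply: lerD => //.
apply: le_trans (snB sq _ _) _; rewrite (mulrDl (2 * c + 2 * c)) (mulrDl (2 * c)).
apply: lerD.
  apply: le_trans (snB sq _ _) _.
  by apply: lerD; [exact: f_remainder n Qq zh cB|exact: f_remainder n Qq z2 cB].
rewrite (snZ sq); apply: le_trans (ler_piMl (sn_ge0 sq _) h1) _.
by have := al q 1 _ c n Qq ler01 aB cB; rewrite mulr1.
Qed.

End PowerSeries.

(** * Extension of bounded bilinear maps to a completion *)

Section Extension.
Variables (S : lmodType C) (i : S -> E).
Hypothesis QD : forall p q, Q p -> Q q -> Q (fun x => p x + q x).
Hypothesis Q_nonempty : exists q, Q q.
Hypothesis i_dense : forall X q, Q q -> exists s, q (i s - X) < 1.

Variable m : S -> S -> E.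
(** The estimate satisfied by bounded bilinear maps: it makes the images under [m]
    of the traces of neighbourhoods of [X] and [Y] a Cauchy filter. *)
Hypothesis m_lip : forall q, Q q -> exists q' c, [/\ Q q', 0 <= c &
  forall a a' b b', q (m a b - m a' b') <=
    c * (q' (i a - i a') * q' (i b) + q' (i a') * q' (i b - i b'))].

Let extension_at X Y : exists Z, forall q, Q q -> exists q', Q q' /\
  forall a b, q' (i a - X) < 1 -> q' (i b - Y) < 1 -> q (m a b - Z) < 1.
Proof.
pose F : set_system E := fun A => exists q, Q q /\
  forall a b, q (i a - X) < 1 -> q (i b - Y) < 1 -> A (m a b).
have FF : ProperFilter F.
  split.
    case=> q [Qq H]; have [a aX] := i_dense X Qq; have [b bY] := i_dense Y Qq.
    exact: H aX bY.
  split.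
  - by have [q Qq] := Q_nonempty; exists q.
  - move=> A A' [q [Qq qA]] [q' [Qq' qA']].
    exists (fun x => q x + q' x); split; first exact: QD.
    have lt1 x : q x + q' x < 1 -> q x < 1 /\ q' x < 1.
      by split; apply: le_lt_trans H; rewrite ?lerDl ?lerDr (sn_ge0 (Qsn _)).
    move=> a b /lt1[a1 a2] /lt1[b1 b2]; split; [exact: qA|exact: qA'].
  - by move=> A A' AA' [q [Qq qA]]; exists q; split => // a b ha hb; apply/AA'/qA.
apply: (Q_complete FF) => q Qq; have [q' [c [Qq' c0 qm]]] := m_lip Qq.
have sq' := Qsn Qq'; have q'0 := sn_ge0 sq'.
(* Chosen so that the Lipschitz estimate gives at most 1 at distance [K^-1]. *)
pose K := 2 * c * (q' X + q' Y + 2) + 1.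
have K1 : 1 <= K by rewrite lerDr !mulr_ge0 ?addr_ge0 ?ler0n.
have K0 : 0 < K by apply: lt_le_trans K1.
have K0' := ltW K0.
exists [set Z | exists a b, [/\ K * q' (i a - X) < 1, K * q' (i b - Y) < 1 & Z = m a b]].
  by exists (fun x => K * q' x); split=> [|a b ha hb]; [exact: QZ|exists a, b].
move=> _ _ [a [b [ha hb ->]]] [a' [b' [ha' hb' ->]]]; apply: le_trans (qm _ _ _ _) _.
pose d := K^-1; have d0 : 0 <= d by rewrite invr_ge0.
have small x : K * q' x < 1 -> q' x <= d by rewrite -ltr_pdivlMl // mulr1 => /ltW.
have d1 : d <= 1 by rewrite invf_le1.
have near x y Z : q' (x - Z) <= d -> q' (y - Z) <= d -> q' (x - y) <= 2 * d.
  move=> hx hy; apply: le_trans (sn_dist sq' Z _ _) _; rewrite (sn_distC sq' Z).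
  by rewrite mulr_natl mulr2n lerD.
have bound x Z : q' (x - Z) <= d -> q' x <= q' Z + 1.
  by move=> hx; apply: le_trans (sn_le_dist sq' Z x) _; rewrite lerD2l (le_trans hx).
move: (small _ ha) (small _ hb) (small _ ha') (small _ hb') => {}ha {}hb {}ha' {}hb'.
apply: (@le_trans _ _ (c * (2 * d * (q' Y + 1) + (q' X + 1) * (2 * d)))).
  rewrite ler_wpM2l // lerD // ler_pM // ?(near _ _ _ ha ha') ?(near _ _ _ hb hb') //.
    exact: bound hb.
  exact: bound ha'.
rewrite (_ : _ * _ = (2 * c * (q' X + q' Y + 2)) * d); last by ring.
by rewrite -ler_pdivlMr ?invr_gt0 // invrK mul1r /K lerDl ler01.
Qed.

(** [M X Y] is the limit of [m a b] when [i a] tends to [X] and [i b] to [Y]; all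
    tolerances are 1 because the seminorms can be rescaled. *)
Definition extends (M : E -> E -> E) : Prop := forall X Y q, Q q ->
  exists q', Q q' /\ forall a b, q' (i a - X) < 1 -> q' (i b - Y) < 1 ->
    q (m a b - M X Y) < 1.

Lemma extension_exists : exists M, extends M.
Proof.
have [M HM] := choice (fun XY : E * E => extension_at XY.1 XY.2).
by exists (fun X Y => M (X, Y)) => X Y; exact: HM (X, Y).
Qed.

Variable M : E -> E -> E.
Hypothesis M_ext : extends M.

Let M_eps X Y q e : Q q -> 0 < e -> exists q', Q q' /\ forall a b,
  q' (i a - X) < 1 -> q' (i b - Y) < 1 -> q (m a b - M X Y) < e.
Proof.
move=> Qq e0; have e'0 : 0 <= e^-1 by rewrite invr_ge0 ltW.
have [q' [Qq' H]] := M_ext X Y (QZ e'0 Qq); exists q'; split => // a b ha hb.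
by have := H a b ha hb; rewrite mulrC ltr_pdivrMr // mul1r.
Qed.

Lemma extends_eq a b : M (i a) (i b) = m a b.
Proof.
apply/esym/separated_eq => q Qq e e0; have [q' [Qq' H]] := M_eps (i a) (i b) Qq e0.
by apply: H; rewrite subrr (sn0 (Qsn Qq')) ltr01.
Qed.

Let approx X Y q q0 e : Q q -> Q q0 -> 0 < e -> exists a b,
  [/\ q (m a b - M X Y) < e, q0 (i a - X) < e & q0 (i b - Y) < e].
Proof.
move=> Qq Qq0 e0; have [q' [Qq' H]] := M_eps X Y Qq e0.
have e'0 : 0 <= e^-1 by rewrite invr_ge0 ltW.
have Qr := QD Qq' (QZ e'0 Qq0).
have split_lt x : q' x + e^-1 * q0 x < 1 -> q' x < 1 /\ q0 x < e.
  move=> lt1; split.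
    by apply: le_lt_trans lt1; rewrite lerDl mulr_ge0 // (sn_ge0 (Qsn Qq0)).
  rewrite -[e]mulr1 -ltr_pdivrMl //; apply: le_lt_trans lt1.
  by rewrite lerDr (sn_ge0 (Qsn Qq')).
have [a /split_lt[a1 a2]] := i_dense X Qr; have [b /split_lt[b1 b2]] := i_dense Y Qr.
by exists a, b; split => //; exact: H.
Qed.

Lemma extends_bilipschitz q q' c : Q q -> Q q' -> 0 <= c ->
  (forall a a' b b', q (m a b - m a' b') <=
    c * (q' (i a - i a') * q' (i b) + q' (i a') * q' (i b - i b'))) ->
  bilipschitz M q q' c.
Proof.
move=> Qq Qq' c0 qm X X' Y Y'; have sq := Qsn Qq; have sq' := Qsn Qq'.
have p0 := sn_ge0 sq'.
apply: (@le_of_le_add _ _ _ (2 + c * (2 * (q' Y + 1) + q' (X - X') +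
                                  (q' (Y - Y') + 2) + 2 * q' X'))).
- exact: sn_real.
- by rewrite ger0_real // mulr_ge0 // addr_ge0 // mulr_ge0.
- by rewrite addr_ge0 ?ler0n // mulr_ge0 // !addr_ge0 ?mulr_ge0 ?addr_ge0 ?ler0n.
move=> e e0 e1; have e0' := ltW e0.
have [a [b [hab ha hb]]] := approx X Y Qq Qq' e0.
have [a' [b' [hab' ha' hb']]] := approx X' Y' Qq Qq' e0.
have near x y Z Z' : q' (x - Z) < e -> q' (y - Z') < e ->
    q' (x - y) <= q' (Z - Z') + 2 * e.
  move=> hx hy; apply: le_trans (sn_dist sq' Z _ _) _.
  rewrite addrC mulr_natl mulr2n addrA; apply: lerD; last exact: ltW.
  apply: le_trans (sn_dist sq' Z' _ _) _; rewrite (sn_distC sq' Z' y) lerD2l.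
  exact: ltW.
have bound x Z : q' (x - Z) < e -> q' x <= q' Z + e.
  by move=> hx; apply: le_trans (sn_le_dist sq' Z x) _; rewrite lerD2l ltW.
apply: le_trans (sn_dist sq (m a b) _ _) _.
apply: le_trans (lerD (lexx _) (sn_dist sq (m a' b') _ _)) _.
rewrite (sn_distC sq (M X Y)).
apply: (@le_trans _ _ (e + (c * ((q' (X - X') + 2 * e) * (q' Y + e) +
    (q' X' + e) * (q' (Y - Y') + 2 * e)) + e))).
  apply: lerD; first exact: ltW.
  apply: lerD; last exact: ltW.
  apply: le_trans (qm _ _ _ _) _; rewrite ler_wpM2l //.
  apply: lerD; apply: ler_pM => //.
  - exact: near ha ha'.
  - exact: bound hb.
  - exact: bound ha'.
  - exact: near hb hb'.
rewrite (_ : _ + (_ + e) = c * (q' (X - X') * q' Y + q' X' * q' (Y - Y')) +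
   (2 + c * (2 * (q' Y + e) + q' (X - X') + (q' (Y - Y') + 2 * e) + 2 * q' X')) * e);
  last by ring.
rewrite lerD2l ler_wpM2r // lerD2l ler_wpM2l // lerD2r !lerD //.
  by rewrite ler_wpM2l ?ler0n // lerD2l.
by rewrite ler_piMr ?ler0n.
Qed.

End Extension.
End Completeness.

(** * The star product on the completion *)

Section ComplexNumbers.
Import numFieldNormedType.Exports.
Variable R : realType.
Local Notation C := R[i].
Local Notation rc := (real_complex R).

Lemma complex_archi (e : C) : 0 < e -> exists n, 2 ^- n < e.
Proof.
move=> e0; have /complex_realP[k ek] := gtr0_real e0.
have k0 : 0 < k by rewrite -ltcR -ek.
have := archi_boundP (ltW (_ : 0 < k^-1)); rewrite invr_gt0 => /(_ k0) kn.
set n := Num.bound _ in kn; exists n.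
have e2 : (2 : C) = rc 2 by rewrite rmorph_nat.
rewrite ek e2 -rmorphXn -fmorphV ltcR invf_plt ?posrE ?exprn_gt0 //.
by apply: lt_trans kn _; rewrite -natrX ltr_nat ltn_expl.
Qed.

Lemma real_complex_continuous : continuous (rc : R -> C^o).
Proof.
move=> x U /nbhs_ballP[e /= e0 eU].
have /complex_realP[k ek] := gtr0_real e0.
have k0 : 0 < k by rewrite -ltcR -ek.
apply/nbhs_ballP; exists k => // y xy; apply: eU.
rewrite /ball /= -rmorphB normc_def /= expr0n /= addr0 sqrtr_sqr ek ltcR.
exact: xy.
Qed.

Lemma series_cvg_half (u : nat -> C^o) (c : C) : 0 <= c ->
  (forall t, 0 <= u t) -> (forall t, u t <= c * 2 ^- t) -> cvgn (series u).
Proof.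
move=> c0 u0 uc; have /complex_realP[k ck] := ger0_real c0.
have k0 : 0 <= k by move: c0; rewrite ck ler0c.
have [v uv] : exists v : nat -> R, forall t, u t = rc (v t).
  have : forall t, exists x, u t = rc x.
    by move=> t; have /complex_realP[x ux] := ger0_real (u0 t); exists x.
  by move=> /choice[v ?]; exists v.
have vcvg : cvgn (series v).
  apply: (@series_le_cvg _ _ (geometric k 2^-1)).
  - by move=> t; rewrite -ler0c -uv.
  - move=> t; by rewrite /geometric /= mulr_ge0 ?exprn_ge0 ?invr_ge0.
  - move=> t; rewrite -lecR -uv (_ : rc _ = c * 2 ^- t); first exact: uc.
    by rewrite ck /geometric /= rmorphM rmorphXn fmorphV rmorph_nat exprVn.
  - by apply: is_cvg_geometric_series; rewrite gtr0_norm ?invr_gt0 // invf_lt1 // ltr1n.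
have -> : series u = rc \o series v.
  apply/funext => n; rewrite /series /= rmorph_sum; apply: eq_bigr => t _.
  exact: uv.
apply/cvg_ex; exists (rc (limn (series v))).
by apply: continuous_cvg => //; exact: real_complex_continuous.
Qed.

End ComplexNumbers.

Section Completion.
Variables (R : realType) (V : tvsType R[i]).
Local Notation C := R[i].
Hypothesis V_hilbert : hilbert_topology V.
Variable Lam : V -> V -> C^o.
Hypothesis LamB : bilinear_for *:%R *:%R Lam.
Hypothesis Lam_continuous : continuous (fun p : V * V => Lam p.1 p.2).
Variables (E : tvsType C) (i : symtensor V -> E).
Hypothesis E_completion : is_completion i.

Local Notation Q := (@continuous_seminorm R E).

Let i_lin : linear i := completion_linear E_completion.

Let Qsn q : Q q -> is_seminorm q.
Proof. by case. Qed.

Let Q_nonempty : exists q, Q q.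
Proof. by have [q [Qq _]] := nbhs0_seminorm (@filterT _ (nbhs (0 : E)) _); exists q. Qed.

Let Qbasis := @continuous_seminorm_basis R E.

Let Q_separated x : (forall q, Q q -> q x = 0) -> x = 0.
Proof.
move=> x0; apply/esym/(completion_hausdorff E_completion) => A B nA nB.
have [_ /(_ x B) [xB _]] := Qbasis; move: (xB nB) => [q [Qq [e [e0 qB]]]].
exists 0; split; first exact: nbhs_singleton.
by apply: qB; rewrite sub0r (snN (Qsn Qq)) x0.
Qed.

Let Q_complete (F : set_system E) : ProperFilter F ->
  (forall q, Q q -> exists2 A, F A & forall x y, A x -> A y -> q (x - y) <= 1) ->
  exists l, forall q, Q q -> F [set x | q (x - l) < 1].
Proof.
move=> FF Fc; have [|l Fl] := completion_complete E_completion FF.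
  move=> U /nbhs0_seminorm[q [Qq qU]]; have [A FA qA] := Fc q Qq.
  by exists A => // x y Ax Ay; apply/qU/qA.
by exists l => q Qq; apply: Fl; exact: (basis_ball Qbasis).
Qed.

Let i_dense X q : Q q -> exists s, q (i s - X) < 1.
Proof.
move=> Qq; have := basis_ball Qbasis X Qq ltr01.
rewrite nbhsE => -[U0 [oU UX] Oq].
have [|Z [OZ [s _ sZ]]] := completion_dense E_completion _ oU; first by exists X.
by exists s; have := Oq _ OZ; rewrite /= -sZ.
Qed.

Let seminorm_comp q : Q q -> is_seminorm (fun s => q (i s)).
Proof.
move=> /Qsn sq; split=> [s|s s'|a s]; first exact: sn_ge0.
  by rewrite (linD i_lin) (snD sq).
by rewrite (linZ i_lin) (snZ sq).
Qed.

(** As [i] is a topological embedding, the continuous seminorms of [E] and the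
    seminorms [sym_norm h] dominate each other on symmetric tensors. *)
Let dominated_by_sym_norm q : Q q -> exists h c, 0 <= c /\
  forall s, q (i s) <= c * sym_norm h s.
Proof.
move=> Qq; have sq := Qsn Qq.
have := basis_ball Qbasis 0 Qq ltr01; rewrite nbhsE => -[U0 [oU U00] Oq].
have nO : nbhs (0 : symtensor V) (i @^-1` U0).
  apply: open_nbhs_nbhs; split; last by rewrite /= (lin0 i_lin).
  by apply/(completion_top E_completion); exists U0.
have [_ /(_ 0 (i @^-1` U0)) [ballO _]] := symtensor_basis V.
have [_ [[h ->] [e [e0 hO]]]] := ballO nO; exists h, (2 / e); split.
  by rewrite divr_ge0 ?ler0n ?ltW.
apply: (sn_dominated (seminorm_comp Qq) (sym_norm_seminorm h) e0) => s hs.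
by have := Oq (i s); rewrite /= subr0; apply; apply: hO; rewrite subr0.
Qed.

Let dominates_sym_norm h : exists q, Q q /\ forall s, sym_norm h s <= q (i s).
Proof.
have sh : exists h', sym_norm h = sym_norm h' by exists h.
have := basis_ball (symtensor_basis V) 0 sh ltr01.
rewrite nbhsE => -[W [oW W0] Wh].
have [B oB WB] : exists2 B : set E, open B & W = i @^-1` B.
  by apply/(completion_top E_completion).
have nB : nbhs (0 : E) B.
  by apply: open_nbhs_nbhs; split=> //; move: W0; rewrite WB /= (lin0 i_lin).
have [q [Qq qB]] := nbhs0_seminorm nB.
exists (fun x => 2 * q x); split.
  by apply: continuous_seminormZ; rewrite ?ler0n.
move=> s; rewrite -[2]divr1.
apply: (sn_dominated (sym_norm_seminorm h) (seminorm_comp Qq) ltr01) => s' qs'.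
by have := Wh s'; rewrite WB /= subr0; apply; apply/qB/ltW.
Qed.

Let term t a b : E := i (star_term Lam t a b).

Let term_lip q r : Q q -> 0 < r -> exists q' c, [/\ Q q', 0 <= c & forall t a a' b b',
  q (term t a b - term t a' b') <=
  c * r ^+ t * (q' (i a - i a') * q' (i b) + q' (i a') * q' (i b - i b'))].
Proof.
move=> Qq r0; have [h [k [k0 qh]]] := dominated_by_sym_norm Qq.
have [h' [c [c0 hc]]] := star_term_geometric V_hilbert LamB Lam_continuous h r0.
have [q' [Qq' hq']] := dominates_sym_norm h'.
have h'0 s : 0 <= sym_norm h' s by exact: tnorm_ge0.
exists q', (k * c); split=> // [|t a a' b b']; first exact: mulr_ge0.
have iB s s' : i s - i s' = i (s - s').
  by rewrite -scaleN1r -(linZ i_lin) -(linD i_lin) scaleN1r.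
have krt : 0 <= k * c * r ^+ t by rewrite !mulr_ge0 // exprn_ge0 // ltW.
have bnd x y : q (i (star_term Lam t x y)) <= k * c * r ^+ t * q' (i x) * q' (i y).
  apply: le_trans (qh _) _; apply: le_trans (ler_wpM2l k0 (hc t x y)) _.
  rewrite !mulrA; apply: ler_pM => //; first exact: mulr_ge0.
  by rewrite ler_wpM2l.
have := bilinear_bilipschitz (star_term_bilinear t LamB) (seminorm_comp Qq) bnd.
by move=> /(_ a a' b b'); rewrite /term !iB.
Qed.

Let QZ c q : 0 <= c -> Q q -> Q (fun x => c * q x).
Proof. exact: continuous_seminormZ. Qed.

Let QD p q : Q p -> Q q -> Q (fun x => p x + q x).
Proof. exact: continuous_seminormD. Qed.

Let archi := @complex_archi R.

Let M_exists : exists M : nat -> E -> E -> E,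
  forall t, extends Q i (term t) (M t).
Proof.
suff /choice[M HM] : forall t, exists N, extends Q i (term t) N by exists M.
move=> t; apply: (extension_exists Qsn QZ Q_complete QD Q_nonempty i_dense) => q Qq.
have [q' [c [Qq' c0 tl]]] := term_lip Qq (ltr01 : 0 < 1 :> C).
exists q', c; split=> // a a' b b'; apply: le_trans (tl t a a' b b') _.
by rewrite expr1n mulr1.
Qed.

Section Extended.
Variable M : nat -> E -> E -> E.
Hypothesis M_ext : forall t, extends Q i (term t) (M t).

Let M_eq t a b : M t (i a) (i b) = term t a b.
Proof. have := extends_eq Qsn QZ Q_separated (M_ext t) a b. by []. Qed.

Let M00 t : M t 0 0 = 0.
Proof.
have i0 := lin0 i_lin; rewrite -{1 2}i0 M_eq /term.
have [stl _] := star_term_bilinear t LamB.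
by rewrite (_ : star_term Lam t 0 0 = 0) //; exact: lin0 (stl 0).
Qed.

Let M_lip q r : Q q -> 0 < r -> exists q' c, [/\ Q q', 0 <= c &
  forall t, bilipschitz (M t) q q' (c * r ^+ t)].
Proof.
move=> Qq r0; have [q' [c [Qq' c0 tl]]] := term_lip Qq r0.
exists q', c; split=> // t.
apply: (extends_bilipschitz Qsn QZ QD i_dense (M_ext t) Qq Qq') => //.
by rewrite mulr_ge0 // exprn_ge0 // ltW.
Qed.

Let M_rate X Y q : Q q -> forall r, 0 < r ->
  exists c, 0 <= c /\ forall t, q (M t X Y) <= c * r ^+ t.
Proof.
move=> Qq r r0; have [q' [c [Qq' c0 ml]]] := M_lip Qq r0.
have sq' := Qsn Qq'; exists (c * (q' X * q' Y)); split=> [|t].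
  by rewrite !mulr_ge0 // (sn_ge0 sq').
have := ml t X 0 Y 0; rewrite M00 !subr0 (sn0 sq') mul0r addr0.
by rewrite mulrAC.
Qed.

Let pow_le (z : C) t : `|z ^+ t| <= 1 * `|z| ^+ t.
Proof. by rewrite mul1r normrX. Qed.

Lemma S_exists : exists S : C -> E -> E -> E, forall z X Y,
  is_psum Q (fun t => M t X Y) (fun t => z ^+ t) (S z X Y).
Proof.
have /choice[S HS] : forall p : C * E * E, exists s,
    is_psum Q (fun t => M t p.1.2 p.2) (fun t => p.1.1 ^+ t) s.
  move=> [[z X] Y] /=.
  exact: (psum_exists Qsn QZ Q_complete archi (M_rate X Y) ler01 (normr_ge0 z) (pow_le z)).
by exists (fun z X Y => S (z, X, Y)) => z X Y; exact: HS (z, X, Y).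
Qed.

Variable S : C -> E -> E -> E.
Hypothesis S_psum : forall z X Y,
  is_psum Q (fun t => M t X Y) (fun t => z ^+ t) (S z X Y).

Let remainder X Y q B c z n : Q q -> `|z| <= B ->
  series_bound (fun t => M t X Y) q B c ->
  q (S z X Y - \sum_(t < n) z ^+ t *: M t X Y) <= 2 * c * 2 ^- n.
Proof.
move=> Qq zB cB.
by have := f_remainder (fun z => @S_psum z X Y) n Qq zB cB.
Qed.

Lemma termE_extension z t : continuous_extension i
  (star_term (fun x y => z *: Lam x y) t) (fun X Y => z ^+ t *: M t X Y).
Proof.
split=> [|a b]; last by rewrite M_eq star_term_scale // (linZ i_lin).
apply: (@bilipschitz_continuous _ _ _ _ _ (fun X Y => z ^+ t *: M t X Y)
  Qbasis Qbasis) => q Qq; have sq := Qsn Qq.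
have [q' [c [Qq' c0 ml]]] := M_lip Qq (ltr01 : 0 < 1 :> C).
exists q', (`|z ^+ t| * c); split=> // [|X X' Y Y']; first exact: mulr_ge0.
rewrite -scalerBr (snZ sq) -mulrA ler_wpM2l //.
by have := ml t X X' Y Y'; rewrite expr1n mulr1.
Qed.

(** A sum of Lipschitz estimates whose constants decay geometrically. *)
Let S_lip z q : Q q -> exists q' c, [/\ Q q', 0 <= c & bilipschitz (S z) q q' c].
Proof.
move=> Qq; have sq := Qsn Qq; have z1 : 0 < 2 * (`|z| + 1).
  by rewrite mulr_gt0 ?ltr0n // ltr_wpDl.
have r0 : 0 < (2 * (`|z| + 1))^-1 by rewrite invr_gt0.
have [q' [c [Qq' c0 ml]]] := M_lip Qq r0; have q'0 := sn_ge0 (Qsn Qq').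
exists q', (2 * c); split=> // [|X X' Y Y']; first by rewrite mulr_ge0 ?ler0n.
set D := q' (X - X') * q' Y + q' X' * q' (Y - Y'); have D0 : 0 <= D by rewrite addr_ge0 // mulr_ge0.
have [c1 b1] := series_bound_exists Qsn (M_rate X Y) Qq (normr_ge0 z).
have [c2 b2] := series_bound_exists Qsn (M_rate X' Y') Qq (normr_ge0 z).
have [c10 _] := b1; have [c20 _] := b2.
apply: (le_of_le_add_half archi (K := 2 * c1 + 2 * c2)).
- exact: sn_real.
- by rewrite ger0_real // !mulr_ge0 ?ler0n.
- by rewrite addr_ge0 // mulr_ge0 ?ler0n.
move=> n; pose P X Y := \sum_(t < n) z ^+ t *: M t X Y.
have -> : S z X Y - S z X' Y' =
    (P X Y - P X' Y') + ((S z X Y - P X Y) - (S z X' Y' - P X' Y')).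
  have swap (x p y r : E) : x - p - (y - r) = x - y - (p - r).
    by rewrite opprD addrACA -opprD.
  by rewrite swap [RHS]addrC subrK.
apply: le_trans (snD sq _ _) _; apply: lerD; last first.
  apply: le_trans (snB sq _ _) _; rewrite mulrDl.
  by apply: lerD; [exact: remainder b1|exact: remainder b2].
rewrite /P -sumrB; apply: le_trans (sn_sum sq _ _ _) _.
apply: (@le_trans _ _ (\sum_(0 <= t < n) c * D * 2 ^- t)).
  rewrite big_mkord; apply: ler_sum => t _; rewrite -scalerBr (snZ sq) normrX.
  apply: (@le_trans _ _ ((`|z| + 1) ^+ t * (c * (2 * (`|z| + 1))^-1 ^+ t * D))).
    apply: ler_pM; rewrite ?(sn_ge0 sq) ?exprn_ge0 //; last exact: ml.
    by apply: lerXn2r; rewrite ?nnegrE ?addr_ge0 // lerDl.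
  by rewrite geometric_cancel // gt_eqF // ltr_wpDl.
rewrite -mulr_sumr; have := sum_half_lt C 0 n; rewrite invr1 mulr1 => le2.
apply: le_trans (ler_wpM2l _ le2) _; first exact: mulr_ge0.
by rewrite mulrC mulrA.
Qed.

(** On symmetric tensors the series has finitely many nonzero terms, so that its sum
    is the star product itself. *)
Lemma starE_extension z : continuous_extension i
  (star (fun x y => z *: Lam x y)) (S z).
Proof.
split; first exact: (bilipschitz_continuous Qbasis Qbasis (S_lip z)).
move=> a b; have zLamB := bilinear_scale z LamB.
have [N HN] := star_sum zLamB a b.
apply: (psum_eq Qsn Q_separated archi (M_rate _ _) ler01 (normr_ge0 z)
  (pow_le z) (@S_psum _ _ _) (N := N)) => n Nn.
rewrite (HN n Nn) (lin_sum i_lin); apply: eq_bigr => t _.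
by rewrite star_term_scale // (linZ i_lin) M_eq.
Qed.

Lemma termE_converges_absolutely z X Y :
  converges_absolutely (fun t => z ^+ t *: M t X Y).
Proof.
move=> p sp cp; have Qp : Q p by split.
have [c [c0 cB]] := series_bound_exists Qsn (M_rate X Y) Qp (normr_ge0 z).
apply: (series_cvg_half c0) => t /=; first exact: (sn_ge0 (Qsn Qp)).
by rewrite (snZ (Qsn Qp)) normrX.
Qed.

Lemma starE_converges_locally_uniformly X Y : converges_locally_uniformly
  (fun n z => series (fun t => z ^+ t *: M t X Y) n) (fun z => S z X Y).
Proof.
move=> z0; exists [set z : C^o | `|z0 - z| < 1].
  by apply/nbhs_ballP; exists 1 => //; exact: ltr01.
move=> N /nbhs0_seminorm[q [Qq qN]]; have sq := Qsn Qq.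
have B0 : 0 <= `|z0| + 1 by rewrite addr_ge0.
have [c cB] := series_bound_exists Qsn (M_rate X Y) Qq B0; have [c0 _] := cB.
have K0 : 0 < 2 * c + 1 by rewrite ltr_wpDl // mulr_ge0 ?ler0n.
have [n nK] : exists n, 2 ^- n < (2 * c + 1)^-1 :> C.
  by apply: archi; rewrite invr_gt0.
exists n => // m /= nm z zz0; apply: qN.
have zB : `|z| <= `|z0| + 1.
  rewrite -[z](subrK z0) addrC; apply: le_trans (ler_normD _ _) _.
  by rewrite lerD2l distrC ltW.
rewrite (sn_distC sq) /series /= big_mkord.
apply: le_trans (remainder m Qq zB cB) _.
have h2 k : 0 < 2 ^- k :> C by rewrite invr_gt0 exprn_gt0 ?ltr0n.
apply: (@le_trans _ _ ((2 * c + 1) * 2 ^- n)).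
  apply: ler_pM; rewrite ?mulr_ge0 ?ler0n ?(ltW (h2 _)) ?lerDl //.
  by rewrite lef_pV2 ?posrE ?exprn_gt0 ?ltr0n // ler_weXn2l ?ler1n.
by rewrite mulrC -ler_pdivlMr // mul1r ltW.
Qed.

Lemma starE_holomorphic X Y : holomorphic (fun z => S z X Y).
Proof.
move=> z; have [l Hl] := psum_derivative Qsn QZ Q_complete archi (M_rate X Y)
  (fun z => @S_psum z X Y) z.
exists l => U nU; have [_ /(_ l U) [U_ball _]] := Qbasis.
have [q [Qq [e [e0 qU]]]] := U_ball nU; have sq := Qsn Qq.
have [c [c0 Hc]] := Hl q Qq.
have ec : 0 < e + c by rewrite ltr_pwDl.
have d0 : 0 < e / (e + c) by rewrite divr_gt0.
have d1 : e / (e + c) <= 1 by rewrite ler_pdivrMr // mul1r lerDl.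
have := @dnbhs0_lt C C^o _ d0; apply: filterS2 (nbhs_dnbhs_neq (0 : C^o)).
move=> h h0 hd; apply: qU => /=.
have h1 : `|h| <= 1 by apply: le_trans d1; exact: ltW.
have hp : 0 < `|h| by rewrite normr_gt0.
have -> : h^-1 *: (S (z + h) X Y - S z X Y) - l =
    h^-1 *: (S (z + h) X Y - S z X Y - h *: l).
  by rewrite [RHS]scalerBr scalerA mulVf // scale1r.
rewrite (snZ sq) normfV ltr_pdivrMl //; apply: le_lt_trans (Hc h h1) _.
rewrite expr2 mulrCA ltr_pM2l //.
apply: (@le_lt_trans _ _ ((e + c) * `|h| - e * `|h|)).
  by rewrite mulrDl addrC addKr.
rewrite ltrBlDr; apply: (@lt_le_trans _ _ e); last by rewrite lerDl mulr_ge0 // ltW.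
by rewrite mulrC -ltr_pdivlMr.
Qed.

End Extended.

Lemma star_completion : exists (termE : C^o -> nat -> E -> E -> E)
    (starE : C^o -> E -> E -> E),
  [/\ forall z t, continuous_extension i
        (star_term (fun x y => z *: Lam x y) t) (termE z t),
      forall z, continuous_extension i
        (star (fun x y => z *: Lam x y)) (starE z)
    & forall X Y : E,
      [/\ forall z, converges_absolutely (fun t => termE z t X Y),
          converges_locally_uniformly
            (fun n z => series (fun t => termE z t X Y) n)
            (fun z => starE z X Y)
        & holomorphic (fun z => starE z X Y)]].
Proof.
have [M HM] := M_exists; have [S HS] := S_exists HM.
exists (fun z t X Y => z ^+ t *: M t X Y), S; split=> [z t|z|X Y].
- exact: termE_extension.
- exact: starE_extension.
split=> [z||].
- exact: termE_converges_absolutely.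
- exact: starE_converges_locally_uniformly.
- exact: starE_holomorphic.
Qed.

End Completion.

Theorem theorem2p13 (R : realType) (V : tvsType R[i])
    (V_hausdorff : hausdorff_space V) (V_hilbert : hilbert_topology V)
    (Lam : V -> V -> R[i]^o) (Lam_bilinear : bilinear_for *:%R *:%R Lam)
    (Lam_continuous : continuous (fun p : V * V => Lam p.1 p.2)) :
  [/\ continuous (fun p : symtensor V * symtensor V => star Lam p.1 p.2),
      lc_algebra (star Lam)
    & forall (E : tvsType R[i]) (i : symtensor V -> E), is_completion i ->
      exists (termE : R[i]^o -> nat -> E -> E -> E)
             (starE : R[i]^o -> E -> E -> E),
      [/\ forall z t, continuous_extension i
            (star_term (fun x y => z *: Lam x y) t) (termE z t),
          forall z, continuous_extension i
            (star (fun x y => z *: Lam x y)) (starE z)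
        & forall X Y : E,
          [/\ forall z, converges_absolutely (fun t => termE z t X Y),
              converges_locally_uniformly
                (fun n z => series (fun t => termE z t X Y) n)
                (fun z => starE z X Y)
            & holomorphic (fun z => starE z X Y)]]].
Proof.
split=> [||E i Ei].
- exact: star_continuous.
- exact: star_lc_algebra.
- exact: star_completion.
Qed.
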